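(* Let $\Bbbk$ be a field of characteristic zero. The $\Bbbk\mathfrak S_n$-modules $\mathrm{OS}(\mathrm{Br}_n)^!_i$: (i) are permutation modules for $i=0,1$ (all $n$); (ii) are half-permutation modules for $i=2$ (all $n$), meaning that $2\cdot[\mathrm{OS}(\mathrm{Br}_n)^!_2]$ is the class of a permutation module in $R_\Bbbk(\mathfrak S_n)$; (iii) are permutation modules for $n=1,2,3,4,5$ (all $i$). However, $\mathrm{OS}(\mathrm{Br}_6)^!_5$ and $\mathrm{OS}(\mathrm{Br}_7)^!_5$ are not permutation modules, and no positive integer multiple of their classes is the class of a permutation module (they have negative character values).
   Context: $\mathrm{OS}(\mathrm{Br}_n)=\bigwedge_\Bbbk(x_{ij}:1\le i<j\le n)/(x_{ij}x_{ik}-x_{ij}x_{jk}+x_{ik}x_{jk}:1\le i<j<k\le n)$, a Koszul algebra with $\mathfrak S_n$ acting by $\sigma(x_{ij})=x_{\sigma(i)\sigma(j)}$ (convention $x_{ji}=x_{ij}$). Its Koszul dual is $\mathrm{OS}(\mathrm{Br}_n)^!=\Bbbk\langle y_{ij}\rangle/(I_2^\perp)$, where $\mathrm{OS}(\mathrm{Br}_n)=\Bbbk\langle x_{ij}\rangle/I$ as a quadratic quotient of the free associative algebra and $(y_ay_b,x_cx_d)=\delta_{ac}\delta_{bd}$; $\mathfrak S_n$ acts by the same rule on the $y_{ij}$, and $\mathrm{OS}(\mathrm{Br}_n)^!_i$ is its degree-$i$ component. A permutation module is $\Bbbk[X]$ for a finite $\mathfrak S_n$-set $X$. $R_\Bbbk(\mathfrak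 S_n)$ is the Grothendieck ring of finite-dimensional $\Bbbk\mathfrak S_n$-modules. *)

(* Defs.v *)
From mathcomp Require Import all_boot all_order all_algebra all_fingroup.
From mathcomp Require Import mxrepresentation.
Set Implicit Arguments. Unset Strict Implicit. Unset Printing Implicit Defensive.
Import GRing.Theory.
Local Open Scope ring_scope.

(* Generators: x_{ij} (resp. y_{ij}), indexed by 2-element subsets {i,j} of   *)
(* 'I_n (so the convention x_{ji} = x_{ij} is built in).  S_n acts by         *)
(* s({i,j}) = {s i, s j}.                                                     *)
(* T^i := degree-i part of the free associative algebra, with basis the words *)
(* of length i in the generators; vectors are row vectors indexed (through    *)
(* enum_rank) by the finite type of words.  The pairing                        *)
(* (y_a y_b, x_c x_d) = delta_ac delta_bd identifies coordinates of T^2(y)     *)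
(* and T^2(x) word by word.                                                    *)

Section OSdual.

Variable k : fieldType.

Definition gen (n : nat) := {A : {set 'I_n} | #|A| == 2%N}.

Lemma gen_act_proof n (s : 'S_n) (A : gen n) : #|s @: val A| == 2%N.
Proof. by rewrite card_imset ?(valP A) //; apply: perm_inj. Qed.

Definition gen_act n (s : 'S_n) (A : gen n) : gen n :=
  exist _ (s @: val A) (gen_act_proof s A).

Definition word (n i : nat) := {ffun 'I_i -> gen n}.

Definition word_act n i (s : 'S_n) (w : word n i) : word n i :=
  [ffun t => gen_act s (w t)].

(* the permutation action of S_n on T^i (row-vector convention, so that    *)
(* rho (s * t) = rho s *m rho t with MathComp's composition of perms)      *)
Definition Tmx n i (s : 'S_n) : 'M[k]_#|word n i| :=
  \matrix_(u, v) ((word_act s (enum_val u) == enum_val v)%:R).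

(* quadratic relations I_2 of OS(Br_n) inside T^2(x):                       *)
(*  - x_a x_b + x_b x_a  (all a, b; for a = b this is 2 x_a^2, and char k = 0) *)
(*  - x_{ij} x_{ik} - x_{ij} x_{jk} + x_{ik} x_{jk}   (i < j < k)           *)
Definition relidx n := ((gen n * gen n) + ('I_n * 'I_n * 'I_n))%type.

Definition is_word2 n (w : word n 2) (A B : {set 'I_n}) : bool :=
  (val (w ord0) == A) && (val (w ord_max) == B).

Definition relcoef n (r : relidx n) (w : word n 2) : k :=
  match r with
  | inl (A, B) => (is_word2 w (val A) (val B))%:R + (is_word2 w (val B) (val A))%:R
  | inr (a, b, c) =>
      if (a < b < c)%N then
        (is_word2 w [set a; b] [set a; c])%:R
        - (is_word2 w [set a; b] [set b; c])%:R
        + (is_word2 w [set a; c] [set b; c])%:R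
      else 0
  end.

Definition I2mx n : 'M[k]_(#|{: relidx n}|, #|word n 2|) :=
  \matrix_(r, c) relcoef (enum_val r) (enum_val c).

Definition I2perp n : 'M[k]_#|word n 2| := kermx (I2mx n)^T.

Definition splice n i (w : word n i) (p : 'I_i) (x : word n 2) : word n i :=
  [ffun t => if val t == val p then x ord0
             else if val t == (val p).+1 then x ord_max else w t].

(* generators of the degree-i part J_i of the ideal generated by I_2^perp: *)
(* u * f * v with f a row of I2perp (spanning I_2^perp), u, v words        *)
Definition Jidx n i := ('I_i * word n i * 'I_#|word n 2|)%type.

Definition Jmx n i : 'M[k]_(#|{: Jidx n i}|, #|word n i|) :=
  \matrix_(r, c)
    let: (p, w, q) := enum_val r in
    if ((val p).+1 < i)%N then
      \sum_(x : word n 2) I2perp n q (enum_rank x) * (enum_val c == splice w p x)%:R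
    else 0.

Definition Jsq n i : 'M[k]_#|word n i| := <<Jmx n i>>%MS.

(* OS(Br_n)^!_i = T^i(y) / J_i, with the induced S_n action (same formula *)
(* as MathComp's factmod_mx).                                              *)
Definition OSdual_mx n i (s : 'S_n) : 'M[k]_(\rank (cokermx (Jsq n i))) :=
  in_factmod (Jsq n i) (val_factmod 1%:M *m Tmx i s).

Definition permrep n (X : finType) (to : {action 'S_n &-> X}) (s : 'S_n)
  : 'M[k]_#|X| :=
  \matrix_(u, v) ((to (enum_val u) s == enum_val v)%:R).

Definition perm_module n d (rho : 'S_n -> 'M[k]_d) : Prop :=
  exists (X : finType) (to : {action 'S_n &-> X}) (B : 'M[k]_(d, #|X|)),
    [/\ d = #|X|, row_free B & forall s, rho s *m B = B *m permrep to s].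

Definition dsum n d c (rho : 'S_n -> 'M[k]_d) (s : 'S_n)
  : 'M[k]_(\sum_(j < c) d) :=
  \mxdiag_(j < c) rho s.

End OSdual.

Arguments OSdual_mx {k} n i s.
Arguments dsum {k n d} c rho s.
Arguments perm_module {k n d} rho.
Arguments permrep {k n X} to s.

(* Main.v *)
Require Import Defs.
From mathcomp Require Import all_boot all_order all_algebra all_fingroup.
From mathcomp Require Import mxrepresentation ring zify.
From Stdlib Require Import FunctionalExtensionality.
Set Implicit Arguments. Unset Strict Implicit. Unset Printing Implicit Defensive.
Import GRing.Theory.
Local Open Scope ring_scope.

(** In characteristic zero two representations of a finite group with equal
    characters are isomorphic, so everything reduces to the characters A_i of
    OS(Br_n)^!_i.

    The dual algebra is the enveloping algebra of the Drinfeld-Kohno Lie algebra,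
    hence has a basis of products of words in the free algebras on
    y_(0,m), ..., y_(m-1,m) for m < n.  With the no-broken-circuit basis of
    OS(Br_n) this makes the Koszul complex explicit; it is exact by induction on n
    (integration along the fibre of Br_(m+1) -> Br_m).  The Lefschetz principle
    gives, with E_j the character of the degree-j part of OS(Br_n),
    sum_j (-1)^j E_j A_(N-j) = 0 for N > 0.

    The E_j are computed on class representatives.  For n <= 5 the recurrence
    propagates an expression of A_(i+t) - A_i as a nonnegative combination of
    permutation characters; for n = 6, 7 it gives A_5(s) = -1 on a 6-cycle s.

    In degree 2 the trace is read off the orthogonal projection of words onto the
    relations: a pair of edges sharing a vertex is an ordered triple of points, and
    2 A_2 counts twice the unordered pairs of equal or disjoint edges, once the
    ordered triples and once the cyclically oriented triples. *)

(** Neither algebra is built from formal sums. An element of OS(Br_n) is its coefficient function on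
    [OSbasis n], a linear form on the dual algebra is a function on [PBWword n], and multiplication
    by a generator is a linear functional in that function ([X i j b], [Y i j s]). Both recursions
    peel off the vertex of largest index, so they can be combined in the Koszul complex, and
    functionals in different variables commute. The quotient T^i / J_i is reached through forms
    only: those killed by J_i are the functions on edge words that respect the relations, and each
    is determined by its values on normal words. The Koszul differential sums over ordered pairs of
    vertices, so that no order of the vertices interferes with the symmetric group; the resulting
    factors 2 and 6 are inverted in characteristic zero. For fixed n <= 5 infinitely many degrees
    remain. At each permutation A_i obeys a linear recurrence of order n-1, and the multiplicities
    are chosen so that the added permutation character obeys it too; then n-1 values per conjugacy
    class settle all degrees. *)

Ltac decide_eqs := repeat (match goal with
  | H : is_true (?a != ?b) |- context [?a == ?b] => rewrite (negbTE H)
  | H : is_true (?a != ?b) |- context [?b == ?a] => rewrite [b == a]eq_sym (negbTE H)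
  | |- context [?a == ?a] => rewrite (eqxx a)
  end); rewrite /=.

(** * Linear functionals on spaces of functions *)

Section Linear.
Variables (k : fieldType) (T : Type).

Definition lin (L : (T -> k) -> k) :=
  forall a f g, L (fun x => a * f x + g x) = a * L f + L g.

Variable L : (T -> k) -> k.
Hypothesis linL : lin L.

Lemma lin0 : L (fun _ => 0) = 0.
Proof.
have := linL 1 (fun _ => 0) (fun _ => 0).
have -> : (fun _ : T => 1 * 0 + 0 : k) = (fun _ => 0).
  by apply: functional_extensionality => x; rewrite mulr0 addr0.
by rewrite mul1r => /esym/eqP; rewrite -subr_eq0 addrK => /eqP.
Qed.

Lemma linZ a f : L (fun x => a * f x) = a * L f.
Proof.
rewrite -[RHS]addr0 -lin0 -linL; congr L.
by apply: functional_extensionality => x; rewrite addr0.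
Qed.

Lemma linD f g : L (fun x => f x + g x) = L f + L g.
Proof.
rewrite -[L f]mul1r -linL; congr L.
by apply: functional_extensionality => x; rewrite mul1r.
Qed.

Lemma linN f : L (fun x => - f x) = - L f.
Proof.
rewrite -mulN1r -linZ; congr L.
by apply: functional_extensionality => x; rewrite mulN1r.
Qed.

Lemma linB f g : L (fun x => f x - g x) = L f - L g.
Proof. by rewrite linD linN. Qed.

Lemma lin_sum I (r : seq I) (P : pred I) (F : I -> T -> k) :
  L (fun x => \sum_(i <- r | P i) F i x) = \sum_(i <- r | P i) L (F i).
Proof.
elim: r => [|i r IH].
  rewrite big_nil -[RHS]lin0; congr (L _).
  by apply: functional_extensionality => x; rewrite big_nil.
rewrite big_cons -IH; case: ifP => Pi; [rewrite -linD|]; congr (L _);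
  by apply: functional_extensionality => x; rewrite big_cons Pi.
Qed.

End Linear.

(** * The dual algebra as an iterated semidirect product of free algebras *)

Section PBW.
Variable k : fieldType.

Definition sgn_at (i j x : nat) : k := (x == i)%:R - (x == j)%:R.

(* D i j w F is F at the image of w under the derivation i |-> [i, j], j |-> [j, i] of the
   free algebra, i.e. under the adjoint action of y_ij on the letters y_im. *)
Fixpoint D (i j : nat) (w : seq nat) (F : seq nat -> k) : k :=
  if w is x :: v then
    sgn_at i j x * (F [:: i, j & v] - F [:: j, i & v]) + D i j v (fun u => F (x :: u))
  else 0.

Lemma D_linear i j w : lin (D i j w).
Proof.
move=> a; elim: w => [|x w IH] f g /=; first by ring.
by rewrite IH; ring.
Qed.

(** [D i j w] is a finite combination of evaluations, so it commutes with every linear functional in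
    another variable. This is how operators on the two factors of a PBW word are exchanged. *)
Lemma D_lin U (L : (U -> k) -> k) (F : seq nat -> U -> k) i j w : lin L ->
  D i j w (fun v => L (F v)) = L (fun u => D i j w (fun v => F v u)).
Proof.
move=> HL; elim: w F => [|x w IH] F /=; first by rewrite (lin0 HL).
by rewrite IH HL linB.
Qed.

Lemma D_sym i j w F : D i j w F = D j i w F.
Proof.
elim: w F => [|x w IH] F //=; rewrite IH /sgn_at; ring.
Qed.

Lemma D_disjoint i j l m w F : uniq [:: i; j; l; m] ->
  D i j w (fun v => D l m v F) = D l m w (fun v => D i j v F).
Proof.
move=> U; elim: w F => [|x w IH] F //=.
rewrite !(linD (D_linear _ _ _)) !(linZ (D_linear _ _ _)) !(linB (D_linear _ _ _)).
rewrite IH /sgn_at.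
move: U; rewrite /= !inE !negb_or !andbA !andbT.
move=> /andP[/andP[/andP[/andP[/andP[ij il] im] jl] jm] lm].
decide_eqs; ring.
Qed.

(** A commutator of derivations is a derivation, so the relation has to be checked on one letter
    only: the induction hypothesis absorbs the tail and the head is i, j, l or none of them. The
    inner [D] is applied last. *)
Lemma D_triangle i j l w F : uniq [:: i; j; l] ->
  D i j w (fun v => D i l v F + D j l v F) =
  D i l w (fun v => D i j v F) + D j l w (fun v => D i j v F).
Proof.
move=> U; elim: w F => [|x w IH] F //=; first by ring.
have E (a b c d : nat) (f : seq nat -> k) : D a b w (fun v => D c d (x :: v) f) =
   sgn_at c d x * (D a b w (fun v => f [:: c, d & v]) - D a b w (fun v => f [:: d, c & v]))
    + D a b w (fun v => D c d v (fun u => f (x :: u))).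
  by rewrite /= (linD (D_linear _ _ _)) (linZ (D_linear _ _ _)) (linB (D_linear _ _ _)).
have := IH (fun u => F (x :: u)).
rewrite (linD (D_linear _ _ _)) => IHx.
rewrite (linD (D_linear _ _ _)) !E /=.
have {}IHx := canRL (addrK _) IHx; rewrite IHx.
move: U; rewrite /= !inE !negb_or !andbA !andbT => /andP[/andP[ij il] jl].
rewrite /sgn_at.
have [<-|ix] := eqVneq i x.
  decide_eqs; ring.
have [<-|jx] := eqVneq j x.
  decide_eqs; ring.
have [<-|lx] := eqVneq l x; decide_eqs; ring.
Qed.

(* The head letters x stand for y_(x, n-1); functions on PBWword n are linear forms on the
   dual algebra. *)
Fixpoint PBWword (n : nat) : eqType := if n is m.+1 then (seq nat * PBWword m)%type else unit.

(* Y i j s F is the value of the form F at y_ij * s. *)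
Fixpoint Y (n i j : nat) : PBWword n -> (PBWword n -> k) -> k :=
  match n with
  | 0 => fun _ _ => 0
  | m.+1 => fun s F => let: (w, u) := s in
      if j == m then F (i :: w, u)
      else if i == m then F (j :: w, u)
      else D i j w (fun v => F (v, u)) + @Y m i j u (fun v => F (w, v))
  end.
Arguments Y {n}.

Lemma Y_linear n i j (s : PBWword n) : lin (Y i j s).
Proof.
move=> a; elim: n s => [|n IH] s f g /=; first by ring.
case: s => w u; case: ifP => // _; case: ifP => // _.
by rewrite IH D_linear; ring.
Qed.

Lemma Y_sym n i j (s : PBWword n) F : Y i j s F = Y j i s F.
Proof.
elim: n s F => [|n IH] //= [w u] F.
case: (eqVneq j n) => [->|_]; case: (eqVneq i n) => [?|_] //; first by subst i.
by rewrite D_sym IH.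
Qed.

Lemma DY_comm n i j a b w (u : PBWword n) (F : seq nat -> PBWword n -> k) :
  D i j w (fun v => Y a b u (F v)) = Y a b u (fun x => D i j w (fun v => F v x)).
Proof. by rewrite D_lin //; apply: Y_linear. Qed.

Lemma Y_disjoint n i j l m (s : PBWword n) F : uniq [:: i; j; l; m] ->
  Y i j s (fun v => Y l m v F) = Y l m s (fun v => Y i j v F).
Proof.
move=> U; elim: n s F => [|n IH] //= [w u] F.
have DU := D_disjoint w _ U.
move: U; rewrite /= !inE !negb_or !andbA !andbT.
move=> /andP[/andP[/andP[/andP[/andP[ij il] im] jl] jm] lm].
rewrite /=.
have [?|jn] := eqVneq j n; [subst j|have [?|i_n] := eqVneq i n; [subst i|
  have [?|m_n] := eqVneq m n; [subst m|have [?|ln] := eqVneq l n; [subst l|]]]].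
- rewrite /sgn_at; decide_eqs; ring.
- rewrite /sgn_at; decide_eqs; ring.
- rewrite /sgn_at; decide_eqs; ring.
- rewrite /sgn_at; decide_eqs; ring.
decide_eqs.
rewrite !(linD (D_linear _ _ _)) !(linD (Y_linear _ _ _)) DU IH.
rewrite !DY_comm; ring.
Qed.

(** If the top vertex belongs to the triangle, the relation is the defining rule y_ij w = [y_ij, w]
    + w y_ij. Otherwise it holds on each factor separately, and the mixed terms cancel because [D]
    and [Y] commute. *)
Lemma Y_triangle n i j l (s : PBWword n) F : uniq [:: i; j; l] ->
  Y i j s (fun v => Y i l v F + Y j l v F) =
  Y i l s (fun v => Y i j v F) + Y j l s (fun v => Y i j v F).
Proof.
move=> U; elim: n s F => [|n IH] /=; first by move=> *; ring.
move=> [w u] F.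
have DU G := D_triangle w G U.
move: U; rewrite /= !inE !negb_or !andbA !andbT => /andP[/andP[ij il] jl].
have [?|jn] := eqVneq j n; [subst j|have [?|i_n] := eqVneq i n; [subst i|
  have [?|ln] := eqVneq l n; [subst l|]]].
- rewrite /sgn_at; decide_eqs; ring.
- rewrite /sgn_at; decide_eqs; ring.
- decide_eqs; rewrite (linD (D_linear _ _ _)) (linD (Y_linear _ _ _)) /sgn_at; decide_eqs; ring.
decide_eqs.
have := DU (fun v => F (v, u)); have := IH u (fun v => F (w, v)).
rewrite !(linD (D_linear _ _ _)) !(linD (Y_linear _ _ _)) => E1 E2.
rewrite (canRL (addrK _) E1) (canRL (addrK _) E2).
rewrite !DY_comm; ring.
Qed.

End PBW.
Arguments Y {k n}.

(** * Edge words evaluated in the PBW module; existence and uniqueness of normal forms *)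

Section Evaluation.
Variable k : fieldType.
Implicit Types (n i j m : nat) (l : seq (nat * nat)).

Fixpoint PBWvalid n : PBWword n -> bool :=
  if n is m.+1 then fun s => all (ltn^~ m) s.1 && PBWvalid s.2 else xpredT.

Fixpoint PBWdegree n : PBWword n -> nat :=
  if n is m.+1 then fun s => (size s.1 + PBWdegree s.2)%N else fun _ => 0.

Fixpoint PBWone n : PBWword n := if n is m.+1 then ([::], PBWone m) else tt.

Fixpoint flat n : PBWword n -> seq (nat * nat) :=
  if n is m.+1 then fun s => [seq (x, m) | x <- s.1] ++ flat s.2 else fun _ => [::].

Lemma size_flat n (s : PBWword n) : size (flat s) = PBWdegree s.
Proof. by elim: n s => [|n IH] //= [w u]; rewrite size_cat size_map IH. Qed.

Lemma D_local n i j w (F G : seq nat -> k) : (i < n)%N -> (j < n)%N ->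
  (forall v, all (ltn^~ n) v -> size v = (size w).+1 -> F v = G v) ->
  all (ltn^~ n) w -> D i j w F = D i j w G.
Proof.
move=> lti ltj; elim: w F G => [|x w IH] F G FG //= /andP[ltx Hw].
rewrite !FG ?(IH (fun u => F (x :: u)) (fun u => G (x :: u))) //= ?lti ?ltj //.
by move=> v Hv Sv; rewrite FG //= ?ltx // Sv.
Qed.

Lemma Y_local n i j (s : PBWword n) (F G : PBWword n -> k) : (i < n)%N -> (j < n)%N -> i != j ->
  (forall v, PBWvalid v -> PBWdegree v = (PBWdegree s).+1 -> F v = G v) ->
  PBWvalid s -> Y i j s F = Y i j s G.
Proof.
elim: n s F G => [|n IH] //= [w u] F G lti ltj ij FG /= /andP[Hw Hu].
have [jn|jn] := eqVneq j n.
  by rewrite FG //= Hu Hw !andbT; move: ij lti; rewrite jn; lia.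
have [i_n|i_n] := eqVneq i n.
  by rewrite FG //= Hu Hw !andbT; move: ij ltj; rewrite i_n; lia.
have lti' : (i < n)%N by lia.
have ltj' : (j < n)%N by lia.
congr (_ + _).
  by apply: (D_local lti' ltj') => // v Hv Sv; rewrite FG //= ?Hv // Sv.
by apply: IH => // v Hv Sv; rewrite FG //= ?Hw // Sv addnS.
Qed.

(** Forms compose inside out: the head of [l] is the leftmost factor of the product at which [F] is
    finally evaluated. *)
Fixpoint Y_seq n l (F : PBWword n -> k) : PBWword n -> k :=
  if l is a :: l' then Y_seq l' (fun s => Y a.1 a.2 s F) else F.

Definition ev n l (F : PBWword n -> k) : k := Y_seq l F (PBWone n).

Lemma Y_seq_cat n l1 l2 (F : PBWword n -> k) : Y_seq (l1 ++ l2) F = Y_seq l2 (Y_seq l1 F).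
Proof. by elim: l1 F => //= a l1 IH F; rewrite IH. Qed.

Lemma Y_seq_linear n l (s : PBWword n) : lin (fun F => Y_seq l F s).
Proof.
move=> a f g; elim: l f g => [|b l IH] f g //=; rewrite -IH; congr (Y_seq l _ s).
by apply: functional_extensionality => x; rewrite Y_linear.
Qed.

Lemma ev_linear n l : lin (@ev n l).
Proof. exact: Y_seq_linear. Qed.

Definition valid n (a : nat * nat) := [&& (a.1 < n)%N, (a.2 < n)%N & a.1 != a.2].

Lemma PBWvalid_one n : PBWvalid (PBWone n).
Proof. by elim: n. Qed.

Lemma PBWdegree_one n : PBWdegree (PBWone n) = 0%N.
Proof. by elim: n. Qed.

Lemma Y_seq_local n l (s : PBWword n) (F G : PBWword n -> k) : all (valid n) l -> PBWvalid s ->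
  (forall v, PBWvalid v -> PBWdegree v = (PBWdegree s + size l)%N -> F v = G v) ->
  Y_seq l F s = Y_seq l G s.
Proof.
elim: l F G => [|a l IH] F G /=; first by move=> _ Hs; apply; rewrite ?addn0.
move=> /andP[/and3P[a1 a2 a12] Hl] Hs FG; apply: IH => // v Hv Dv.
by apply: Y_local => // x Hx Dx; rewrite FG // Dx Dv addnS.
Qed.

Lemma ev_local n l (F G : PBWword n -> k) : all (valid n) l ->
  (forall v, PBWvalid v -> PBWdegree v = size l -> F v = G v) -> ev l F = ev l G.
Proof. by move=> Hl FG; apply: Y_seq_local; rewrite ?PBWvalid_one ?PBWdegree_one. Qed.

Lemma flat_valid n (s : PBWword n) : PBWvalid s -> all (valid n) (flat s).
Proof.
elim: n s => [|n IH] //= [w u] /= /andP[Hw Hu]; rewrite all_cat all_map.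
apply/andP; split.
  by apply: sub_all Hw => x /= Hx; rewrite /valid /=; lia.
by apply: sub_all (IH _ Hu) => -[a b]; rewrite /valid /=; lia.
Qed.

(** The independence half of PBW: a normal word, multiplied out on the unit, gives itself back, so
    the normal words can be separated by forms. *)
Lemma ev_flat n (s : PBWword n) (F : PBWword n -> k) : PBWvalid s -> ev (flat s) F = F s.
Proof.
rewrite /ev; elim: n s F => [|n IH] /=; first by case.
move=> [w u] F /= /andP[Hw Hu]; rewrite Y_seq_cat.
have -> : @Y_seq n.+1 [seq (x, n) | x <- w] F = fun s => F (w ++ s.1, s.2).
  elim: w F {Hw} => [|x w IHw] F /=; first by apply: functional_extensionality; case.
  by rewrite IHw; apply: functional_extensionality => -[v z] /=; rewrite eqxx.
have := IH u (fun v => F (w, v)) Hu.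
have E l (z : PBWword n) (G : PBWword n.+1 -> k) : all (valid n) l ->
    Y_seq l G ([::], z) = Y_seq l (fun v => G ([::], v)) z.
  elim: l G => [|[a b] l IHl] G //= /andP[/and3P[/= a1 b1 ab] Hl].
  rewrite IHl //; congr (Y_seq l _ z); apply: functional_extensionality => s /=.
  have -> : b == n = false by lia.
  have -> : a == n = false by lia.
  by rewrite add0r.
rewrite E ?flat_valid // => <-; congr (Y_seq _ _ _).
by apply: functional_extensionality => v /=; rewrite cats0.
Qed.

(** The forms on edge words that descend to the dual algebra: they vanish on y_ij = y_ji,
    [y_ij, y_ab] = 0 and [y_ij, y_ia + y_ja] = 0 placed between arbitrary words. *)
Record word_rels n (P : seq (nat * nat) -> k) : Prop := WordRels {
  wr_sym : forall l1 l2 i j, P (l1 ++ (i, j) :: l2) = P (l1 ++ (j, i) :: l2);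
  wr_disjoint : forall l1 l2 i j a b, uniq [:: i; j; a; b] ->
    all (ltn^~ n) [:: i; j; a; b] ->
    P (l1 ++ [:: (i, j), (a, b) & l2]) = P (l1 ++ [:: (a, b), (i, j) & l2]);
  wr_triangle : forall l1 l2 i j a, uniq [:: i; j; a] -> all (ltn^~ n) [:: i; j; a] ->
    P (l1 ++ [:: (i, j), (i, a) & l2]) + P (l1 ++ [:: (i, j), (j, a) & l2]) =
    P (l1 ++ [:: (i, a), (i, j) & l2]) + P (l1 ++ [:: (j, a), (i, j) & l2]) }.

(** The renaming [f] is built in, because the same statement is needed for the action of a
    permutation on forms. *)
Lemma ev_rels N n (F : PBWword n -> k) (f : nat -> nat) :
  {in ltn^~ N &, injective f} ->
  word_rels N (fun l => ev [seq (f a.1, f a.2) | a <- l] F).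
Proof.
move=> inj_f.
have Uf s : uniq s -> all (ltn^~ N) s -> uniq (map f s).
  by move=> Us As; rewrite map_inj_in_uniq // => x y /(allP As) Hx /(allP As) Hy; apply: inj_f.
split=> [l1 l2 i j|l1 l2 i j a b U A|l1 l2 i j a U A];
  rewrite /ev !map_cat !Y_seq_cat /=; move: (Y_seq (map _ l1) F) => G.
- congr (Y_seq _ _ _); apply: functional_extensionality => s; exact: Y_sym.
- congr (Y_seq _ _ _); apply: functional_extensionality => s.
  by apply/esym/(Y_disjoint _ _ (Uf _ U A)).
rewrite -!(linD (Y_seq_linear _ _)); congr (Y_seq _ _ _).
apply: functional_extensionality => s.
by rewrite -(Y_triangle _ _ (Uf _ U A)) (linD (Y_linear _ _ _)).
Qed.

(** Rewriting to normal form with the relations alone: moving y_ij to the right across the letters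
    (x, n) costs one commutator at each letter i or j, and these commutators add up to [D]. *)
Lemma rels_Y N n (P : seq (nat * nat) -> k) l i j (s : PBWword n) : word_rels N P ->
  (n <= N)%N -> (i < n)%N -> (j < n)%N -> i != j -> PBWvalid s ->
  P (l ++ (i, j) :: flat s) = Y i j s (fun v => P (l ++ flat v)).
Proof.
move=> HP; elim: n s l => [|n IH] //= [w u] l ltnN lti ltj ij /= /andP[Hw Hu].
have [->|jn] := eqVneq j n; first by [].
have [->|i_n] := eqVneq i n; first exact: (wr_sym HP).
have lti' : (i < n)%N by lia.
have ltj' : (j < n)%N by lia.
have -> : P (l ++ (i, j) :: [seq (x, n) | x <- w] ++ flat u) =
  D i j w (fun v => P (l ++ [seq (x, n) | x <- v] ++ flat u)) +
  P ((l ++ [seq (x, n) | x <- w]) ++ (i, j) :: flat u).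
  elim: w Hw l => [|x w IHw] /=; first by move=> _ l; rewrite add0r cats0.
  move=> /andP[ltx Hw] l.
  have {}IHw := IHw Hw (rcons l (x, n)).
  have E : (fun v => P (l ++ (x, n) :: [seq (x0, n) | x0 <- v] ++ flat u)) =
     fun v => P (rcons l (x, n) ++ [seq (x0, n) | x0 <- v] ++ flat u).
    by apply: functional_extensionality => v; rewrite cat_rcons.
  rewrite E -[RHS]addrA -[l ++ (x, n) :: map _ w]cat_rcons -IHw cat_rcons /sgn_at.
  have xn : x != n by lia.
  have [xi|xi] := eqVneq x i.
    subst x; rewrite (negbTE ij) subr0 mul1r.
    have U : uniq [:: i; n; j] by rewrite /= !inE; lia.
    have A : all (ltn^~ N) [:: i; n; j] by rewrite /=; lia.
    have := wr_triangle HP l ([seq (x, n) | x <- w] ++ flat u) U A.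
    have Sw l3 : P (l ++ [:: (i, n), (n, j) & l3]) = P (l ++ [:: (i, n), (j, n) & l3]).
      by have := wr_sym HP (rcons l (i, n)) l3 n j; rewrite !cat_rcons.
    rewrite Sw (wr_sym HP _ _ n j) => /(canRL (addKr _)) ->; ring.
  have [xj|xj] := eqVneq x j.
    subst x; rewrite add0r mulN1r.
    have U : uniq [:: j; n; i] by rewrite /= !inE; lia.
    have A : all (ltn^~ N) [:: j; n; i] by rewrite /=; lia.
    have := wr_triangle HP l ([seq (x, n) | x <- w] ++ flat u) U A.
    have Sw a b c d l3 : P (l ++ [:: (a, b), (c, d) & l3]) = P (l ++ [:: (a, b), (d, c) & l3]).
      by have := wr_sym HP (rcons l (a, b)) l3 c d; rewrite !cat_rcons.
    rewrite (Sw j n n i) (wr_sym HP _ _ n i) (Sw j n j i) (wr_sym HP _ _ j i).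
    move=> /(canRL (addKr _)) ->; ring.
  rewrite subrr mul0r add0r (wr_disjoint HP) //=; last by lia.
  by rewrite !inE; lia.
rewrite IH //; last by lia.
by congr (_ + _); congr (Y i j u _); apply: functional_extensionality => v; rewrite catA.
Qed.

(** The spanning half of PBW, stated on forms: a form that respects the relations is recovered from
    its values on normal words. *)
Lemma rels_ev n (P : seq (nat * nat) -> k) l1 l : word_rels n P -> all (valid n) l ->
  P (l1 ++ l) = ev l (fun s : PBWword n => P (l1 ++ flat s)).
Proof.
move=> HP; elim: l l1 => [|a l IH] l1 /=.
  by move=> _; rewrite /ev /=; congr (P (_ ++ _)); elim: n {HP}.
move=> /andP[/and3P[a1 a2 a12] Hl]; rewrite -cat_rcons IH // /ev /=.
apply: Y_seq_local (PBWvalid_one n) _ => // v Hv _; rewrite cat_rcons.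
by case: a a1 a2 a12 => i j /= *; apply: (rels_Y _ HP).
Qed.

End Evaluation.

(** * The Orlik-Solomon algebra in the no-broken-circuit basis *)

Section OrlikSolomon.
Variable k : fieldType.

(* The no-broken-circuit basis: each vertex m is joined to a smaller vertex or to none. *)
Fixpoint OSbasis (n : nat) : finType := if n is m.+1 then (option 'I_m * OSbasis m)%type else unit.

Definition sgn_opt m (o : option 'I_m) : k := if o is Some _ then -1 else 1.

(* X i j b e is the coefficient of b in x_ij * e. *)
Fixpoint X (n i j : nat) : OSbasis n -> (OSbasis n -> k) -> k :=
  match n with
  | 0 => fun _ _ => 0
  | m.+1 => fun b e => let: (o, c) := b in
      if (j == m) || (i == m) then
        let a := if j == m then i else j in
        if o is Some p then
          if val p == a then
            e (None, c) + \sum_(l < m | val l != a) @X m a l c (fun x => e (Some l, x))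
          else - @X m a p c (fun x => e (Some p, x))
        else 0
      else sgn_opt o * @X m i j c (fun x => e (o, x))
  end.
Arguments X {n}.

Lemma X_linear n i j (b : OSbasis n) : lin (X i j b).
Proof.
move=> a; elim: n i j b => [|n IH] i j b f g /=; first by ring.
case: b => o c; case: ifP => _; last by rewrite IH; ring.
case: o => [p|]; last by ring.
case: ifP => _; last by rewrite IH; ring.
rewrite mulrDr addrACA mulr_sumr -big_split /=; congr (_ + _).
by apply: eq_bigr => l _; rewrite IH.
Qed.

Lemma X_sym n i j (b : OSbasis n) e : X i j b e = X j i b e.
Proof.
elim: n i j b e => [|n IH] i j //= [o c] e.
rewrite orbC; case: (eqVneq i n) => ei /=; case: (eqVneq j n) => ej //=.
  by rewrite ei ej.
by rewrite IH.
Qed.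

Lemma X_symE n i j : @X n i j = X j i.
Proof. by do 2!apply: functional_extensionality => ?; rewrite X_sym. Qed.

Section Top.
Variables (n : nat) (e : OSbasis n.+1 -> k).

Lemma X_top0 a c : @X n.+1 a n (None, c) e = 0.
Proof. by rewrite /= eqxx. Qed.

(** The pair (Some l, c) stands for x_ln c, and two edges at the top vertex are reduced by x_an x_ln
    = x_an x_al - x_ln x_al. Here the first term of this rule is collected over all l; [X_top2]
    collects the second. *)
Lemma X_top1 (a : 'I_n) c : @X n.+1 a n (Some a, c) e =
  e (None, c) + \sum_(l < n | l != a) X a l c (fun x => e (Some l, x)).
Proof. by rewrite /= !eqxx. Qed.

Lemma X_top2 (a p : 'I_n) c : p != a ->
  @X n.+1 a n (Some p, c) e = - X a p c (fun x => e (Some p, x)).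
Proof. by rewrite /= !eqxx /= => /negbTE; rewrite -val_eqE /= => ->. Qed.

Lemma X_low i j o c : (i < n)%N -> (j < n)%N ->
  @X n.+1 i j (o, c) e = sgn_opt o * X i j c (fun x => e (o, x)).
Proof.
move=> lti ltj /=; have -> : (j == n) = false by lia.
by have -> : (i == n) = false by lia.
Qed.

End Top.

Arguments X : simpl never.

Lemma X_fext n i j (b : OSbasis n) f g : f =1 g -> X i j b f = X i j b g.
Proof. by move=> fg; congr (X i j b); apply: functional_extensionality. Qed.

Lemma edge_ind n (P : nat -> nat -> Prop) :
  (forall i j, P i j -> P j i) ->
  (forall i j, i != j -> (i < n)%N -> (j < n)%N -> P i j) ->
  (forall a : 'I_n, P a n) ->
  forall i j, i != j -> (i < n.+1)%N -> (j < n.+1)%N -> P i j.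
Proof.
move=> Psym Plow Ptop i j ij lti ltj.
have [jn|jn] := eqVneq j n.
  have lti' : (i < n)%N by lia.
  by have := Ptop (Ordinal lti'); rewrite jn.
have [i_n|i_n] := eqVneq i n.
  have ltj' : (j < n)%N by lia.
  by apply: Psym; have := Ptop (Ordinal ltj'); rewrite i_n.
by apply: Plow => //; lia.
Qed.

Lemma sgo2 m (o : option 'I_m) (x : k) : sgn_opt o * (sgn_opt o * x) = x.
Proof. by case: o => [p|] /=; ring. Qed.

Lemma X_low2 n i j l m o c (e : OSbasis n.+1 -> k) :
  (i < n)%N -> (j < n)%N -> (l < n)%N -> (m < n)%N ->
  @X n.+1 i j (o, c) (fun x => X l m x e) = X i j c (fun x => X l m x (fun y => e (o, y))).
Proof.
move=> *; rewrite X_low //; under X_fext => x do rewrite X_low //.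
by rewrite (linZ (X_linear _ _ _)) sgo2.
Qed.

Lemma X_square n i j (b : OSbasis n) e : i != j -> (i < n)%N -> (j < n)%N ->
  X i j b (fun c => X i j c e) = 0.
Proof.
elim: n i j b e => [|n IH] i j // b e; move: i j.
apply: edge_ind => [i j E|i j ij lti ltj|a].
- by rewrite X_symE -E; apply: X_fext => c; rewrite X_symE.
- by case: b => o c; rewrite X_low2 // IH.
case: b => -[p|] c; last by rewrite X_top0.
have [->|pa] := eqVneq p a.
  rewrite X_top1 X_top0 add0r big1 // => l la.
  under X_fext => x do rewrite X_top2 //.
  by rewrite (linN (X_linear _ _ _)) IH ?oppr0 // eq_sym.
rewrite X_top2 //; under X_fext => x do rewrite X_top2 //.
by rewrite (linN (X_linear _ _ _)) IH ?oppr0 // eq_sym.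
Qed.

Definition X_anticomm_at n := forall (i j l m : nat) (b : OSbasis n) e,
  i != j -> (i < n)%N -> (j < n)%N -> l != m -> (l < n)%N -> (m < n)%N ->
  X i j b (fun c => X l m c e) = - X l m b (fun c => X i j c e).

(** The three-term relation in the cyclic form x_jl x_ij + x_li x_jl + x_ij x_li = 0, which needs no
    order on the three vertices. *)
Definition X_triangle_at n := forall (i j l : nat) (b : OSbasis n) e,
  uniq [:: i; j; l] -> all (ltn^~ n) [:: i; j; l] ->
  X j l b (fun c => X i j c e) + X l i b (fun c => X j l c e) + X i j b (fun c => X l i c e) = 0.

(** Once the squares of x_ab are removed, the two sides differ, for each third vertex l, by the
    triangle relation of a, b, l one level down. *)
Lemma X_anticomm_top n (a b : 'I_n) c e :
  X_anticomm_at n -> X_triangle_at n -> a != b ->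
  @X n.+1 a n (Some b, c) (fun x => X b n x e) = - @X n.+1 b n (Some b, c) (fun x => X a n x e).
Proof.
move=> IH tri ab; rewrite X_top2 1?eq_sym // X_top1 X_top0 add0r; congr (- _).
under X_fext => x do rewrite X_top1.
rewrite (linD (X_linear _ _ _)) (lin_sum (X_linear _ _ _)).
rewrite (bigD1 a) //= [in RHS](bigD1 a) //=.
rewrite (X_symE _ b a) X_square // add0r.
under [in RHS]X_fext => x do rewrite X_top1.
rewrite (linD (X_linear _ _ _)) (lin_sum (X_linear _ _ _)) -addrA; congr (_ + _).
rewrite [in RHS](bigD1 b) 1?eq_sym //= X_square // add0r.
under [X in _ = X + _]eq_bigl => l do rewrite andbC.
rewrite -big_split; apply: eq_bigr => l /andP[lb la] /=.
under [X in _ = _ + X]X_fext => x do rewrite X_top2 //.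
rewrite (linN (X_linear _ _ _)).
have U : uniq [:: b : nat; l : nat; a : nat].
  by rewrite /= !inE !negb_or ![val _ == _]val_eqE eq_sym lb eq_sym ab la.
have A : all (ltn^~ n) [:: b : nat; l : nat; a : nat] by rewrite /= !ltn_ord.
have := tri b l a c (fun x => e (Some l, x)) U A.
have {}ab : (a : nat) != b by rewrite val_eqE.
have {}lb : (l : nat) != b by rewrite val_eqE.
have {}la : (l : nat) != a by rewrite val_eqE.
have bl : (b : nat) != l by rewrite eq_sym.
have al : (a : nat) != l by rewrite eq_sym.
rewrite (X_symE _ l a) (IH b l a b) // (IH b l a l) // opprK.
by move=> /eqP; rewrite subr_eq0 => /eqP <-; rewrite addrC.
Qed.

(** The two families are proved together: each of them at level n+1 uses both at level n. *)
Lemma X_rels n : X_anticomm_at n /\ X_triangle_at n.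
Proof.
elim: n => [|n [IH tri]]; first by split=> [[|i]|[|i]] //.
have anti : X_anticomm_at n.+1.
  have sw (i j l m : nat) : (forall (b : OSbasis n.+1) e, X i j b (fun c => X l m c e) = - X l m b (fun c => X i j c e)) ->
      forall (b : OSbasis n.+1) e, X l m b (fun c => X i j c e) = - X i j b (fun c => X l m c e).
    by move=> E b e; rewrite E opprK.
  have LT i j (a : 'I_n) : i != j -> (i < n)%N -> (j < n)%N -> forall (b : OSbasis n.+1) e,
      X i j b (fun c => X a n c e) = - X a n b (fun c => X i j c e).
    move=> ij lti ltj [[p|] c] e; rewrite X_low //; last first.
      under X_fext => x do rewrite X_top0.
      by rewrite (lin0 (X_linear _ _ _)) mulr0 X_top0 oppr0.
    have [->|pa] := eqVneq p a.
      under X_fext => x do rewrite X_top1.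
      rewrite X_top1 X_low //= mul1r mulN1r; congr (- _).
      rewrite (linD (X_linear _ _ _)) (lin_sum (X_linear _ _ _)); congr (_ + _).
      apply: eq_bigr => l la; under [in RHS]X_fext => x do rewrite X_low //= mulN1r.
      by rewrite (linN (X_linear _ _ _)) IH // val_eqE eq_sym.
    under X_fext => x do rewrite X_top2 //.
    rewrite X_top2 //=; under [in RHS]X_fext => x do rewrite X_low //= mulN1r.
    by rewrite !(linN (X_linear _ _ _)) mulN1r !opprK IH // val_eqE eq_sym.
  have TT (a a' : 'I_n) : forall (b : OSbasis n.+1) e, X a n b (fun c => X a' n c e) = - X a' n b (fun c => X a n c e).
    move=> b e; have [<-|aa'] := eqVneq a a'.
      by rewrite X_square ?oppr0 //; have := ltn_ord a; lia.
    case: b => -[p|] c; last by rewrite !X_top0 oppr0.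
    have [->|pa'] := eqVneq p a'; first exact: X_anticomm_top.
    have [->|pa] := eqVneq p a.
      by rewrite [in RHS]X_anticomm_top ?opprK // eq_sym.
    rewrite !X_top2 //; under X_fext => x do rewrite X_top2 //.
    under [in RHS]X_fext => x do rewrite X_top2 //.
    by rewrite !(linN (X_linear _ _ _)) !opprK IH // val_eqE eq_sym.
  move=> i j l m b e ij lti ltj lm ltl ltm.
  move: i j ij lti ltj b e; apply: edge_ind => [i j E b e|i j ij lti ltj|a].
  - by rewrite ![@X _ j i]X_symE E.
  - move: l m lm ltl ltm; apply: edge_ind => [l m E b e|l m lm ltl ltm|a].
    + by rewrite ![@X _ m l]X_symE E.
    + by move=> [o c] e; rewrite !X_low2 // IH.
    exact: LT.
  - move: l m lm ltl ltm; apply: edge_ind => [l m E b e|l m lm ltl ltm|a'].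
    + by rewrite ![@X _ m l]X_symE E.
    + by apply: sw; apply: LT.
    exact: TT.
split=> // i j l b e U A.
have low (p q r : nat) (b' : OSbasis n.+1) : uniq [:: p; q; r] -> all (ltn^~ n) [:: p; q; r] ->
    X q r b' (fun c => X p q c e) + X r p b' (fun c => X q r c e) + X p q b' (fun c => X r p c e) = 0.
  move=> U' A'; have := A'; rewrite /= andbT => /and3P[ltp ltq ltr].
  by case: b' => o c; rewrite !X_low2 // tri.
have top (a a' : 'I_n) (b' : OSbasis n.+1) : a != a' ->
    X a' n b' (fun c => X a a' c e) + X n a b' (fun c => X a' n c e) + X a a' b' (fun c => X n a c e) = 0.
  move=> aa'; rewrite ![@X _ n a]X_symE.
  case: b' => -[p|] c; last first.
    rewrite !X_top0 !add0r X_low //; under X_fext => x do rewrite X_top0.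
    by rewrite (lin0 (X_linear _ _ _)) mulr0.
  have [->|pa] := eqVneq p a.
    rewrite X_top2 //; under X_fext => x do rewrite X_low //= mulN1r.
    rewrite (linN (X_linear _ _ _)) opprK (X_symE _ a' a) X_square // add0r.
    rewrite -[X a n _ _]opprK -X_anticomm_top //; last by rewrite eq_sym.
    by rewrite X_top2 // X_low //= mulN1r (X_symE _ a' a) opprK addrN.
  have [->|pa'] := eqVneq p a'.
    have -> : @X n.+1 a a' (Some a', c) (fun x => X a n x e) = 0.
      rewrite X_low //; under X_fext => x do rewrite X_top2 1?eq_sym //.
      by rewrite (linN (X_linear _ _ _)) X_square // oppr0 mulr0.
    rewrite addr0 X_top1 X_top2 1?eq_sym // X_low //= mul1r.
    under [X in _ - X]X_fext => x do rewrite X_top1.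
    rewrite (linD (X_linear _ _ _)) (lin_sum (X_linear _ _ _)) opprD addrACA subrr add0r.
    rewrite -sumrB big1 // => l' la'; under X_fext => x do rewrite X_low //= mulN1r.
    by rewrite (linN (X_linear _ _ _)) IH ?opprK ?subrr // val_eqE eq_sym.
  have -> : @X n.+1 a' n (Some p, c) (fun x => X a a' x e) =
      X a' p c (fun x => X a a' x (fun y => e (Some p, y))).
    rewrite X_top2 //; under X_fext => x do rewrite X_low //= mulN1r.
    by rewrite (linN (X_linear _ _ _)) opprK.
  have -> : @X n.+1 a n (Some p, c) (fun x => X a' n x e) =
      X a p c (fun x => X a' p x (fun y => e (Some p, y))).
    rewrite X_top2 //; under X_fext => x do rewrite X_top2 //.
    by rewrite (linN (X_linear _ _ _)) opprK.
  have -> : @X n.+1 a a' (Some p, c) (fun x => X a n x e) =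
      X a a' c (fun x => X a p x (fun y => e (Some p, y))).
    rewrite X_low //; under X_fext => x do rewrite X_top2 //.
    by rewrite (linN (X_linear _ _ _)) mulN1r opprK.
  rewrite (X_symE _ a p); apply: tri; rewrite /= ?ltn_ord // !inE negb_or !val_eqE.
  by rewrite ![_ == p]eq_sym aa' pa pa'.
move: (U) (A); rewrite /= !inE !negb_or !andbT => /andP[/andP[ij il] jl] /and3P[lti ltj ltl].
have [ln|ln] := eqVneq l n.
  have [lti' ltj'] : (i < n)%N /\ (j < n)%N by move: ij il jl; rewrite ln; lia.
  by rewrite ln; exact: (top (Ordinal lti') (Ordinal ltj') b ij).
have [i_n|i_n] := eqVneq i n.
  have [lti' ltj'] : (j < n)%N /\ (l < n)%N by move: ij il jl; rewrite i_n; lia.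
  by rewrite i_n -addrA addrC; exact: (top (Ordinal lti') (Ordinal ltj') b jl).
have [jn|jn] := eqVneq j n.
  have [lti' ltj'] : (l < n)%N /\ (i < n)%N by move: ij il jl; rewrite jn; lia.
  have li : Ordinal lti' != Ordinal ltj' by rewrite eq_sym.
  by rewrite jn addrC addrA; exact: (top (Ordinal lti') (Ordinal ltj') b li).
by apply: low => //=; rewrite andbT; lia.
Qed.

End OrlikSolomon.
Arguments X {k n} : simpl never.

(** * The Koszul differential and its square *)

Section KoszulComplex.
Variable k : fieldType.
Hypothesis k0 : [pchar k] =i pred0.

Lemma natk_neq0 m : (m.+1%:R : k) != 0.
Proof. by rewrite ((pcharf0P k).1 k0). Qed.

Lemma mul_natk_eq0 m (x : k) : m.+1%:R * x = 0 -> x = 0.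
Proof. by move/eqP; rewrite mulf_eq0 (negbTE (natk_neq0 _)) => /eqP. Qed.

(** The element sum of x_ij tensor y_ij acts on OS tensor the forms on the dual algebra: x_ij
    multiplies, y_ij acts by the transpose of left multiplication. Every edge is counted in both
    orders. *)
Definition koszul_d n (h : OSbasis n -> PBWword n -> k) (b : OSbasis n) (s : PBWword n) : k :=
  \sum_(i < n) \sum_(j < n | j != i) X i j b (fun c => Y i j s (h c)).

Lemma koszul_d_linear n (b : OSbasis n) (s : PBWword n) a h1 h2 :
  koszul_d (fun c t => a * h1 c t + h2 c t) b s = a * koszul_d h1 b s + koszul_d h2 b s.
Proof.
rewrite /koszul_d mulr_sumr -big_split; apply: eq_bigr => i _ /=.
rewrite mulr_sumr -big_split; apply: eq_bigr => j _ /=.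
by rewrite -X_linear; apply: X_fext => c; rewrite Y_linear.
Qed.

(* Only the pairs of edges sharing exactly one vertex survive: [t i j i l] sums to zero over
   the six orderings of a triangle, and disjoint edges cancel in pairs. *)
Lemma edge_pair_sum0 n (t : 'I_n -> 'I_n -> 'I_n -> 'I_n -> k) :
  (forall i j l m, t i j l m = t j i l m) -> (forall i j l m, t i j l m = t i j m l) ->
  (forall i j, i != j -> t i j i j = 0) ->
  (forall i j l m, uniq [:: i; j; l; m] -> t i j l m = - t l m i j) ->
  (forall i j l, uniq [:: i; j; l] -> t i j i l + t i l i j + t j i j l + t j l j i
     + t l i l j + t l j l i = 0) ->
  \sum_(i < n) \sum_(j < n | j != i) \sum_(l < n) \sum_(m < n | m != l) t i j l m = 0.
Proof.
move=> s1 s2 t0 td tt.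
pose D i j l m := if uniq [:: i; j; l; m] then t i j l m else 0.
pose h i j l := if uniq [:: i; j; l] then t i j i l else 0.
have E i j l m : (if (j != i) && (m != l) then t i j l m else 0) =
   D i j l m + ((if l == i then h i j m else 0) + (if l == j then h j i m else 0) +
     ((if m == i then h i j l else 0) + (if m == j then h j i l else 0))).
  rewrite /D /h /= !inE !negb_or !andbT.
  have [?|ij] := eqVneq i j; [subst j|]; (have [?|lm] := eqVneq l m; [subst m|]);
  (have [?|li] := eqVneq l i; [try subst l|]); try (have [?|lj] := eqVneq l j; [try subst l|]);
  try (have [?|mi] := eqVneq m i; [try subst m|]); try (have [?|mj] := eqVneq m j; [try subst m|]);
  decide_eqs; rewrite ?andbF ?addr0 ?add0r //=.
  - by rewrite eqxx in lm.
  - exact: t0.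
  - by rewrite s2 t0.
  - by rewrite eqxx in lm.
  - by rewrite s1 s2.
have -> : \sum_(i < n) \sum_(j < n | j != i) \sum_(l < n) \sum_(m < n | m != l) t i j l m =
  \sum_(i < n) \sum_(j < n) \sum_(l < n) \sum_(m < n)
    if (j != i) && (m != l) then t i j l m else 0.
  apply: eq_bigr => i _; rewrite big_mkcond; apply: eq_bigr => j _ /=.
  case: ifP => ji /=; last by rewrite big1 // => l _; rewrite big1.
  by apply: eq_bigr => l _; rewrite big_mkcond.
under eq_bigr => i _ do under eq_bigr => j _ do under eq_bigr => l _ do
  under eq_bigr => m _ do rewrite E.
under eq_bigr => i _ do under eq_bigr => j _ do under eq_bigr => l _ do rewrite !big_split /=.
under eq_bigr => i _ do under eq_bigr => j _ do rewrite !big_split /=.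
under eq_bigr => i _ do rewrite !big_split /=.
rewrite !big_split /=.
set B := \sum_i \sum_j \sum_l h i j l.
have -> : \sum_(i < n) \sum_(j < n) \sum_(l < n) \sum_(m < n) D i j l m = 0.
  (* The argument 1 stands for the factor 2: the sum is added to itself with its two edges
     exchanged. *)
  apply: (@mul_natk_eq0 1); rewrite mulr_natl mulr2n.
  rewrite pair_bigA /=; under eq_bigr => p _ do rewrite pair_bigA /=.
  rewrite [X in X + _]exchange_big -big_split /= big1 // => p _.
  rewrite -big_split /= big1 // => q _; rewrite /D.
  have -> : uniq [:: q.1; q.2; p.1; p.2] = uniq [:: p.1; p.2; q.1; q.2].
    by apply: perm_uniq; rewrite (perm_catC [:: q.1; q.2] [:: p.1; p.2]).
  by case: ifP => U; rewrite ?addr0 // [X in _ + X]td // addrN.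
have e2 (f : 'I_n -> 'I_n -> 'I_n -> k) :
    \sum_(i < n) \sum_(j < n) \sum_(l < n) f i j l = \sum_(j < n) \sum_(i < n) \sum_(l < n) f i j l.
  by rewrite exchange_big.
have e3 (f : 'I_n -> 'I_n -> 'I_n -> k) :
    \sum_(i < n) \sum_(j < n) \sum_(l < n) f i j l = \sum_(i < n) \sum_(l < n) \sum_(j < n) f i j l.
  by apply: eq_bigr => i _; rewrite exchange_big.
have B0 : B = 0.
  have B1 : B = \sum_i \sum_j \sum_l h i l j by rewrite /B e3.
  have B2 : B = \sum_i \sum_j \sum_l h j i l by rewrite /B e2.
  have B3 : B = \sum_i \sum_j \sum_l h j l i by rewrite B1 e2.
  have B4 : B = \sum_i \sum_j \sum_l h l i j by rewrite B2 e3.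
  have B5 : B = \sum_i \sum_j \sum_l h l j i by rewrite B3 e3.
  (* The argument 5 stands for the factor 6: the six reindexings of [B] are added, so that each
     summand runs over all orderings of one triangle. *)
  apply: (@mul_natk_eq0 5); rewrite mulr_natl !mulrS mulr0n addr0.
  rewrite {2}B1 {2}B2 {2}B3 {2}B4 {2}B5 /B.
  rewrite -!big_split /= big1 // => i _; rewrite -!big_split /= big1 // => j _.
  rewrite -!big_split /= big1 // => l _; rewrite /h.
  have U s : perm_eq s [:: i; j; l] -> uniq s = uniq [:: i; j; l].
    exact: perm_uniq.
  have P1 : perm_eq [:: i; l; j] [:: i; j; l] by rewrite perm_cons (perm_catC [:: l] [:: j]).
  have P2 : perm_eq [:: j; l; i] [:: i; j; l] by rewrite (perm_catC [:: j; l] [:: i]).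
  have P3 : perm_eq [:: l; i; j] [:: i; j; l] by rewrite (perm_catC [:: l] [:: i; j]).
  have P4 : perm_eq [:: j; i; l] [:: i; j; l] by rewrite (perm_catCA [:: j] [:: i] [:: l]).
  have P5 : perm_eq [:: l; j; i] [:: i; j; l].
    by rewrite -(permPr P2) (perm_catCA [:: l] [:: j] [:: i]).
  rewrite (U _ P1) (U _ P2) (U _ P3) (U _ P4) (U _ P5).
  by case: ifP => Uq; [rewrite -(tt i j l Uq); ring|rewrite !addr0].
have pick1 (F : 'I_n -> k) a : \sum_(l < n) (if l == a then F l else 0) = F a.
  by rewrite -big_mkcond big_pred1_eq.
have R1 : \sum_(i < n) \sum_(j < n) \sum_(l < n) \sum_(m < n) (if l == i then h i j m else 0) = B.
  apply: eq_bigr => i _; apply: eq_bigr => j _; rewrite exchange_big /=.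
  by apply: eq_bigr => l _; rewrite pick1.
have R2 : \sum_(i < n) \sum_(j < n) \sum_(l < n) \sum_(m < n) (if l == j then h j i m else 0) = B.
  rewrite /B e2; apply: eq_bigr => i _; apply: eq_bigr => j _; rewrite exchange_big /=.
  by apply: eq_bigr => l _; rewrite pick1.
have R3 : \sum_(i < n) \sum_(j < n) \sum_(l < n) \sum_(m < n) (if m == i then h i j l else 0) = B.
  by apply: eq_bigr => i _; apply: eq_bigr => j _; apply: eq_bigr => l _; rewrite pick1.
have R4 : \sum_(i < n) \sum_(j < n) \sum_(l < n) \sum_(m < n) (if m == j then h j i l else 0) = B.
  rewrite /B e2; apply: eq_bigr => i _; apply: eq_bigr => j _; apply: eq_bigr => l _.
  by rewrite pick1.
by rewrite R1 R2 R3 R4 B0 !addr0.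
Qed.

Lemma X_lin n U (L : (U -> k) -> k) (F : OSbasis n -> U -> k) i j b : lin L ->
  X i j b (fun c => L (F c)) = L (fun u => X i j b (fun c => F c u)).
Proof.
move=> HL; rewrite /X; elim: n i j b F => [|n IH] i j b F; first by rewrite (lin0 HL).
case: b => o c; case: ifP => _; last by rewrite IH (linZ HL).
case: o => [p|]; last by rewrite (lin0 HL).
case: ifP => _; last by rewrite IH (linN HL).
by rewrite (linD HL) (lin_sum HL); congr (_ + _); apply: eq_bigr => l _; rewrite IH.
Qed.

Lemma Y_symE n i j : @Y k n i j = Y j i.
Proof. by do 2!apply: functional_extensionality => ?; rewrite Y_sym. Qed.

Lemma koszul_d_koszul_d n (h : OSbasis n -> PBWword n -> k) b s : koszul_d (koszul_d h) b s = 0.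
Proof.
pose t (i j l m : 'I_n) := X i j b (fun c => X l m c (fun c' => Y i j s (fun s' => Y l m s' (h c')))).
have -> : koszul_d (koszul_d h) b s =
    \sum_(i < n) \sum_(j < n | j != i) \sum_(l < n) \sum_(m < n | m != l) t i j l m.
  apply: eq_bigr => i _; apply: eq_bigr => j ji.
  rewrite (@X_fext k n i j b _ (fun c => \sum_(l < n) \sum_(m < n | m != l)
    X l m c (fun c' => Y i j s (fun s' => Y l m s' (h c'))))).
    rewrite (lin_sum (X_linear _ _ _)); apply: eq_bigr => l _.
    by rewrite (lin_sum (X_linear _ _ _)).
  move=> c; rewrite (lin_sum (Y_linear _ _ _)); apply: eq_bigr => l _.
  rewrite (lin_sum (Y_linear _ _ _)); apply: eq_bigr => m _.
  by rewrite X_lin //; apply: Y_linear.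
apply: edge_pair_sum0.
- move=> i j l m; rewrite /t X_symE; apply: X_fext => c; apply: X_fext => c'.
  by rewrite Y_sym.
- move=> i j l m; rewrite /t; apply: X_fext => c; rewrite X_symE; apply: X_fext => c'.
  by congr (Y i j s); apply: functional_extensionality => s'; rewrite Y_sym.
- by move=> i j ij; rewrite /t X_square.
- move=> i j l m U; rewrite /t.
  move: (U); rewrite /= !inE !negb_or !andbT => /and3P[/and3P[ij _ _] _ lm].
  rewrite (X_rels k n).1 //; congr (- _); apply: X_fext => c; apply: X_fext => c'.
  by apply: Y_disjoint; rewrite -(map_inj_uniq val_inj) in U.
move=> i j l U; rewrite /t.
have U' : uniq [:: val i; val j; val l] by rewrite -(map_inj_uniq val_inj) in U.
have A : all (ltn^~ n) [:: val i; val j; val l] by rewrite /= !ltn_ord.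
move: (U); rewrite /= !inE !negb_or !andbT => /andP[/andP[ij il] jl].
have [anti tri] := X_rels k n.
have ij' : val i != val j := ij.
have il' : val i != val l := il.
have jl' : val j != val l := jl.
pose YY (i j l m : nat) (c : OSbasis n) := Y i j s (fun s' => Y l m s' (h c)).
rewrite (X_symE _ _ j i) (X_symE _ _ l i) (X_symE _ _ l j).
rewrite (Y_symE _ j i) (Y_symE _ l i) (Y_symE _ l j).
rewrite (anti i l i j) // (anti j l i j) // (anti j l i l) //.
rewrite -/(YY i j i l) -/(YY i l i j) -/(YY i j j l) -/(YY j l i j) -/(YY i l j l) -/(YY j l i l).
have E1 c : YY i j i l c + YY i j j l c = YY i l i j c + YY j l i j c.
  by rewrite /YY -(Y_triangle _ _ U') (linD (Y_linear _ _ _)).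
have E2 c : YY i l i j c + YY i l j l c = YY i j i l c + YY j l i l c.
  have U2 : uniq [:: val i; val l; val j] by rewrite /= !inE !negb_or ij' il' eq_sym jl'.
  have := Y_triangle s (h c) U2; rewrite (linD (Y_linear _ _ _)) => E.
  by rewrite /YY (Y_symE _ j l) E.
(* The two Drinfeld-Kohno relations make the three commutators of a triangle equal to [T], [- T] and
   [T]; the six terms then form the Orlik-Solomon relation applied to [T]. *)
pose T c := YY i j i l c - YY i l i j c.
have := tri i j l b T U' A; rewrite (X_symE _ _ l i) (anti j l i j) //.
have -> : YY i j j l = fun c => YY j l i j c - T c.
  apply: functional_extensionality => c; rewrite /T; have := E1 c.
  by move/(canRL (addKr _)) => ->; ring.
have -> : YY i l j l = fun c => YY j l i l c + T c.
  apply: functional_extensionality => c; rewrite /T; have := E2 c.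
  by move/(canRL (addKr _)) => ->; ring.
have LD (f g : OSbasis n -> k) x y z w : X x y b (fun c => X z w c (fun c' => f c' + g c')) =
    X x y b (fun c => X z w c f) + X x y b (fun c => X z w c g).
  by rewrite -(linD (X_linear _ _ _)); apply: X_fext => c; rewrite (linD (X_linear _ _ _)).
have LB (f g : OSbasis n -> k) x y z w : X x y b (fun c => X z w c (fun c' => f c' - g c')) =
    X x y b (fun c => X z w c f) - X x y b (fun c => X z w c g).
  by rewrite -(linB (X_linear _ _ _)); apply: X_fext => c; rewrite (linB (X_linear _ _ _)).
have ET := LB (YY i j i l) (YY i l i j) i j i l; rewrite -/T in ET; clearbody T.
by rewrite LB LD => triT; rewrite -[RHS]triT ET; ring.
Qed.

End KoszulComplex.

Arguments Y : simpl never.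

(** * Exactness of the Koszul complex away from the unit *)

Section Exactness.
Variable k : fieldType.
Hypothesis k0 : [pchar k] =i pred0.

Fixpoint OSone n : OSbasis n := if n is m.+1 then (None, OSone m) else tt.

Lemma X_OSone n i j (e : OSbasis n -> k) : X i j (OSone n) e = 0.
Proof.
rewrite /X; elim: n i j e => [|n IH] i j e //=.
by case: ifP => // _; rewrite IH mulr0.
Qed.

Lemma koszul_d_OSone n (h : OSbasis n -> PBWword n -> k) s : koszul_d h (OSone n) s = 0.
Proof. by rewrite /koszul_d big1 // => i _; rewrite big1 // => j _; rewrite X_OSone. Qed.

(** Separates the edges at the top vertex; the factor 2 comes from their two orders. *)
Lemma dKS n (h : OSbasis n.+1 -> PBWword n.+1 -> k) (b : OSbasis n.+1) (s : PBWword n.+1) :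
  koszul_d h b s = \sum_(i < n) \sum_(j < n | j != i) X i j b (fun c => Y i j s (h c)) +
    2%:R * \sum_(a < n) X a n b (fun c => Y a n s (h c)).
Proof.
rewrite /koszul_d big_ord_recr /=.
under eq_bigr => i _.
  rewrite big_mkcond big_ord_recr -big_mkcond /=.
  have -> : (ord_max != widen_ord (leqnSn n) i) by rewrite -val_eqE /=; have := ltn_ord i; lia.
  over.
rewrite big_split /= -addrA mulr2n mulrDl !mul1r; congr (_ + (_ + _)).
rewrite [LHS]big_mkcond big_ord_recr /= eqxx /= addr0; apply: eq_bigr => i _.
have -> : (widen_ord (leqnSn n) i != ord_max) by rewrite -val_eqE /=; have := ltn_ord i; lia.
by rewrite X_symE Y_symE.
Qed.

(** A derivation never produces the empty word, so only values at nonempty words enter. *)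
Lemma D_vanish i j w (F : seq nat -> k) : (forall x v, F (x :: v) = 0) -> D i j w F = 0.
Proof.
elim: w F => [|x w IH] F F0 //=; rewrite !F0 subrr mulr0 add0r.
by apply: IH => *; apply: F0.
Qed.

Lemma Y_top n a s (F : PBWword n.+1 -> k) : Y a n s F = F (a :: s.1, s.2).
Proof. by case: s => w u; rewrite /Y eqxx. Qed.

Lemma Y_low n i j s (F : PBWword n.+1 -> k) : (i < n)%N -> (j < n)%N ->
  Y i j s F = D i j s.1 (fun v => F (v, s.2)) + Y i j s.2 (fun u => F (s.1, u)).
Proof.
case: s => w u lti ltj; rewrite /Y; have -> : (j == n) = false by lia.
by have -> : (i == n) = false by lia.
Qed.

Definition lift_base n (f : OSbasis n -> PBWword n.+1 -> k) (b : OSbasis n.+1) (s : PBWword n.+1) : k :=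
  if b.1 is Some _ then 0 else f b.2 s.

Lemma koszul_d_lift0 n (f : OSbasis n -> PBWword n.+1 -> k) c s : koszul_d (lift_base f) (None, c) s =
  \sum_(i < n) \sum_(j < n | j != i) X i j c (fun c' => Y i j s (f c')).
Proof.
rewrite dKS [X in _ + _ * X]big1 => [|a _]; last by rewrite X_top0.
rewrite mulr0 addr0; apply: eq_bigr => i _; apply: eq_bigr => j _.
by rewrite X_low //= mul1r.
Qed.

Lemma koszul_d_lift1 n (f : OSbasis n -> PBWword n.+1 -> k) (m : 'I_n) c s :
  koszul_d (lift_base f) (Some m, c) s = 2%:R * f c ((m : nat) :: s.1, s.2).
Proof.
rewrite dKS big1 ?add0r => [|i _]; last first.
  rewrite big1 // => j _; rewrite X_low //=.
  rewrite (@X_fext _ _ _ _ _ _ (fun=> 0)) ?(lin0 (X_linear _ _ _)) ?mulr0 // => c'.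
  exact: lin0 (Y_linear _ _ _).
congr (_ * _); rewrite (bigD1 m) //= X_top1 big1 => [|l lm]; last first.
  by rewrite -[RHS](lin0 (X_linear (val m) (val l) c)); apply: X_fext => c'; rewrite Y_top.
rewrite addr0 Y_top big1 ?addr0 // => a am; rewrite X_top2 1?eq_sym //.
rewrite -[RHS]oppr0 -[X in _ = - X](lin0 (X_linear (val a) (val m) c)); congr (- _).
by apply: X_fext => c'; rewrite Y_top.
Qed.

(* Poincare lemma: the fibre variable of the top vertex is integrated by deleting the first
   letter of its word; what remains is pulled back from the base. *)
Lemma koszul_d_exact n (h : OSbasis n -> PBWword n -> k) :
  (forall b s, PBWvalid s -> koszul_d h b s = 0) -> h (OSone n) (PBWone n) = 0 ->
  exists f, forall b s, PBWvalid s -> koszul_d f b s = h b s.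
Proof.
elim: n h => [|n IH] h hK h1.
  by exists (fun _ _ => 0) => -[] [] _; rewrite /koszul_d big_ord0 -h1.
(* The factor 1/2 cancels the double count of the edge at the top vertex; [insub] sets the value to
   0 on letters that are not vertices. *)
pose f1 (c : OSbasis n) (s : PBWword n.+1) := if s.1 is x :: w then
   (if insub x is Some m then 2%:R^-1 * h (Some m, c) (w, s.2) else 0) else 0.
pose z c s := -1 * koszul_d (lift_base f1) c s + h c s.
have z1 (m : 'I_n) c s : z (Some m, c) s = 0.
  rewrite /z koszul_d_lift1 /f1 /= valK mulVKf ?natk_neq0 // mulN1r.
  by case: s => w u; rewrite addNr.
have zK b s : PBWvalid s -> koszul_d z b s = 0.
  by move=> Hs; rewrite koszul_d_linear koszul_d_koszul_d // mulr0 add0r hK.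
(* Since [z] has no component with an edge at the top vertex, the equation d z = 0 in such a
   component reduces to twice the value of [z] at the word lengthened by the corresponding
   letter. *)
have zx c x w (u : PBWword n) : PBWvalid ((x :: w, u) : PBWword n.+1) -> z (None, c) (x :: w, u) = 0.
  move=> /= /andP[/andP[ltx Hw] Hu].
  have E : koszul_d z (Some (Ordinal ltx), c) (w, u) =
      koszul_d (lift_base (fun c => z (None, c))) (Some (Ordinal ltx), c) (w, u).
    congr (koszul_d _ _ _); apply: functional_extensionality => -[[m|] c'];
    apply: functional_extensionality => s //; exact: z1.
  have := zK (Some (Ordinal ltx), c) (w, u); rewrite E koszul_d_lift1 /= Hw Hu.
  by move=> /(_ isT) /(mul_natk_eq0 k0).
pose h' c u := z (None, c) ([::], u).
have [||f2 f2K] := IH h'.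
- move=> c u Hu; have := zK (None, c) ([::], u) Hu => <-.
  have -> : z = lift_base (fun c => z (None, c)).
    by apply: functional_extensionality => -[[m|] c'];
      apply: functional_extensionality => s //; exact: z1.
  rewrite koszul_d_lift0; apply: eq_bigr => i _; apply: eq_bigr => j _.
  by apply: X_fext => c'; rewrite Y_low //= add0r.
- by rewrite /h' /z -[(None, OSone n)]/(OSone n.+1) koszul_d_OSone -[([::], PBWone n)]/(PBWone n.+1) h1 mulr0 addr0.
(* Extension by zero to words with a top letter: the differential of the extension stays zero there
   by [D_vanish], and in the components with a top edge as well. *)
pose f3 (c : OSbasis n) (s : PBWword n.+1) := if s.1 is x :: w then 0 else f2 c s.2.
exists (fun b s => 1 * lift_base f1 b s + lift_base f3 b s) => b s Hs.
have -> : h b s = koszul_d (lift_base f1) b s + z b s by rewrite /z; ring.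
rewrite koszul_d_linear mul1r; congr (_ + _).
case: b => -[m|] c; first by rewrite koszul_d_lift1 z1 mulr0.
rewrite koszul_d_lift0; case: s Hs => -[|x w] u Hs.
  rewrite -/(h' c u) -f2K //; apply: eq_bigr => i _; apply: eq_bigr => j _.
  by apply: X_fext => c'; rewrite Y_low //= add0r.
rewrite zx // big1 // => i _; rewrite big1 // => j _.
rewrite -[RHS](lin0 (X_linear (val i) (val j) c)); apply: X_fext => c'.
rewrite Y_low // D_vanish // add0r; exact: lin0 (Y_linear _ _ _).
Qed.

End Exactness.

(** * Renaming of vertices on both algebras *)

Section Action.
Variable k : fieldType.

(* The algebra morphism x_ij |-> x_(f i)(f j), on coordinate functions. *)
Fixpoint OSact N (f : nat -> nat) n : (OSbasis n -> k) -> OSbasis N -> k :=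
  match n with
  | 0 => fun e b => e tt * (b == OSone N)%:R
  | m.+1 => fun e b => OSact f (fun c => e (None, c)) b +
      \sum_(l < m) X (f l) (f m) b (@OSact N f m (fun c => e (Some l, c)))
  end.

Lemma OSact_linear N f n (b : OSbasis N) : lin (fun e => @OSact N f n e b).
Proof.
move=> a; elim: n b => [|n IH] b e1 e2 /=; first by ring.
rewrite IH mulrDr addrACA mulr_sumr -big_split /=; congr (_ + _).
apply: eq_bigr => l _; rewrite -X_linear; apply: X_fext => c; exact: IH.
Qed.

Lemma OSact_lin N f n U (L : (U -> k) -> k) (F : OSbasis n -> U -> k) (b : OSbasis N) : lin L ->
  OSact f (fun c => L (F c)) b = L (fun u => OSact f (fun c => F c u) b).
Proof.
move=> HL; elim: n b F => [|n IH] b F /=.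
  by rewrite mulrC -(linZ HL); congr L; apply: functional_extensionality => u; rewrite mulrC.
rewrite (linD HL) (lin_sum HL) IH; congr (_ + _); apply: eq_bigr => l _.
by rewrite -X_lin //; apply: X_fext => c; rewrite IH.
Qed.

Lemma OSact_fext N f n (e1 e2 : OSbasis n -> k) (b : OSbasis N) : e1 =1 e2 -> OSact f e1 b = OSact f e2 b.
Proof. by move=> E; congr (OSact f _ b); apply: functional_extensionality. Qed.

(** Multiplicativity of the renaming. For an edge at the top vertex the reduction rule of the source
    is matched by the triangle relation of the target, so [f] has to keep the vertices below [N]
    distinct. *)
Lemma OSact_X N f n i j (e : OSbasis n -> k) (b : OSbasis N) :
  {in ltn^~ N &, injective f} -> (forall x, (x < N)%N -> (f x < N)%N) ->
  (n <= N)%N -> i != j -> (i < n)%N -> (j < n)%N ->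
  OSact f (fun c => X i j c e) b = X (f i) (f j) b (OSact f e).
Proof.
move=> f_inj f_lt; elim: n i j e b => [|n IH] i j // e b ltnN.
have [anti tri] := X_rels k N.
have fne x y : (x < N)%N -> (y < N)%N -> x != y -> f x != f y.
  by move=> Hx Hy; apply: contra => /eqP /f_inj -> //.
have lt (l : 'I_n) : (l < N)%N := ltn_trans (ltn_ord l) ltnN.
have ne (l : 'I_n) : f l != f n by apply: fne => //; have := ltn_ord l; lia.
have ne2 (l m : 'I_n) : l != m -> f l != f m by move=> lm; apply: fne.
move: i j; apply: edge_ind => [i j E|i j ij lti ltj|a].
- by rewrite X_symE E X_symE.
- have ltiN : (i < N)%N by lia.
  have ltjN : (j < N)%N by lia.
  rewrite /= (linD (X_linear _ _ _)) (lin_sum (X_linear _ _ _)); congr (_ + _).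
    by rewrite -IH //; [apply: OSact_fext => c; rewrite X_low //= mul1r|lia].
  apply: eq_bigr => l _; have ltlN := lt l.
  rewrite (anti (f i) (f j)) //; [|exact: fne|exact: f_lt..].
  rewrite -(linN (X_linear _ _ _)); apply: X_fext => b'.
  rewrite -IH //; last by lia.
  by rewrite -(linN (OSact_linear _ _)); apply: OSact_fext => c; rewrite X_low //= mulN1r.
have ltaN := lt a.
rewrite /= (@OSact_fext _ _ _ _ (fun=> 0)) => [|c]; last by rewrite X_top0.
rewrite (lin0 (OSact_linear _ _)) add0r (linD (X_linear _ _ _)) (lin_sum (X_linear _ _ _)).
rewrite (bigD1 a) //= [in RHS](bigD1 a) //= X_square ?f_lt // add0r.
rewrite (@X_fext _ _ _ _ _ _ (fun b' => OSact f (fun c => e (None, c)) b' +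
    \sum_(l < n | l != a) X (f a) (f l) b' (OSact f (fun c => e (Some l, c))))); last first.
  move=> b'; rewrite (@OSact_fext _ _ _ _ (fun c => e (None, c) +
    \sum_(l < n | l != a) X a l c (fun x => e (Some l, x)))); last by move=> c; rewrite X_top1.
  rewrite (linD (OSact_linear _ _)) (lin_sum (OSact_linear _ _)); congr (_ + _).
  by apply: eq_bigr => l la; rewrite IH //; [lia|rewrite eq_sym].
rewrite (linD (X_linear _ _ _)) (lin_sum (X_linear _ _ _)) -addrA; congr (_ + _).
rewrite -big_split /=; apply: eq_bigr => l la; have ltlN := lt l.
have -> : X (f l) (f n) b (OSact f (fun c : OSbasis n => @X k n.+1 a n (Some l, c) e)) =
    - X (f l) (f n) b (fun b' => X (f a) (f l) b' (OSact f (fun c => e (Some l, c)))).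
  rewrite -(linN (X_linear _ _ _)); apply: X_fext => b'.
  rewrite -IH ?(eq_sym (a : nat)) //; last by lia.
  by rewrite -(linN (OSact_linear _ _)); apply: OSact_fext => c; rewrite X_top2.
have U : uniq [:: f a; f l; f n].
  by rewrite /= !inE !negb_or !ne ne2 // eq_sym.
have A : all (ltn^~ N) [:: f a; f l; f n] by rewrite /= !f_lt.
have := tri _ _ _ b (OSact f (fun c => e (Some l, c))) U A.
rewrite (X_symE _ _ (f n) (f a)) (anti (f a) (f l)) ?f_lt ?ne ?ne2 // 1?eq_sym //.
by move=> /eqP; rewrite subr_eq0 => /eqP <-; ring.
Qed.

Definition PBWact n (f : nat -> nat) (F : PBWword n -> k) (s : PBWword n) : k :=
  ev [seq (f a.1, f a.2) | a <- flat s] F.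

Lemma PBWact_linear n f (s : PBWword n) : lin (fun F => PBWact f F s).
Proof. by move=> a F G; rewrite /PBWact ev_linear. Qed.

Lemma PBWact_Y n f i j (F : PBWword n -> k) (s : PBWword n) : {in ltn^~ n &, injective f} ->
  i != j -> (i < n)%N -> (j < n)%N -> PBWvalid s ->
  Y i j s (PBWact f F) = PBWact f (fun t => Y (f i) (f j) t F) s.
Proof.
move=> f_inj ij lti ltj Hs.
by rewrite -[LHS](rels_Y [::] (ev_rels F f_inj) (leqnn n)).
Qed.

End Action.

(** * Gradings: each operator reads values of one degree only *)

Section Locality.
Variable k : fieldType.

Fixpoint OSdegree n : OSbasis n -> nat :=
  if n is m.+1 then fun b => (isSome b.1 + OSdegree b.2)%N else fun _ => 0.

Lemma OSdegree_OSone n : OSdegree (OSone n) = 0%N.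
Proof. by elim: n. Qed.

Lemma OSdegree_eq0 n (b : OSbasis n) : OSdegree b = 0%N -> b = OSone n.
Proof. by elim: n b => [|n IH] [] //= [m|] // c /IH ->. Qed.

Lemma X_local n i j (b : OSbasis n) (e1 e2 : OSbasis n -> k) :
  (forall c, (OSdegree c).+1 = OSdegree b -> e1 c = e2 c) -> X i j b e1 = X i j b e2.
Proof.
rewrite /X; elim: n i j b e1 e2 => [|n IH] i j b e1 e2 // E.
case: b E => o c /= E; case: ifP => _.
  case: o E => [p|] //= E; case: ifP => _; last first.
    by congr (- _); apply: IH => c' D; rewrite E //= -D.
  by congr (_ + _); [exact: E|apply: eq_bigr => l _; apply: IH => c' D; rewrite E //= -D].
by congr (_ * _); apply: IH => c' D; rewrite E //= -D addnS.
Qed.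

Lemma OSact_local N f n (b : OSbasis N) (e1 e2 : OSbasis n -> k) :
  (forall c, OSdegree c = OSdegree b -> e1 c = e2 c) -> OSact f e1 b = OSact f e2 b.
Proof.
elim: n b e1 e2 => [|n IH] b e1 e2 E /=.
  have [bE|bN] := eqVneq b (OSone N); last by rewrite !mulr0.
  by rewrite E // bE OSdegree_OSone.
congr (_ + _); first by apply: IH => c D; apply: E.
apply: eq_bigr => l _; apply: X_local => c D; apply: IH => c' D'.
by apply: E; rewrite /= D' add1n.
Qed.

Lemma PBWact_local n f (s : PBWword n) (F G : PBWword n -> k) :
  {in ltn^~ n &, injective f} -> (forall x, (x < n)%N -> (f x < n)%N) -> PBWvalid s ->
  (forall v, PBWvalid v -> PBWdegree v = PBWdegree s -> F v = G v) -> PBWact f F s = PBWact f G s.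
Proof.
move=> f_inj f_lt Hs E; apply: ev_local => [|v Hv].
  rewrite all_map; apply: sub_all (flat_valid Hs) => -[i j] /and3P[/= lti ltj ij].
  by rewrite /valid /= !f_lt //=; apply: contra ij => /eqP /f_inj ->.
by rewrite size_map size_flat; apply: E.
Qed.

End Locality.

(** * Equivariance of the Koszul differential *)

Definition perm_nat n (s : 'S_n) (x : nat) : nat := if insub x is Some i then val (s i) else x.

Lemma perm_nat_val n (s : 'S_n) (i : 'I_n) : perm_nat s i = s i.
Proof. by rewrite /perm_nat valK. Qed.

Lemma perm_nat_lt n (s : 'S_n) x : (x < n)%N -> (perm_nat s x < n)%N.
Proof. by move=> ltx; rewrite -[x]/(val (Ordinal ltx)) perm_nat_val. Qed.

Lemma perm_nat_inj n (s : 'S_n) : {in ltn^~ n &, injective (perm_nat s)}.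
Proof.
move=> x y Hx Hy; have ltx : (x < n)%N := Hx; have lty : (y < n)%N := Hy.
rewrite -[x]/(val (Ordinal ltx)) -[y]/(val (Ordinal lty)) !perm_nat_val => /val_inj /perm_inj.
by move=> [].
Qed.

Section Koszul.
Variable k : fieldType.
Hypothesis k0 : [pchar k] =i pred0.
Variable n : nat.

Let T := (OSbasis n * PBWword n)%type.

Definition dT (h : T -> k) (x : T) : k := koszul_d (fun b s => h (b, s)) x.1 x.2.

(** Forms on the dual algebra are pulled back along s, so elements of OS are pushed forward along
    the inverse of s; with this pairing the sum of x_ij tensor y_ij is invariant. *)
Definition rT (s : 'S_n) (h : T -> k) (x : T) : k :=
  OSact (perm_nat s^-1) (fun c => PBWact (perm_nat s) (fun t => h (c, t)) x.2) x.1.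

Lemma dT_linear x : lin (fun h => dT h x).
Proof. by move=> a f g; rewrite /dT koszul_d_linear. Qed.

Lemma rT_linear s x : lin (fun h => rT s h x).
Proof.
move=> a f g; rewrite /rT -OSact_linear; apply: OSact_fext => c; exact: PBWact_linear.
Qed.

Lemma rT_dT s h x : PBWvalid x.2 -> rT s (dT h) x = dT (rT s h) x.
Proof.
case: x => b t /= Ht; rewrite /rT /dT /=.
have -> : koszul_d (fun c u => OSact (perm_nat s^-1) (fun c0 => PBWact (perm_nat s) (fun v => h (c0, v)) u) c) b t =
  \sum_(i < n) \sum_(j < n | j != i) OSact (perm_nat s^-1) (fun c => X (s i) (s j) c (fun c' =>
    PBWact (perm_nat s) (fun v => Y (s i) (s j) v (fun v => h (c', v))) t)) b.
  apply: eq_bigr => i _; apply: eq_bigr => j ji.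
  have E (i' : 'I_n) : val i' = perm_nat s^-1 (s i') by rewrite perm_nat_val permK.
  rewrite OSact_X //; last first.
  - by rewrite val_eqE (inj_eq perm_inj) eq_sym.
  - exact: perm_nat_lt.
  - exact: perm_nat_inj.
  rewrite -!E.
  apply: X_fext => c; rewrite -(OSact_lin _ (fun c0 u => PBWact (perm_nat s) (fun v => h (c0, v)) u)); last exact: Y_linear.
  apply: OSact_fext => c'; rewrite PBWact_Y //; [|exact: perm_nat_inj|by rewrite eq_sym].
  by rewrite !perm_nat_val.
rewrite (@OSact_fext _ _ _ _ _ (fun c => \sum_(i < n) \sum_(j < n | j != i)
    X (s i) (s j) c (fun c' => PBWact (perm_nat s) (fun v => Y (s i) (s j) v (fun v => h (c', v))) t))).
  rewrite (lin_sum (OSact_linear _ _)); apply: eq_bigr => i _.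
  by rewrite (lin_sum (OSact_linear _ _)).
move=> c; rewrite (lin_sum (PBWact_linear _ _)) (reindex_inj (@perm_inj _ s)).
apply: eq_bigr => i _; rewrite (lin_sum (PBWact_linear _ _)) (reindex_inj (@perm_inj _ s)).
apply: eq_big => [j|j _]; first by rewrite (inj_eq perm_inj).
exact/esym/(X_lin (L := fun F => PBWact (perm_nat s) F t) (fun c' u => Y (s i) (s j) u (fun v => h (c', v))))/PBWact_linear.
Qed.

End Koszul.

(** * Alternating traces on an exact complex *)

Section Lefschetz.
Variable k : fieldType.

(** With a pseudo-inverse [h j] of [d j], [t j] is the trace of the action on the image of [d j].
    Exactness gives tr (r (j+1)) = t (j+1) + t j, so the alternating sum telescopes to a multiple of
    [t N], which is 0 because [d N] has no columns. *)
Lemma lefschetz (m : nat -> nat) (d : forall j, 'M[k]_(m j, m j.+1))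
    (r : forall j, 'M[k]_(m j)) N :
  (forall j, r j *m d j = d j *m r j.+1) -> (forall j, d j *m d j.+1 = 0) ->
  (forall v : 'rV_(m 0), v *m d 0 = 0 -> v = 0) ->
  (forall j (v : 'rV_(m j.+1)), v *m d j.+1 = 0 -> exists w, v = w *m d j) ->
  m N.+1 = 0%N -> \sum_(j < N.+1) (-1) ^+ j * \tr (r j) = 0.
Proof.
move=> rd dd ex0 exS mN.
pose h j := pinvmx (d j); pose e j := 1%:M - d j *m h j.
pose t j := \tr (r j *m d j *m h j).
have ed j : e j *m d j = 0 by rewrite mulmxBl mul1mx mulmxKpV ?subrr.
have rE j : \tr (r j) = t j + \tr (r j *m e j).
  by rewrite /t /e mulmxBr mulmx1 linearB /= (mulmxA (r j) (d j)) addrCA subrr addr0.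
have r0 : \tr (r 0%N) = t 0%N.
  rewrite rE (_ : e 0%N = 0) ?mulmx0 ?linear0 ?addr0 //.
  apply/row_matrixP => i; rewrite row0; apply: ex0.
  by rewrite -row_mul ed row0.
have rS j : \tr (r j.+1) = t j.+1 + t j.
  rewrite rE; congr (_ + _); set E := e j.+1.
  have EE : E = E *m h j *m d j.
    apply/row_matrixP => i; rewrite row_mul row_mul.
    have [|w ->] := exS j (row i E); first by rewrite -row_mul ed row0.
    by rewrite mulmxKpV // submxMl.
  have dE : d j *m E = d j by rewrite /E /e mulmxBr mulmx1 mulmxA dd mul0mx subr0.
  clearbody E; rewrite EE mulmxA mxtrace_mulC !(mulmxA (d j)) -rd.
  by rewrite -(mulmxA (r j)) (mulmxA (d j)) dE mulmxA.
have sumE M : \sum_(j < M.+1) (-1) ^+ j * \tr (r j) = (-1) ^+ M * t M.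
  elim: M => [|M IH]; first by rewrite big_ord1 r0.
  by rewrite big_ord_recr IH /= rS exprS; ring.
rewrite sumE /t (_ : d N = 0) ?mulmx0 ?mul0mx ?linear0 ?mulr0 //.
by apply/matrixP => i [j lj]; exfalso; rewrite mN in lj.
Qed.

End Lefschetz.

(** * Matrices of operators on functions, cut down to finite lists of points *)

Section OperatorMatrix.
Variables (k : fieldType) (T : eqType).

Definition delta (y x : T) : k := (x == y)%:R.

Definition opmx (l1 l2 : seq T) (O : (T -> k) -> T -> k) : 'M[k]_(size l1, size l2) :=
  \matrix_(p, q) O (delta (tnth (in_tuple l1) p)) (tnth (in_tuple l2) q).

Definition fun_of (l : seq T) (v : 'rV[k]_(size l)) (x : T) : k :=
  \sum_p v 0 p * delta (tnth (in_tuple l) p) x.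

Definition vec_of (l : seq T) (h : T -> k) : 'rV[k]_(size l) :=
  \row_p h (tnth (in_tuple l) p).

Lemma delta_tnth (l : seq T) p q : uniq l ->
  delta (tnth (in_tuple l) p) (tnth (in_tuple l) q) = (q == p)%:R.
Proof. by move=> Ul; rewrite /delta (inj_eq (elimT (@tuple_uniqP _ _ (in_tuple l)) Ul)). Qed.

Lemma vec_ofK l h x : uniq l -> x \in l -> fun_of (vec_of l h) x = h x.
Proof.
move=> Ul; rewrite -[l]/(val (in_tuple l)) => /tnthP[p ->].
rewrite /fun_of (bigD1 p) //= mxE delta_tnth // eqxx mulr1 big1 ?addr0 // => q qp.
by rewrite delta_tnth // eq_sym (negbTE qp) mulr0.
Qed.

Lemma fun_ofK l (v : 'rV_(size l)) : uniq l -> vec_of l (fun_of v) = v.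
Proof.
move=> Ul; apply/rowP => p; rewrite mxE /fun_of (bigD1 p) //= delta_tnth // eqxx mulr1.
by rewrite big1 ?addr0 // => q qp; rewrite delta_tnth // eq_sym (negbTE qp) mulr0.
Qed.

Lemma fun_of_out l (v : 'rV_(size l)) x : x \notin l -> fun_of v x = 0.
Proof.
move=> xl; rewrite /fun_of big1 // => p _; rewrite /delta.
by have [xE|] := eqVneq; rewrite ?mulr0 //; case/negP: xl; rewrite xE mem_tnth.
Qed.

Lemma mul_opmx l1 l2 (v : 'rV_(size l1)) O : (forall x, lin (fun h => O h x)) ->
  v *m opmx l1 l2 O = vec_of l2 (O (fun_of v)).
Proof.
move=> linO; apply/rowP => q; rewrite !mxE (lin_sum (linO _)).
by apply: eq_bigr => p _; rewrite mxE (linZ (linO _)).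
Qed.

Lemma opmx_row l1 l2 O p :
  row p (opmx l1 l2 O) = vec_of l2 (O (delta (tnth (in_tuple l1) p))).
Proof. by apply/rowP => q; rewrite !mxE. Qed.

(** [O1] may produce values outside [l2]; the product is still correct because [O2], read on [l3],
    looks only at [l2]. *)
Lemma opmx_comp l1 l2 l3 O1 O2 : uniq l2 -> (forall x, lin (fun h => O2 h x)) ->
  (forall h h', {in l2, h =1 h'} -> {in l3, O2 h =1 O2 h'}) ->
  opmx l1 l2 O1 *m opmx l2 l3 O2 = opmx l1 l3 (fun h => O2 (O1 h)).
Proof.
move=> U2 linO loc; apply/row_matrixP => p; rewrite row_mul opmx_row mul_opmx // opmx_row.
apply/rowP => q; rewrite !mxE; apply: loc; last exact: mem_tnth.
by move=> x; apply: vec_ofK.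
Qed.

Lemma eq_opmx l1 l2 O1 O2 : (forall h, {in l2, O1 h =1 O2 h}) -> opmx l1 l2 O1 = opmx l1 l2 O2.
Proof. by move=> E; apply/matrixP => p q; rewrite !mxE E // mem_tnth. Qed.

Lemma tr_opmx l O : \tr (opmx l l O) = \sum_(x <- l) O (delta x) x.
Proof. by rewrite big_tnth; apply: eq_bigr => p _; rewrite mxE. Qed.

End OperatorMatrix.

(** * Enumeration of the normal words of given degree *)

Section KoszulTrace.
Variable k : fieldType.

Fixpoint words_of (n m : nat) : seq (seq nat) :=
  if m is m'.+1 then [seq x :: w | x <- iota 0 n, w <- words_of n m'] else [:: [::]].

Lemma mem_words_of n m w : (w \in words_of n m) = (size w == m) && all (ltn^~ n) w.
Proof.
elim: m w => [|m IH] [|x w] //=.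
  by apply/negbTE/negP => /allpairsP[[y v] []].
apply/allpairsP/idP => [[[y v] [/= Hy Hv [-> ->]]]|/and3P[Sw ltx Hw]].
  by move: Hy Hv; rewrite mem_iota IH /= eqSS => -> /andP[-> ->].
by exists (x, w); rewrite mem_iota IH -eqSS Sw ltx Hw.
Qed.

Lemma words_of_uniq n m : uniq (words_of n m).
Proof.
elim: m => // m IH; apply: allpairs_uniq => //; first exact: iota_uniq.
by move=> [x w] [y v] _ _ [-> ->].
Qed.

Fixpoint PBWwords (n i : nat) : seq (PBWword n) :=
  if n is m.+1 then
    flatten [seq [seq (w, u) | w <- words_of m p, u <- PBWwords m (i - p)] | p <- iota 0 i.+1]
  else if i == 0%N then [:: tt] else [::].

Lemma mem_PBWwords n i (s : PBWword n) : (s \in PBWwords n i) = PBWvalid s && (PBWdegree s == i).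
Proof.
elim: n i s => [|n IH] i; first by case; case: i.
move=> [w u]; rewrite [PBWvalid _]/= [PBWdegree _]/=; apply/flatten_mapP/idP => [[p]|].
  rewrite mem_iota => /= Hp /allpairsP[[v t] [/= Hv Ht [-> ->]]].
  move: Hv Ht; rewrite mem_words_of IH => /andP[/eqP Sv ->] /andP[-> /eqP ->] /=.
  by rewrite Sv; apply/eqP; lia.
move=> /andP[/andP[Hw Hu] /eqP <-]; exists (size w); first by rewrite mem_iota /=; lia.
apply/allpairsP; exists (w, u); split=> //=; first by rewrite mem_words_of eqxx.
by rewrite IH Hu /=; apply/eqP; lia.
Qed.

Lemma PBWwords_uniq n i : uniq (PBWwords n i).
Proof.
elim: n i => [|n IH] i; first by rewrite /=; case: ifP.
change (uniq (flatten [seq [seq (w, u) | w <- words_of n p, u <- PBWwords n (i - p)] | p <- iota 0 i.+1])).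
elim: (iota 0 i.+1) (iota_uniq 0 i.+1) => // p l IHl; rewrite [uniq (_ :: _)]/= => /= /andP[pl Ul]; rewrite cat_uniq IHl // andbT; apply/andP; split.
  by apply: allpairs_uniq (words_of_uniq _ _) (IH _) _ => -[x v] [y t].
apply/hasPn => x /flatten_mapP[q ql /allpairsP[[w u] [/= Hw _ ->]]].
apply/negP => /allpairsP[[w' u'] [/= Hw' _ [ww' _]]].
move: Hw Hw'; rewrite -ww' !mem_words_of => /andP[/eqP E1 _] /andP[/eqP E2 _].
by rewrite -E2 E1 ql in pl.
Qed.

End KoszulTrace.

(** * The trace identity in total degree N *)

Section KoszulTraceFormula.
Variable k : fieldType.
Hypothesis k0 : [pchar k] =i pred0.
Variable n : nat.

Definition OStrace j (s : 'S_n) : k := \sum_(b : OSbasis n | OSdegree b == j) OSact (perm_nat s^-1) (delta k b) b.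

Definition dual_trace i (s : 'S_n) : k := \sum_(t <- PBWwords n i) PBWact (perm_nat s) (delta k t) t.

Variables (N : nat) (s : 'S_n).
Hypothesis N_gt0 : (0 < N)%N.

Local Notation T := (OSbasis n * PBWword n)%type.

(** Basis of OS_j tensor the forms of degree N - j. The test matters: for j > N the truncated
    difference would be 0 and yield spurious cells, and the complex has to stop after N. *)
Definition cells j : seq T :=
  if (j <= N)%N then [seq (b, t) | b <- [seq b <- enum (OSbasis n) | OSdegree b == j], t <- PBWwords n (N - j)]
  else [::].

Lemma mem_cells j (x : T) :
  (x \in cells j) = [&& (j <= N)%N, OSdegree x.1 == j, PBWvalid x.2 & PBWdegree x.2 == (N - j)%N].
Proof.
rewrite /cells; case: ifP => //= _; case: x => b t /=.
apply/allpairsP/and3P => [[[b' t'] /= [Hb Ht [-> ->]]]|[Hb Ht Dt]].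
  by move: Hb Ht; rewrite mem_filter mem_PBWwords => /andP[-> _] /andP[-> ->].
by exists (b, t); rewrite /= mem_filter Hb mem_enum mem_PBWwords Ht Dt.
Qed.

Lemma cells_uniq j : uniq (cells j).
Proof.
rewrite /cells; case: ifP => // _; apply: allpairs_uniq; last by move=> [x v] [y t].
  by rewrite filter_uniq // enum_uniq.
exact: PBWwords_uniq.
Qed.

Lemma dT_cells j (h h' : T -> k) : {in cells j, h =1 h'} -> {in cells j.+1, dT h =1 dT h'}.
Proof.
move=> E [b t]; rewrite mem_cells => /and4P[/= jN /eqP Db Ht /eqP Dt].
apply: eq_bigr => i _; apply: eq_bigr => i' ii'.
apply: X_local => c Dc; apply: Y_local => //; first by rewrite eq_sym.
have Dc' : OSdegree c = j by rewrite Db in Dc; case: Dc.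
by move=> v Hv Dv; apply: E; rewrite mem_cells /= Hv Dc' eqxx Dv Dt (ltnW jN) /=; apply/eqP; lia.
Qed.

Lemma rT_cells j (h h' : T -> k) : {in cells j, h =1 h'} -> {in cells j, rT s h =1 rT s h'}.
Proof.
move=> E [b t]; rewrite mem_cells => /and4P[/= jN /eqP Db Ht /eqP Dt].
apply: OSact_local => c Dc; apply: PBWact_local => //; [exact: perm_nat_inj|exact: perm_nat_lt|].
by move=> v Hv Dv; apply: E; rewrite mem_cells /= Hv Dc Db eqxx Dv Dt eqxx jN.
Qed.

Lemma tr_cells j : (j <= N)%N ->
  \tr (opmx (cells j) (cells j) (@rT k n s)) = OStrace j s * dual_trace (N - j) s.
Proof.
move=> jN; rewrite tr_opmx /cells jN big_allpairs big_filter big_enum_cond /= /OStrace mulr_suml.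
apply: eq_bigr => b _.
rewrite /dual_trace mulr_sumr; apply: eq_bigr => t _; rewrite /rT /=.
rewrite mulrC -(linZ (OSact_linear _ _)); apply: OSact_fext => c.
rewrite mulrC -(linZ (PBWact_linear _ _)); congr (PBWact _ _ _).
by apply: functional_extensionality => v; rewrite /delta xpair_eqE -mulnb natrM.
Qed.

Lemma dT_out j (v : 'rV[k]_(size (cells j))) b t : PBWvalid t ->
  (b, t) \notin cells j.+1 -> dT (fun_of v) (b, t) = 0.
Proof.
move=> Ht nbt; rewrite /dT -[RHS](_ : koszul_d (fun _ _ => 0 : k) b t = 0); last first.
  by rewrite /koszul_d big1 // => i _; rewrite big1 // => i' _; rewrite -[RHS](lin0 (X_linear i i' b));
    apply: X_fext => c; rewrite (lin0 (Y_linear _ _ _)).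
apply: eq_bigr => i _; apply: eq_bigr => i' ii'.
apply: X_local => c /= Dc; apply: Y_local => //; first by rewrite eq_sym.
move=> u Hu /= Du; apply: fun_of_out; apply: contra nbt; rewrite !mem_cells /= Ht => /and4P[jN Dj _ Di].
rewrite -Dc (eqP Dj) eqxx /=; move/eqP: Di => Di.
rewrite Du in Di; apply/andP; split; first by lia.
by apply/eqP; lia.
Qed.

Theorem koszul_trace : \sum_(j < N.+1) (-1) ^+ j * (OStrace j s * dual_trace (N - j) s) = 0.
Proof.
have := @lefschetz k (fun j => size (cells j)) (fun j => opmx (cells j) (cells j.+1) (@dT k n))
  (fun j => opmx (cells j) (cells j) (@rT k n s)) N.
have lindT x := @dT_linear k n x; have linrT x := @rT_linear k n s x.
have dTc j := @dT_cells j; have rTc j := @rT_cells j.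
have closed j (v : 'rV[k]_(size (cells j))) : v *m opmx (cells j) (cells j.+1) (@dT k n) = 0 ->
    exists f, forall b t, PBWvalid t -> koszul_d f b t = fun_of v (b, t).
  rewrite mul_opmx // => v0; apply: (@koszul_d_exact k k0 n (fun b t => fun_of v (b, t))).
    move=> b t Ht; have [Hbt|Hbt] := boolP ((b, t) \in cells j.+1); last exact: dT_out Hbt.
    rewrite -[LHS]/(dT (fun_of v) (b, t)) -(vec_ofK _ (cells_uniq _) Hbt) v0 /fun_of.
    by rewrite big1 // => p _; rewrite mxE mul0r.
  (* Exactness requires the value at the unit to vanish. The unit has total degree 0, so it is no
     cell when N is positive. *)
  apply: fun_of_out; rewrite mem_cells OSdegree_OSone PBWdegree_one.
  by apply/negP => /and4P[_ /eqP <- _]; rewrite subn0 => /eqP E; move: N_gt0; rewrite -E.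
move=> L; rewrite -[RHS]L => {L}.
- by apply: eq_bigr => j _; rewrite tr_cells // -ltnS.
- move=> j; rewrite !opmx_comp ?cells_uniq //; try by [exact: rTc|exact: dTc].
  by apply: eq_opmx => h x; rewrite mem_cells => /and4P[_ _ Hx _]; rewrite rT_dT.
- move=> j; rewrite opmx_comp ?cells_uniq //; try exact: dTc.
  by apply/matrixP => p q; rewrite !mxE /dT; exact: koszul_d_koszul_d.
- move=> v /closed[f fK]; rewrite -(fun_ofK v (cells_uniq 0)); apply/rowP => p; rewrite !mxE.
  have := mem_tnth p (in_tuple (cells 0)); case: (tnth _ p) => b t.
  rewrite mem_cells => /and4P[/= _ /eqP/OSdegree_eq0 -> Ht _].
  by rewrite -fK // koszul_d_OSone.
- move=> j v /closed[f fK]; exists (vec_of (cells j) (fun x => f x.1 x.2)).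
  rewrite mul_opmx // -[LHS](fun_ofK v (cells_uniq _)); apply/rowP => p; rewrite !mxE.
  have := mem_tnth p (in_tuple (cells j.+1)); case: (tnth _ p) => b t Hbt.
  have Ht : PBWvalid t by move: Hbt; rewrite mem_cells => /and4P[].
  rewrite -fK // -[LHS]/(dT (fun x => f x.1 x.2) (b, t)); apply: dTc Hbt => x Hx.
  by rewrite vec_ofK ?cells_uniq.
by rewrite /cells ltnn.
Qed.

End KoszulTraceFormula.

(** * The quadratic relations and the forms they span *)

Section Relations.
Variables (k : fieldType) (n : nat).
Implicit Types (a b c i j l : 'I_n) (P Q : {set 'I_n}).

Lemma set2_ltn a b a' b' : (a < b)%N -> (a' < b')%N ->
  ([set a; b] == [set a'; b']) = (a == a') && (b == b').
Proof.
move=> ab ab'; apply/eqP/andP => [E|[/eqP -> /eqP ->]] //.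
have : a \in [set a'; b'] by rewrite -E set21.
have : b \in [set a'; b'] by rewrite -E set22.
have : a' \in [set a; b] by rewrite E set21.
have : b' \in [set a; b] by rewrite E set22.
rewrite !inE -!val_eqE /=; lia.
Qed.

Definition gcoef a b c P Q : k :=
  ((P == [set a; b]) && (Q == [set a; c]))%:R
  - ((P == [set a; b]) && (Q == [set b; c]))%:R
  + ((P == [set a; c]) && (Q == [set b; c]))%:R.

(** Of the six ordered pairs of edges of a triangle x, y, z, the sorted relation sees only xy, xz
    and yz; the reversed pairs have coefficient 0. *)
Lemma gcoefE a b c a' b' c' (E := ((a, b, c) == (a', b', c'))%:R : k) :
    (a < b < c)%N -> (a' < b' < c')%N ->
  let x := [set a; b] in let y := [set a; c] in let z := [set b; c] in
  [/\ gcoef a' b' c' x y = E, gcoef a' b' c' x z = - E & gcoef a' b' c' y z = E] /\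
  [/\ gcoef a' b' c' y x = 0, gcoef a' b' c' z x = 0 & gcoef a' b' c' z y = 0].
Proof.
move=> /andP[ab bc] /andP[ab' bc'] x y z.
have ac := ltn_trans ab bc; have ac' := ltn_trans ab' bc'.
rewrite /gcoef /E /x /y /z !set2_ltn // !xpair_eqE -!val_eqE /=.
by split; split; repeat match goal with |- context [@eq_op _ ?u ?v] =>
  case: (@eqP _ u v) => ? end; rewrite /=; try (exfalso; lia); ring.
Qed.

Lemma sort3_ind (P : 'I_n -> 'I_n -> 'I_n -> Prop) :
  (forall i j l, P i j l -> P j i l) -> (forall i j l, P i j l -> P i l j) ->
  (forall a b c, (a < b < c)%N -> P a b c) -> forall i j l, uniq [:: i; j; l] -> P i j l.
Proof.
move=> sw1 sw2 Ps i j l; rewrite /= !inE !negb_or !andbT -!val_eqE /=.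
move=> /andP[/andP[ij il] jl].
case: (ltngtP i j) ij => // ij _; case: (ltngtP i l) il => // il _;
  case: (ltngtP j l) jl => // jl _; try (exfalso; lia).
- by apply: Ps; rewrite ij.
- by apply/sw2; apply: Ps; rewrite il.
- by apply/sw2; apply/sw1; apply: Ps; rewrite il.
- by apply/sw1; apply: Ps; rewrite ij.
- by apply/sw1; apply/sw2; apply: Ps; rewrite jl.
- by apply/sw1; apply/sw2; apply/sw1; apply: Ps; rewrite jl.
Qed.

(** A function on pairs of edges is both an element of T^2(x) and a form on T^2(y). As a form it
    kills the Drinfeld-Kohno commutators; [pair_rels_span] shows that as an element it lies in
    I_2. *)
Record pair_rels (phi : {set 'I_n} -> {set 'I_n} -> k) : Prop := PairRels {
  pr_disjoint : forall i j l m, uniq [:: i; j; l; m] ->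
    phi [set i; j] [set l; m] = phi [set l; m] [set i; j];
  pr_triangle : forall i j l, uniq [:: i; j; l] ->
    phi [set i; j] [set i; l] + phi [set i; j] [set j; l] =
    phi [set i; l] [set i; j] + phi [set j; l] [set i; j] }.

Lemma gcoef_disjoint a b c P Q : [disjoint P & Q] -> gcoef a b c P Q = 0.
Proof.
move=> PQ; have H u v w : (P == [set u; v]) && (Q == [set u; w]) = false.
  apply/negP => /andP[/eqP E1 /eqP E2]; move: PQ; rewrite E1 E2.
  by move/disjointFr => /(_ u); rewrite !set21 => /(_ isT).
have H' u v w : (P == [set v; u]) && (Q == [set u; w]) = false by rewrite setUC H.
have H'' u v w : (P == [set v; u]) && (Q == [set w; u]) = false.
  by rewrite (setUC [set w] [set u]) H'.
by rewrite /gcoef H H' H'' subrr add0r.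
Qed.

Definition rel_set (r : relidx n) P Q : k :=
  match r with
  | inl (A, B) => ((P == val A) && (Q == val B))%:R + ((P == val B) && (Q == val A))%:R
  | inr (a, b, c) => if (a < b < c)%N then gcoef a b c P Q else 0
  end.

Lemma relcoefE r (w : word n 2) : relcoef k r w = rel_set r (val (w ord0)) (val (w ord_max)).
Proof. by case: r => [[A B]|[[a b] c]]. Qed.

Lemma disjoint_set2 i j l m : uniq [:: i; j; l; m] -> [disjoint [set i; j] & [set l; m]].
Proof.
rewrite /= !inE !negb_or !andbT => /and3P[/and3P[_ il im] /andP[jl jm] _].
by rewrite disjoints_subset; apply/subsetP => x; rewrite !inE => /orP[]/eqP->; rewrite negb_or ?il ?im ?jl ?jm.
Qed.

Lemma rel_set_rels r : pair_rels (rel_set r).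
Proof.
case: r => [[A B]|[[a b] c]].
  have sy P Q : rel_set (inl (A, B)) P Q = rel_set (inl (A, B)) Q P.
    by rewrite /= addrC andbC; congr (_ + _); rewrite andbC.
  split=> [i j l m _|i j l _]; first exact: sy.
  by rewrite (sy [set i; j] [set i; l]) (sy [set i; j] [set j; l]).
have [abc|abc] := boolP (a < b < c)%N; last by split=> *; rewrite /rel_set (negbTE abc).
split=> [i j l m U|]; rewrite /rel_set abc.
  by have dj := disjoint_set2 U; rewrite !gcoef_disjoint // disjoint_sym.
pose t i j l := gcoef a b c [set i; j] [set i; l] + gcoef a b c [set i; j] [set j; l] =
    gcoef a b c [set i; l] [set i; j] + gcoef a b c [set j; l] [set i; j].
suff H : forall i j l, uniq [:: i; j; l] -> [/\ t i j l, t i l j & t j l i].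
  by move=> i j l /H[].
have tC i j l : t i j l -> t j i l.
  by rewrite /t (setUC [set j] [set i]) => E; rewrite addrC E addrC.
apply: sort3_ind => [i j l [h1 h2 h3]|i j l [h1 h2 h3]|i j l ijl].
- by split=> //; apply: tC.
- by split=> //; apply: tC.
rewrite /t (setUC [set j] [set i]) (setUC [set l] [set i]) (setUC [set l] [set j]).
have [[-> -> ->] [-> -> ->]] := gcoefE ijl abc.
by split; ring.
Qed.

End Relations.

Section Span.
Variables (k : fieldType) (n : nat).
Hypothesis k0 : [pchar k] =i pred0.

Lemma gen_set2 (A : gen n) : exists i j : 'I_n, i != j /\ val A = [set i; j].
Proof. by have /cards2P[i [j [ij ->]]] := valP A; exists i, j. Qed.

Definition apart (P Q : {set 'I_n}) := (P == Q) || [disjoint P & Q].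

Lemma gen_cases (A B : gen n) : apart (val A) (val B) \/
  exists i j l, [/\ uniq [:: i; j; l], val A = [set i; j] & val B = [set i; l]].
Proof.
have [->|AB] := eqVneq A B; first by left; rewrite /apart eqxx.
have [dAB|] := boolP [disjoint val A & val B]; first by left; rewrite /apart dAB orbT.
move=> /pred0Pn[i /= /andP[iA iB]]; right.
have sh (C : gen n) : i \in val C -> exists2 j, i != j & val C = [set i; j].
  have [x [y [xy ->]]] := gen_set2 C; rewrite !inE => /orP[] /eqP ->; [by exists y|].
  by exists x; rewrite 1?eq_sym // setUC.
have [j ij EA] := sh A iA; have [l il EB] := sh B iB.
have jl : j != l by apply: contra AB => /eqP jl; rewrite -val_eqE EA EB jl.
by exists i, j, l; rewrite /= !inE negb_or ij il jl.
Qed.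

Lemma pair_rels_apart (phi : {set 'I_n} -> {set 'I_n} -> k) (A B : gen n) :
  pair_rels phi -> apart (val A) (val B) -> phi (val A) (val B) = phi (val B) (val A).
Proof.
move=> [pd _] /orP[/eqP -> //|AB].
have [i [j [ij EA]]] := gen_set2 A; have [l [m [lm EB]]] := gen_set2 B.
rewrite EA EB pd //; move: AB; rewrite EA EB disjoints_subset => /subsetP S.
have := S i (set21 _ _); have := S j (set22 _ _).
by rewrite /= !inE !negb_or ij lm => /andP[-> ->] /andP[-> ->].
Qed.

(** Subtracting one triangle relation per sorted triple leaves a function symmetric in its two
    edges, and symmetric functions are combinations of anticommutators. *)
Lemma pair_rels_span (phi : {set 'I_n} -> {set 'I_n} -> k) : pair_rels phi ->
  exists c : relidx n -> k, forall A B : gen n,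
    phi (val A) (val B) = \sum_r c r * rel_set k r (val A) (val B).
Proof.
move=> phiP; have pt := pr_triangle phiP.
(* The sorted relation has coefficient 1 at (ab, ac) and 0 at (ac, ab), so this choice makes the
   remainder [th] symmetric on that pair; [pr_triangle] forces symmetry on the other two pairs of
   the triangle. *)
pose c3 (t : 'I_n * 'I_n * 'I_n) : k := let: (a, b, c) := t in
  phi [set a; b] [set a; c] - phi [set a; c] [set a; b].
pose G P Q := \sum_(t : 'I_n * 'I_n * 'I_n) c3 t * rel_set k (inr t) P Q.
pose th P Q := phi P Q - G P Q.
have Gs (a b c : 'I_n) P Q e : (a < b < c)%N ->
    (forall a' b' c' : 'I_n, (a' < b' < c')%N -> gcoef k a' b' c' P Q = e * ((a, b, c) == (a', b', c'))%:R) ->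
    G P Q = e * c3 (a, b, c).
  move=> abc gE; rewrite /G (bigD1 (a, b, c)) //= abc gE // eqxx mulr1 mulrC big1 ?addr0 //.
  move=> [[a' b'] c'] /= ne; case: ifP => abc'; last by rewrite mulr0.
  by rewrite gE // eq_sym (negbTE ne) !mulr0.
have th_sym (A B : gen n) : th (val A) (val B) = th (val B) (val A).
  have [AB|[i [j [l [U EA EB]]]]] := gen_cases A B.
    case/orP: (AB) => [/eqP -> //|dAB].
    have GD (P Q : {set 'I_n}) : [disjoint P & Q] -> G P Q = 0.
      move=> PQ; rewrite /G big1 // => -[[a b] c] _ /=.
      by case: ifP; rewrite ?mulr0 // gcoef_disjoint ?mulr0.
    by rewrite /th !GD // 1?disjoint_sym // !subr0 pair_rels_apart.
  rewrite EA EB.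
  pose H i j l := th [set i; j] [set i; l] = th [set i; l] [set i; j].
  suff Hs x y z : uniq [:: x; y; z] -> [/\ H x y z, H y x z & H z x y].
    by have [h _ _] := Hs i j l U.
  move: x y z.
  have HC x y z : H x y z -> H x z y by [].
  apply: sort3_ind => [x y z [h1 h2 h3]|x y z [h1 h2 h3]|a b c abc].
  - by split=> //; apply: HC.
  - by split=> //; apply: HC.
  rewrite /H (setUC [set b] [set a]) (setUC [set c] [set a]) (setUC [set c] [set b]).
  have gE a' b' c' := @gcoefE k n a b c a' b' c' abc.
  have Gxy : G [set a; b] [set a; c] = c3 (a, b, c).
    by rewrite (Gs a b c _ _ 1) ?mul1r // => a' b' c' /gE[[-> _ _] _]; rewrite mul1r.
  have Gxz : G [set a; b] [set b; c] = - c3 (a, b, c).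
    by rewrite (Gs a b c _ _ (-1)) ?mulN1r // => a' b' c' /gE[[_ -> _] _]; rewrite mulN1r.
  have Gyz : G [set a; c] [set b; c] = c3 (a, b, c).
    by rewrite (Gs a b c _ _ 1) ?mul1r // => a' b' c' /gE[[_ _ ->] _]; rewrite mul1r.
  have Gyx : G [set a; c] [set a; b] = 0.
    by rewrite (Gs a b c _ _ 0) ?mul0r // => a' b' c' /gE[_ [-> _ _]]; rewrite mul0r.
  have Gzx : G [set b; c] [set a; b] = 0.
    by rewrite (Gs a b c _ _ 0) ?mul0r // => a' b' c' /gE[_ [_ -> _]]; rewrite mul0r.
  have Gzy : G [set b; c] [set a; c] = 0.
    by rewrite (Gs a b c _ _ 0) ?mul0r // => a' b' c' /gE[_ [_ _ ->]]; rewrite mul0r.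
  rewrite /th Gxy Gxz Gyz Gyx Gzx Gzy /c3; move/andP: abc => [ab bc].
  have U1 : uniq [:: a; b; c] by rewrite /= !inE -!val_eqE /=; lia.
  have U2 : uniq [:: a; c; b] by rewrite /= !inE -!val_eqE /=; lia.
  have := pt _ _ _ U2; rewrite (setUC [set c] [set b]).
  have := pt _ _ _ U1.
  by move=> /(canRL (addKr _)) -> /(canRL (addKr _)) ->; split; ring.
(* The anticommutator of A and B is listed under (A, B) and under (B, A), hence the half; for A = B
   it takes the value 2 by itself. *)
exists (fun r => match r with inl (A, B) => 2%:R^-1 * th (val A) (val B) | inr t => c3 t end).
move=> A B; rewrite big_sumType /= -/(G (val A) (val B)).
suff -> : \sum_(p : gen n * gen n) (let: (A, B) := p in 2%:R^-1 * th (val A) (val B)) *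
    rel_set k (inl p) (val A) (val B) = th (val A) (val B) by rewrite subrK.
have E (p : gen n * gen n) : (let: (A, B) := p in 2%:R^-1 * th (val A) (val B)) *
    rel_set k (inl p) (val A) (val B) =
    (if p == (A, B) then 2%:R^-1 * th (val A) (val B) else 0) +
    (if p == (B, A) then 2%:R^-1 * th (val A) (val B) else 0).
  case: p => C D /=; rewrite !xpair_eqE ![C == _]eq_sym ![D == _]eq_sym [(B == C) && _]andbC !(inj_eq val_inj).
  rewrite mulrDr; congr (_ + _); case: ifP => [/andP[/eqP-> /eqP->]|_]; rewrite ?mulr0 ?mulr1 //.
  by rewrite th_sym.
rewrite (eq_bigr _ (fun p _ => E p)) big_split /= -!big_mkcond !big_pred1_eq -mulrDl.
have -> : 2%:R^-1 + 2%:R^-1 = 1 :> k; last by rewrite mul1r.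
by rewrite -mulr2n -[_ *+ 2]mulr_natl divff // (natk_neq0 k0 1).
Qed.

End Span.

(** * Words in two-element sets against words in pairs of numbers *)

Section Words.
Variables (k : fieldType) (n : nat).
Hypothesis k0 : [pchar k] =i pred0.

Definition edge_set (e : nat * nat) : {set 'I_n} := [set x | (val x == e.1) || (val x == e.2)].

Definition edge_pair (P : {set 'I_n}) : nat * nat :=
  if [pick p : 'I_n * 'I_n | (p.1 < p.2)%N && (P == [set p.1; p.2])] is Some p
  then (val p.1, val p.2) else (0, 0)%N.

Lemma edge_set_val (i j : 'I_n) : edge_set (val i, val j) = [set i; j].
Proof. by apply/setP => x; rewrite !inE /= !val_eqE. Qed.

Lemma edge_pair_val (i j : 'I_n) : (i < j)%N -> edge_pair [set i; j] = (val i, val j).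
Proof.
move=> ij; rewrite /edge_pair; case: pickP => [[a b] /= /andP[ab]|/(_ (i, j))].
  by rewrite set2_ltn // => /andP[/eqP -> /eqP ->].
by rewrite /= ij eqxx.
Qed.

Lemma set2_sorted (i j : 'I_n) : i != j ->
  exists a b : 'I_n, (a < b)%N /\ [set i; j] = [set a; b].
Proof.
move=> ij; case: (ltngtP i j) => [h|h|/val_inj h]; first by exists i, j.
  by exists j, i; rewrite setUC.
by rewrite h eqxx in ij.
Qed.

Lemma gen_sorted (A : gen n) : exists a b : 'I_n, (a < b)%N /\ val A = [set a; b].
Proof. by have [i [j [ij ->]]] := gen_set2 A; apply: set2_sorted. Qed.

Lemma edge_pair_valid (A : gen n) : valid n (edge_pair (val A)).
Proof.
by have [a [b [ab ->]]] := gen_sorted A; rewrite edge_pair_val // /valid /= !ltn_ord neq_ltn ab.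
Qed.

Lemma edge_pairK (A : gen n) : edge_set (edge_pair (val A)) = val A.
Proof. by have [a [b [ab ->]]] := gen_sorted A; rewrite edge_pair_val // edge_set_val. Qed.

Lemma edge_set_gen e : valid n e -> #|edge_set e| == 2%N.
Proof.
case: e => i j /and3P[/= lti ltj ij].
by rewrite -[i]/(val (Ordinal lti)) -[j]/(val (Ordinal ltj)) edge_set_val cards2 -val_eqE /= ij.
Qed.

Lemma edge_set_inj e f : valid n e -> valid n f -> edge_set e = edge_set f -> f = e \/ f = (e.2, e.1).
Proof.
case: e f => [i j] [a b] /and3P[/= lti ltj ij] /and3P[/= lta ltb ab] E.
have : Ordinal lti \in edge_set (a, b) by rewrite -E !inE /= eqxx.
have : Ordinal ltj \in edge_set (a, b) by rewrite -E !inE /= eqxx orbT.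
rewrite !inE /= => /orP[]/eqP ja /orP[]/eqP ia; subst; rewrite ?eqxx // in ij; by [left|right].
Qed.

Lemma ev_edge_set (l l' : seq (nat * nat)) (F : PBWword n -> k) : all (valid n) l -> all (valid n) l' ->
  map edge_set l = map edge_set l' -> ev l F = ev l' F.
Proof.
rewrite /ev; elim: l l' F => [|e l IH] [|f l'] F //= /andP[Ve Vl] /andP[Vf Vl'] [E El].
rewrite -(IH l') //; congr (Y_seq l _ _); apply: functional_extensionality => s.
by case: (edge_set_inj Ve Vf E) => ->; rewrite //= Y_sym.
Qed.

Section Degree.
Variable i : nat.

Definition word_sets (w : word n i) : seq {set 'I_n} := [seq val (w t) | t <- enum 'I_i].
Definition word_edges (w : word n i) : seq (nat * nat) := map edge_pair (word_sets w).

Lemma size_word_sets w : size (word_sets w) = i.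
Proof. by rewrite size_map size_enum_ord. Qed.

Lemma size_word_edges w : size (word_edges w) = i.
Proof. by rewrite size_map size_word_sets. Qed.

Lemma word_edges_valid w : all (valid n) (word_edges w).
Proof. by rewrite !all_map; apply/allP => t _ /=; apply: edge_pair_valid. Qed.

Lemma edge_set_word_edges w : map edge_set (word_edges w) = word_sets w.
Proof. by rewrite /word_edges /word_sets -!map_comp; apply: eq_map => t /=; apply: edge_pairK. Qed.

Lemma nth_word_sets w (t : 'I_i) : nth set0 (word_sets w) t = val (w t).
Proof. by rewrite (nth_map t) ?size_enum_ord // nth_ord_enum. Qed.

Lemma word_sets_inj : injective word_sets.
Proof.
by move=> w w' E; apply/ffunP => t; apply: val_inj; rewrite -!nth_word_sets E.
Qed.

Lemma word_sets_ex (L : seq {set 'I_n}) : size L = i -> all (fun P : {set 'I_n} => #|P| == 2%N) L ->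
  exists w, word_sets w = L.
Proof.
move=> SL AL.
have H (t : 'I_i) : #|nth set0 L t| == 2%N by apply: (allP AL); rewrite mem_nth // SL.
exists [ffun t : 'I_i => exist _ (nth set0 L t) (H t) : gen n].
apply: (@eq_from_nth _ set0) => [|p]; rewrite size_word_sets ?SL // => ltp.
by rewrite -[p]/(val (Ordinal ltp)) nth_word_sets ffunE.
Qed.

Lemma word_sets_card w : all (fun P : {set 'I_n} => #|P| == 2%N) (word_sets w).
Proof. by rewrite all_map; apply/allP => t _ /=; apply: (valP (w t)). Qed.

Lemma word_sets_splice w (p : 'I_i) x : (p.+1 < i)%N ->
  word_sets (splice w p x) =
  take p (word_sets w) ++ [:: val (x ord0), val (x ord_max) & drop p.+2 (word_sets w)].
Proof.
move=> ltp; have Sp : size (take p (word_sets w)) = p by rewrite size_takel ?size_word_sets // ltnW.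
apply: (@eq_from_nth _ set0) => [|q].
  by rewrite size_cat Sp /= size_drop !size_word_sets; lia.
rewrite size_word_sets => ltq; rewrite -[q]/(val (Ordinal ltq)) nth_word_sets ffunE /=.
rewrite nth_cat Sp.
have [qp|qp] := ltnP q p.
  have -> : (q == p) = false by lia.
  have -> : (q == p.+1) = false by lia.
  by rewrite nth_take // -[q]/(val (Ordinal ltq)) nth_word_sets.
have [->|qp'] := eqVneq q p; first by rewrite subnn.
have [->|qp''] := eqVneq q p.+1; first by rewrite subSnn.
have -> : (q - p = (q - p.+2).+2)%N by lia.
rewrite /= nth_drop; have -> : (p.+2 + (q - p.+2) = val (Ordinal ltq))%N by rewrite /=; lia.
by rewrite nth_word_sets.
Qed.

(** The map that sends a word of T^i to its expansion in normal words; J_i turns out to be its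
    kernel. *)
Definition PBWmx : 'M[k]_(#|word n i|, size (PBWwords n i)) :=
  \matrix_(u, p) ev (word_edges (enum_val u)) (delta k (tnth (in_tuple (PBWwords n i)) p)).

Lemma ev_expand (l : seq (nat * nat)) (F : PBWword n -> k) : all (valid n) l -> size l = i ->
  ev l F = \sum_p ev l (delta k (tnth (in_tuple (PBWwords n i)) p)) * F (tnth (in_tuple (PBWwords n i)) p).
Proof.
move=> Vl Sl; rewrite (ev_local (G := fun x => fun_of (vec_of (PBWwords n i) F) x)) //.
  rewrite (lin_sum (ev_linear _)); apply: eq_bigr => p _.
  by rewrite (linZ (ev_linear _)) mxE mulrC.
by move=> v Hv Dv; rewrite vec_ofK ?PBWwords_uniq // mem_PBWwords Hv Dv Sl eqxx.
Qed.

End Degree.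
End Words.

Lemma sum_enum_val (k : nmodType) (T : finType) (F : T -> k) :
  \sum_x F x = \sum_(i < #|T|) F (enum_val i).
Proof. by rewrite (reindex _ (onW_bij _ (@enum_val_bij T))). Qed.

(** * T^i / J_i identified with the span of the normal words *)

Section Quotient.
Variables (k : fieldType) (n i : nat).
Hypothesis k0 : [pchar k] =i pred0.
Local Notation G := (PBWmx k n i).

Definition at2 (A B : gen n) (x : word n 2) : k := ((x ord0 == A) && (x ord_max == B))%:R.

Lemma sum_at2 (F : {set 'I_n} -> {set 'I_n} -> k) (A B : gen n) :
  \sum_x at2 A B x * F (val (x ord0)) (val (x ord_max)) = F (val A) (val B).
Proof.
pose x : word n 2 := [ffun t : 'I_2 => if t == ord0 then A else B].
have x0 : x ord0 = A by rewrite ffunE.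
have x1 : x ord_max = B by rewrite ffunE.
rewrite (bigD1 x) //= /at2 x0 x1 !eqxx mul1r big1 ?addr0 // => y yx.
case: eqP => [y0|_]; last by rewrite mul0r.
case: eqP => [y1|_]; last by rewrite mul0r.
case/eqP: yx; apply/ffunP => t; have [->|t0] := eqVneq t ord0; first by rewrite x0.
have -> : t = ord_max by apply: val_inj; case: t t0 => [[|[|]]].
by rewrite x1.
Qed.

Lemma Jmx_mul (c : 'I_#|{: Jidx n i}|) m (M : 'M[k]_(_, m)) q :
  (Jmx k n i *m M) c q = let: (p, w, u) := enum_val c in
    if (p.+1 < i)%N then \sum_x I2perp k n u (enum_rank x) * M (enum_rank (splice w p x)) q else 0.
Proof.
rewrite mxE; case E : (enum_val c) => [[p w] u].
case: ifP => ltp; last by rewrite big1 // => v _; rewrite mxE E ltp mul0r.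
transitivity (\sum_v \sum_x I2perp k n u (enum_rank x) * (enum_val v == splice w p x)%:R * M v q).
  by apply: eq_bigr => v _; rewrite mxE E ltp mulr_suml.
rewrite exchange_big /=; apply: eq_bigr => x _.
rewrite (bigD1 (enum_rank (splice w p x))) //= enum_rankK eqxx mulr1 big1 ?addr0 // => v vx.
by rewrite -(inj_eq enum_rank_inj) enum_valK (negbTE vx) mulr0 mul0r.
Qed.

(** Such a [phi] is a combination of the rows of [I2mx], and [I2perp] is orthogonal to these rows by
    construction. *)
Lemma pair_rels_perp (phi : {set 'I_n} -> {set 'I_n} -> k) q : pair_rels phi ->
  \sum_x I2perp k n q (enum_rank x) * phi (val (x ord0)) (val (x ord_max)) = 0.
Proof.
move=> /(pair_rels_span k0)[c cE].
transitivity (\sum_r c r * (I2perp k n *m (I2mx k n)^T) q (enum_rank r)).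
  under eq_bigr => x _ do rewrite cE mulr_sumr.
  rewrite exchange_big; apply: eq_bigr => r _ /=; rewrite mxE mulr_sumr.
  rewrite sum_enum_val.
  by apply: eq_bigr => x _; rewrite !mxE enum_rankK relcoefE enum_valK; ring.
by rewrite big1 // => r _; rewrite mulmx_ker mxE mulr0.
Qed.

Lemma ev_word_rels N m (F : PBWword m -> k) : word_rels N (fun l => ev l F).
Proof.
have -> : (fun l => ev l F) = fun l => ev [seq (id a.1, id a.2) | a <- l] F.
  apply: functional_extensionality => l; congr ev.
  by rewrite -[LHS]map_id; apply: eq_map => -[].
exact: (ev_rels _ (in2W (@inj_id nat))).
Qed.

(** A row of [Jmx] puts an element of I_2^perp between two fixed words. With these words fixed, a
    coefficient of the normal form is a function of the middle pair that satisfies [pair_rels], so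
    it is killed. *)
Lemma Jmx_PBWmx : Jmx k n i *m G = 0.
Proof.
apply/matrixP => c q; rewrite Jmx_mul mxE; case: (enum_val c) => [[p w] u].
case: ifP => // ltp; set F := delta k (tnth (in_tuple (PBWwords n i)) q).
pose L1 := map (@edge_pair n) (take p (word_sets w)); pose L2 := map (@edge_pair n) (drop p.+2 (word_sets w)).
have [Rs Rd Rt] := @ev_word_rels n n F.
pose phi (P Q : {set 'I_n}) := ev (L1 ++ [:: edge_pair P, edge_pair Q & L2]) F.
transitivity (\sum_x I2perp k n u (enum_rank x) * phi (val (x ord0)) (val (x ord_max))).
  apply: eq_bigr => x _; congr (_ * _).
  by rewrite mxE enum_rankK /word_edges word_sets_splice // map_cat.
apply: pair_rels_perp.
have edsC (a b : 'I_n) : a != b -> edge_pair [set a; b] = (val a, val b) \/ edge_pair [set a; b] = (val b, val a).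
  move=> ab; case: (ltngtP a b) => [h|h|/val_inj h].
  - by left; apply: edge_pair_val.
  - by right; rewrite setUC edge_pair_val.
  by rewrite h eqxx in ab.
have phiE (a b c' d : 'I_n) : a != b -> c' != d -> phi [set a; b] [set c'; d] =
    ev (L1 ++ [:: (val a, val b), (val c', val d) & L2]) F.
  move=> ab cd; rewrite /phi.
  have S1 l1 l2 (x y : nat) : ev (l1 ++ (x, y) :: l2) F = ev (l1 ++ (y, x) :: l2) F.
    exact: Rs.
  have S2 l1 l2 e (x y : nat) : ev (l1 ++ [:: e, (x, y) & l2]) F = ev (l1 ++ [:: e, (y, x) & l2]) F.
    by rewrite -!(cat_rcons e) S1.
  transitivity (ev (L1 ++ [:: (val a, val b), edge_pair [set c'; d] & L2]) F).
    case: (edsC a b ab) => -> //; exact: S1.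
  case: (edsC c' d cd) => -> //; exact: S2.
split=> [a b c' d U|a b d U].
  have [ab cd] : a != b /\ c' != d.
    by move: U; rewrite /= !inE !negb_or !andbT => /and3P[/and3P[]].
  rewrite !phiE //; have := Rd L1 L2 a b c' d; apply; last by rewrite /= !ltn_ord.
  by rewrite -(map_inj_uniq val_inj) in U.
move: (U); rewrite /= !inE !negb_or !andbT => /andP[/andP[ab ad] bd].
rewrite !phiE //; have := Rt L1 L2 a b d; apply; last by rewrite /= !ltn_ord.
by rewrite -(map_inj_uniq val_inj) in U.
Qed.

Section Perp.
Variable psi : 'cV[k]_#|word n i|.
Hypothesis Jpsi : Jmx k n i *m psi = 0.

(** The form [psi] extended by 0 to all lists of sets, so that lists can be cut and glued without
    proofs about lengths or cardinalities. *)
Definition word_fun (L : seq {set 'I_n}) : k :=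
  if [pick w : word n i | word_sets w == L] is Some w then psi (enum_rank w) 0 else 0.

Lemma word_funE w : word_fun (word_sets w) = psi (enum_rank w) 0.
Proof.
rewrite /word_fun; case: pickP => [w' /eqP /word_sets_inj -> //|/(_ w)].
by rewrite eqxx.
Qed.

(** The hypothesis says that [v] lies in I_2^perp; put between [L1] and [L2] it belongs to J_i,
    which [psi] kills. *)
Lemma word_fun_perp L1 L2 (v : word n 2 -> k) :
  (forall r, \sum_x v x * rel_set k r (val (x ord0)) (val (x ord_max)) = 0) ->
  \sum_x v x * word_fun (L1 ++ [:: val (x ord0), val (x ord_max) & L2]) = 0.
Proof.
move=> vr.
have [x0 _|no] := pickP (fun _ : word n 2 => true); last first.
  by rewrite big1 // => x _; have := no x.
pose card2 := fun P : {set 'I_n} => #|P| == 2%N.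
have [/and3P[/eqP SL A1 A2]|bad] := boolP [&& (size L1 + size L2).+2 == i, all card2 L1 & all card2 L2];
  last first.
  rewrite big1 // => x _; rewrite /word_fun; case: pickP => [w /eqP E|_]; last by rewrite mulr0.
  case/negP: bad; have := word_sets_card w; rewrite E all_cat /= => /and4P[-> _ _ ->].
  by rewrite -(size_word_sets w) E size_cat /= !addnS eqxx.
have ltp1 : ((size L1).+1 < i)%N by lia.
pose p := Ordinal (ltnW ltp1).
(* The letters of [x0] only fill the gap so that a word [w] exists; [splice] overwrites them. *)
have [||w wE] := @word_sets_ex n i (L1 ++ [:: val (x0 ord0), val (x0 ord_max) & L2]).
- by rewrite size_cat /= !addnS.
- by rewrite all_cat /=; apply/and4P; split=> //; [exact: (valP (x0 _))..].
have E (x : word n 2) : L1 ++ [:: val (x ord0), val (x ord_max) & L2] = word_sets (splice w p x).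
  rewrite word_sets_splice // wE /= take_size_cat //; congr (_ ++ [:: _, _ & _]).
  by rewrite drop_cat ltnNge ltnW // -addn2 addKn /= drop0.
pose phi : 'cV[k]_#|word n 2| := \col_x psi (enum_rank (splice w p (enum_val x))) 0.
have perp0 : I2perp k n *m phi = 0.
  apply/colP => q; have := congr1 (fun M : 'cV[k]_ _ => M (enum_rank (p, w, q)) 0) Jpsi.
  rewrite /= Jmx_mul enum_rankK ltp1 [X in _ = X]mxE => J0; rewrite [LHS]mxE [RHS]mxE -[RHS]J0.
  rewrite [RHS]sum_enum_val.
  by apply: eq_bigr => x _; rewrite [phi _ _]mxE enum_valK.
pose vr' : 'rV[k]_#|word n 2| := \row_x v (enum_val x).
have : (vr' <= I2perp k n)%MS.
  apply/sub_kermxP; apply/rowP => r; rewrite !mxE -[RHS](vr (enum_val r)).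
  rewrite [RHS]sum_enum_val.
  by apply: eq_bigr => x _; rewrite !mxE relcoefE.
case/submxP => D DE.
have : vr' *m phi = 0 by rewrite DE -mulmxA perp0 mulmx0.
move/(congr1 (fun M : 'M[k]_1 => M 0 0)); rewrite [LHS]mxE [RHS]mxE => sum0.
rewrite -[RHS]sum0 [LHS]sum_enum_val.
by apply: eq_bigr => x _; rewrite E word_funE ![in RHS]mxE.
Qed.

Lemma word_fun_rels : word_rels n (fun l => word_fun (map (@edge_set n) l)).
Proof.
have gen_of (a b : nat) : valid n (a, b) -> exists A : gen n, val A = edge_set n (a, b).
  by move=> V; exists (exist _ (edge_set n (a, b)) (edge_set_gen V)).
split=> [l1 l2 a b|l1 l2 a b c d U A|l1 l2 a b c U A].
- rewrite !map_cat /=; congr (word_fun (_ ++ _ :: _)).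
  by apply/setP => x; rewrite !inE orbC.
- move: (U) (A); rewrite /= !inE !negb_or !andbT.
  move=> /and3P[/and3P[ab ac ad] /andP[bc bd] cd] /and4P[lta ltb ltc ltd].
  have [P EP] : exists P : gen n, val P = edge_set n (a, b) by apply: gen_of; rewrite /valid /= lta ltb.
  have [Q EQ] : exists P : gen n, val P = edge_set n (c, d) by apply: gen_of; rewrite /valid /= ltc ltd.
  pose f (S T : {set 'I_n}) := word_fun (map (@edge_set n) l1 ++ [:: S, T & map (@edge_set n) l2]).
  rewrite !map_cat /= -EP -EQ -/(f (val P) (val Q)) -/(f (val Q) (val P)).
  apply/eqP; rewrite -subr_eq0 -!(sum_at2 f) -sumrB; apply/eqP.
  under eq_bigr => z _ do rewrite -mulrBl.
  apply: word_fun_perp => r; under eq_bigr => z _ do rewrite mulrBl.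
  rewrite sumrB !sum_at2 EP EQ -[a]/(val (Ordinal lta)) -[b]/(val (Ordinal ltb)).
  rewrite -[c]/(val (Ordinal ltc)) -[d]/(val (Ordinal ltd)) !edge_set_val.
  by rewrite (pr_disjoint (rel_set_rels k r)) ?subrr // -(map_inj_uniq val_inj).
- move: (U) (A); rewrite /= !inE !negb_or !andbT.
  move=> /andP[/andP[ab ac] bc] /and3P[lta ltb ltc].
  have [P EP] : exists P : gen n, val P = edge_set n (a, b) by apply: gen_of; rewrite /valid /= lta ltb.
  have [Q EQ] : exists P : gen n, val P = edge_set n (a, c) by apply: gen_of; rewrite /valid /= lta ltc.
  have [R ER] : exists P : gen n, val P = edge_set n (b, c) by apply: gen_of; rewrite /valid /= ltb ltc.
  pose f (S T : {set 'I_n}) := word_fun (map (@edge_set n) l1 ++ [:: S, T & map (@edge_set n) l2]).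
  rewrite !map_cat /= -EP -EQ -ER -!/(f _ _).
  apply/eqP; rewrite -subr_eq0 -!(sum_at2 f) -!big_split -sumrB /=; apply/eqP.
  under eq_bigr => z _ do rewrite -!mulrDl -mulrBl.
  apply: word_fun_perp => r; under eq_bigr => z _ do rewrite mulrBl !mulrDl.
  rewrite sumrB !big_split /= !sum_at2 EP EQ ER -[a]/(val (Ordinal lta)) -[b]/(val (Ordinal ltb)).
  rewrite -[c]/(val (Ordinal ltc)) !edge_set_val.
  by rewrite (pr_triangle (rel_set_rels k r)) ?subrr // -(map_inj_uniq val_inj).
Qed.

(** A form killed by J_i respects the relations, so [rels_ev] factors it through the normal
    words. *)
Lemma perp_PBWmx : psi = G *m \col_p word_fun (map (@edge_set n) (flat (tnth (in_tuple (PBWwords n i)) p))).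
Proof.
apply/colP => u; rewrite mxE -[in LHS](enum_valK u) -word_funE -edge_set_word_edges.
have := rels_ev [::] word_fun_rels (word_edges_valid (enum_val u)); rewrite /= => ->.
rewrite (@ev_expand k n i) ?word_edges_valid ?size_word_edges //; apply: eq_bigr => p _; by rewrite !mxE.
Qed.

End Perp.

(** Double annihilator: each column of the cokernel matrix of J_i is killed by J_i, so it factors
    through [G] and is killed by [v]; this is membership of [v] in J_i. *)
Lemma ker_PBWmx m (v : 'M[k]_(m, _)) : v *m G = 0 -> (v <= Jsq k n i)%MS.
Proof.
move=> vG; rewrite submxE; apply/eqP/row_matrixP => a; apply/rowP => b; rewrite row0 [RHS]mxE.
have perpb : Jmx k n i *m col b (cokermx (Jsq k n i)) = 0.
  rewrite colE mulmxA; have : (Jmx k n i <= Jsq k n i)%MS by rewrite genmxE.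
  by rewrite submxE => /eqP ->; rewrite mul0mx.
have := congr1 (fun M => (v *m M) a 0) (perp_PBWmx perpb).
rewrite /= mulmxA vG mul0mx colE mulmxA -colE.
have -> (M : 'M[k]_(m, _)) : (col b M) a 0 = M a b by rewrite mxE.
by move=> vC; rewrite [LHS]mxE vC mxE.
Qed.

Lemma Jsq_PBWmx : Jsq k n i *m G = 0.
Proof.
apply/eqP; rewrite -sub_kermx genmxE; apply/sub_kermxP; exact: Jmx_PBWmx.
Qed.

Lemma row_full_PBWmx : row_full G.
Proof.
apply/row_fullP.
have H p : exists w : word n i, word_edges w = flat (tnth (in_tuple (PBWwords n i)) p).
  set t := tnth _ p; have : t \in PBWwords n i by apply: mem_tnth.
  rewrite mem_PBWwords => /andP[Ht /eqP Dt].
  have [||w wE] := @word_sets_ex n i (map (@edge_set n) (flat t)).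
  - by rewrite size_map size_flat.
  - by rewrite all_map; apply: sub_all (flat_valid Ht) => e; apply: edge_set_gen.
  exists w; rewrite /word_edges wE -map_comp -[RHS]map_id; apply/eq_in_map => e Ee /=.
  have [e12 e2n] : (e.1 < e.2)%N /\ (e.2 < n)%N.
    move: Ht Ee {Dt wE}; move: t; elim: (n) => [|m IH] //= [x u] /andP[Hx Hu].
    rewrite mem_cat => /orP[/mapP[y yx ->]|/(IH _ Hu)[]] /=; last by lia.
    by split=> //; apply: (allP Hx).
  case: e e12 e2n {Ee} => a b /= ab bn; have an := ltn_trans ab bn.
  by rewrite -[a]/(val (Ordinal an)) -[b]/(val (Ordinal bn)) edge_set_val edge_pair_val.
have [f fE] := fin_all_exists H.
exists (\matrix_(p, u) (u == enum_rank (f p))%:R); apply/matrixP => p q.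
rewrite [LHS]mxE (bigD1 (enum_rank (f p))) //= mxE eqxx mul1r big1 ?addr0 => [|u uf]; last first.
  by rewrite mxE (negbTE uf) mul0r.
rewrite mxE enum_rankK fE ev_flat ?delta_tnth ?PBWwords_uniq ?mxE //.
by have := mem_tnth p (in_tuple (PBWwords n i)); rewrite mem_PBWwords => /andP[].
Qed.

(** The form [P], which renames the vertices and then takes a coefficient of the normal form,
    respects the relations, so normal forms may be taken before renaming. *)
Lemma Tmx_PBWmx s : Tmx k i s *m G =
  G *m \matrix_(p, q) PBWact (perm_nat s) (delta k (tnth (in_tuple (PBWwords n i)) q)) (tnth (in_tuple (PBWwords n i)) p).
Proof.
apply/matrixP => u q; rewrite [LHS]mxE [RHS]mxE (bigD1 (enum_rank (word_act s (enum_val u)))) //=.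
rewrite [Tmx _ _ _ _ _]mxE enum_rankK eqxx mul1r big1 ?addr0 => [|v vu]; last first.
  by rewrite [Tmx _ _ _ _ _]mxE -(inj_eq enum_rank_inj) enum_valK eq_sym (negbTE vu) mul0r.
rewrite [G _ _]mxE enum_rankK; set F := delta k (tnth _ q); set w := enum_val u.
pose P l := ev [seq (perm_nat s a.1, perm_nat s a.2) | a <- l] F.
have HP : word_rels n P by apply: ev_rels; apply: perm_nat_inj.
transitivity (P (word_edges w)).
  apply: ev_edge_set => //; first exact: word_edges_valid.
    rewrite all_map; apply: sub_all (word_edges_valid w) => -[a b] /and3P[/= lta ltb ab].
    by rewrite /valid /= !perm_nat_lt //=; apply: contra ab => /eqP /perm_nat_inj ->.
  rewrite edge_set_word_edges /word_edges /word_sets -!map_comp; apply: eq_map => t /=; rewrite ffunE /=.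
  have [a [b [ab ->]]] := gen_sorted (w t); rewrite edge_pair_val //= !perm_nat_val edge_set_val.
  by rewrite imsetU1 imset_set1.
have := rels_ev [::] HP (word_edges_valid w); rewrite /= => ->.
rewrite (@ev_expand k n i) ?word_edges_valid ?size_word_edges //; apply: eq_bigr => p _.
by rewrite [G _ _]mxE [X in _ = _ * X]mxE.
Qed.

End Quotient.

(** * Equal characters give isomorphic representations *)

Section CharacterIso.
Variables (k : fieldType) (gT : finGroupType).
Hypothesis k0 : [pchar k] =i pred0.

Definition is_rep d (rho : gT -> 'M[k]_d) : Prop :=
  rho 1%g = 1%:M /\ forall x y, rho (x * y)%g = rho x *m rho y.

Lemma mxtrace_idempotent d (F : 'M[k]_d) : F *m F = F -> \tr F = (\rank F)%:R.
Proof.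
move=> FF; rewrite -{1}(mulmx_base F) mxtrace_mulC.
suff -> : row_base F *m col_base F = 1%:M by rewrite mxtrace1.
have [C' C'C] := row_fullP (col_base_full F); have [R' RR'] := row_freeP (row_base_free F).
have aux r (C : 'M[k]_(d, r)) (R : 'M[k]_(r, d)) C1 R1 : C1 *m C = 1%:M -> R *m R1 = 1%:M ->
    (C *m R) *m (C *m R) = C *m R -> R *m C = 1%:M.
  move=> CC RR /(congr1 (fun M => C1 *m M *m R1)).
  by rewrite !mulmxA CC !mul1mx -!mulmxA RR !mulmx1.
by apply: aux C'C RR' _; rewrite mulmx_base.
Qed.

Lemma tr_lin_mx m p (f : {linear 'M[k]_(m, p) -> 'M[k]_(m, p)}) :
  \tr (lin_mx f) = \sum_i \sum_j f (delta_mx i j) i j.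
Proof.
rewrite pair_bigA /= /mxtrace (reindex _ (curry_mxvec_bij m p)) /=.
apply: eq_bigr => -[i j] _ /=; rewrite mxE /= vec_mx_delta mxvecE.
by [].
Qed.

Lemma sum_mulmx_delta m p (A : 'M[k]_m) (B : 'M[k]_p) :
  \sum_i \sum_j (A *m delta_mx i j *m B) i j = \tr A * \tr B.
Proof.
rewrite mulr_suml; apply: eq_bigr => i _; rewrite mulr_sumr; apply: eq_bigr => j _.
rewrite mxE (bigD1 j) //= big1 ?addr0 => [|l lj]; last first.
  rewrite mxE big1 ?mul0r // => l' _; rewrite mxE (negbTE lj) andbF mulr0 //.
rewrite mxE (bigD1 i) //= big1 ?addr0 => [|l li]; last by rewrite mxE (negbTE li) mulr0.
by rewrite mxE !eqxx mulr1.
Qed.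

Lemma natG_neq0 : (#|gT|%:R : k) != 0.
Proof. by have := natk_neq0 k0 #|gT|.-1; rewrite prednK // -cardsT cardG_gt0. Qed.

(* An intertwiner M of non-maximal rank is enlarged: the projections P and Q onto its kernel and
   cokernel have equal characters, so averaging some P E_ij Q gives a nonzero intertwiner, which
   is added to M. *)
Lemma char_iso d1 d2 (r1 : gT -> 'M[k]_d1) (r2 : gT -> 'M[k]_d2) :
  is_rep r1 -> is_rep r2 -> (forall x, \tr (r1 x) = \tr (r2 x)) ->
  exists B : 'M_(d1, d2), [/\ d1 = d2, row_free B & forall x, r1 x *m B = B *m r2 x].
Proof.
move=> [r11 r1M] [r21 r2M] r12.
have dd : d1 = d2.
  have := r12 1%g; rewrite r11 r21 !mxtrace1 => /eqP.
  rewrite -subr_eq0; case: (leqP d1 d2) => h.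
    rewrite -oppr_eq0 opprB -natrB // => E; apply/eqP; rewrite eqn_leq h /= -subn_eq0.
    by move: E; rewrite ((pcharf0P k).1 k0).
  rewrite -natrB 1?ltnW // ((pcharf0P k).1 k0) subn_eq0 leqNgt h //.
have K1 x : r1 x *m r1 x^-1%g = 1%:M by rewrite -r1M mulgV.
have K2 x : r2 x *m r2 x^-1%g = 1%:M by rewrite -r2M mulgV.
pose hom (M : 'M[k]_(d1, d2)) := forall x, r1 x *m M = M *m r2 x.
have avg_hom (M : 'M[k]_(d1, d2)) : hom (\sum_x r1 x^-1%g *m M *m r2 x).
  move=> y; rewrite mulmx_sumr mulmx_suml (reindex_inj (mulIg y)) /=.
  apply: eq_bigr => x _; by rewrite invMg r1M r2M !mulmxA K1 mul1mx.
have step (M : 'M[k]_(d1, d2)) : hom M -> (\rank M < d1)%N ->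
    exists2 M', hom M' & (\rank M < \rank M')%N.
  (* Averaging the pseudo-inverse makes it an intertwiner and keeps [M *m N *m M = M], so [P] and
     [Q] below are equivariant idempotents. *)
  move=> homM rM; pose N : 'M[k]_(d2, d1) :=
    #|gT|%:R^-1 *: \sum_x r2 x^-1%g *m pinvmx M *m r1 x.
  have homN y : r2 y *m N = N *m r1 y.
    rewrite -scalemxAr -scalemxAl mulmx_sumr mulmx_suml; congr (_ *: _).
    rewrite (reindex_inj (mulIg y)) /=; apply: eq_bigr => x _.
    by rewrite invMg r1M r2M !mulmxA K2 mul1mx.
  have MNM : M *m N *m M = M.
    rewrite -scalemxAr -scalemxAl mulmx_sumr mulmx_suml.
    rewrite (eq_bigr (fun=> M)) => [|x _]; last first.
      transitivity (r1 x^-1%g *m (M *m pinvmx M *m M) *m r2 x).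
        by rewrite !mulmxA -homM -[LHS]mulmxA (homM x) !mulmxA.
      by rewrite mulmxKpV // -mulmxA -homM mulmxA -r1M mulVg r11 mul1mx.
    by rewrite sumr_const -scaler_nat scalerA mulVf ?scale1r // natG_neq0.
  pose P := 1%:M - M *m N; pose Q := 1%:M - N *m M.
  have MQ : M *m Q = 0 by rewrite mulmxBr mulmx1 mulmxA MNM subrr.
  have PM : P *m M = 0 by rewrite mulmxBl mul1mx MNM subrr.
  have PP : P *m P = P by rewrite {2}/P mulmxBr mulmx1 mulmxA PM mul0mx subr0.
  have QQ : Q *m Q = Q by rewrite {1}/Q mulmxBl mul1mx -mulmxA MQ mulmx0 subr0.
  have Pr x : r1 x *m P = P *m r1 x.
    by rewrite mulmxBr mulmxBl mul1mx mulmx1 mulmxA homM -!mulmxA homN.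
  have Qr x : r2 x *m Q = Q *m r2 x.
    by rewrite mulmxBr mulmxBl mul1mx mulmx1 mulmxA homN -!mulmxA homM.
  have P0 : P != 0.
    apply: contraTneq rM => /eqP; rewrite subr_eq0 => /eqP MN1; rewrite -leqNgt.
    by rewrite -[X in (X <= _)%N](mxrank1 k d1) MN1 mxrankM_maxl.
  have trPQ x : \tr (Q *m r2 x) = \tr (P *m r1 x).
    rewrite /P /Q !mulmxBl !mul1mx !linearB /= r12; congr (_ - _).
    by rewrite -mulmxA -homM mxtrace_mulC -mulmxA [RHS]mxtrace_mulC.
  pose avg (A : 'M[k]_(d1, d2)) := \sum_x r1 x^-1%g *m A *m r2 x.
  have [/'exists_existsP[i [j nz]]|z] := boolP [exists i, exists j, P *m avg (delta_mx i j) *m Q != 0].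
    pose Z := P *m avg (delta_mx i j) *m Q.
    exists (M + Z) => [x|].
      rewrite mulmxDr mulmxDl homM; congr (_ + _).
      by rewrite /Z !mulmxA Pr -!mulmxA (mulmxA (r1 x)) avg_hom -Qr !mulmxA.
    have ZM : (M <= (M + Z)%R)%MS.
      apply/submxP; exists (M *m N); rewrite mulmxDr MNM /Z !mulmxA.
      have -> : M *m N *m P = 0 by rewrite mulmxBr mulmx1 mulmxA MNM subrr.
      by rewrite !mul0mx addr0.
    have ZZ : (Z <= (M + Z)%R)%MS.
      by apply/submxP; exists P; rewrite mulmxDr PM add0r /Z !mulmxA PP.
    have cap0 : (M :&: Z = 0)%MS.
      apply/eqP; rewrite -submx0; apply/rV_subP => v; rewrite sub_capmx => /andP[].
      move=> /submxP[a ->] /submxP[b E]; rewrite E; have : a *m M *m Q = 0 by rewrite -mulmxA MQ mulmx0.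
      by rewrite E /Z -!mulmxA QQ => ->; rewrite sub0mx.
    have := mxrank_disjoint_sum cap0; have : (M + Z <= (M + Z)%R)%MS by rewrite addsmx_sub ZM ZZ.
    move=> /mxrankS le rE; apply: leq_trans le; rewrite rE -[X in (X < _)%N]addn0 ltn_add2l.
    by rewrite lt0n mxrank_eq0.
  exfalso; have z' i j : P *m avg (delta_mx i j) *m Q = 0.
    by apply/eqP; move: z; rewrite negb_exists => /forallP/(_ i); rewrite negb_exists => /forallP/(_ j); rewrite negbK.
  (* If every averaged unit matrix vanishes between [P] and [Q], the sum of its (i, j) entries over
     all i, j says that the character of [P] has norm 0. *)
  have tr0 : \sum_x \tr (P *m r1 x^-1%g) * \tr (P *m r1 x) = 0.
    under eq_bigr => x _ do rewrite -(trPQ x) -sum_mulmx_delta.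
    rewrite exchange_big big1 // => i _; rewrite exchange_big big1 // => j _ /=.
    transitivity ((P *m avg (delta_mx i j) *m Q) i j); last by rewrite z' mxE.
    rewrite /avg mulmx_sumr mulmx_suml summxE; apply: eq_bigr => x _.
    by rewrite -Qr !mulmxA.
  (* [F] projects the matrices onto the equivariant A with P A = A = A P. Its trace is the norm just
     shown to be 0, so its rank is 0; but it fixes [P], which is not 0. *)
  pose F := #|gT|%:R^-1 *: \sum_x lin_mx (mulmxr (P *m r1 x) \o mulmx (P *m r1 x^-1%g)).
  pose f (A : 'M[k]_d1) := #|gT|%:R^-1 *: \sum_x (P *m r1 x^-1%g) *m A *m (P *m r1 x).
  have FE A : mxvec A *m F = mxvec (f A).
    rewrite -scalemxAr mulmx_sumr /f [RHS]linearZ [in RHS]linear_sum /=; congr (_ *: _).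
    by apply: eq_bigr => x _; rewrite mul_vec_lin /=.
  have fixf A : (forall x, r1 x *m A = A *m r1 x) -> P *m A = A -> A *m P = A -> f A = A.
    move=> homA PA AP; rewrite /f (eq_bigr (fun=> A)) => [|x _].
      by rewrite sumr_const -scaler_nat scalerA mulVf ?scale1r // natG_neq0.
    by rewrite -(mulmxA P) homA (mulmxA P) PA -Pr mulmxA -(mulmxA A) -r1M mulVg r11 mulmx1 AP.
  have FF : F *m F = F.
    apply/row_matrixP => a; rewrite row_mul -[row a F]vec_mxK FE; congr mxvec.
    rewrite rowE -[delta_mx 0 a]vec_mxK FE mxvecK; set A := vec_mx _.
    apply: fixf => [y||].
    - rewrite /f -scalemxAr -scalemxAl mulmx_sumr mulmx_suml; congr (_ *: _).
      rewrite (reindex_inj (mulIg y)) /=; apply: eq_bigr => x _.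
      by rewrite invMg !r1M !mulmxA Pr -(mulmxA P (r1 y)) K1 mulmx1.
    - rewrite /f -scalemxAr mulmx_sumr; congr (_ *: _); apply: eq_bigr => x _.
      by rewrite !mulmxA PP.
    rewrite /f -scalemxAl mulmx_suml; congr (_ *: _); apply: eq_bigr => x _.
    by rewrite -!mulmxA Pr !(mulmxA P) PP.
  have trF : \tr F = 0.
    rewrite linearZ linear_sum /= (eq_bigr (fun x => \tr (P *m r1 x^-1%g) * \tr (P *m r1 x))) ?tr0 ?mulr0 //.
    by move=> x _; rewrite tr_lin_mx -sum_mulmx_delta.
  have := mxtrace_idempotent FF; rewrite trF => /esym/eqP.
  rewrite ((pcharf0P k).1 k0) mxrank_eq0 => /eqP F0.
  have := FE P; rewrite F0 mulmx0 fixf // => /esym/(congr1 vec_mx); rewrite mxvecK linear0 => P00.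
  by rewrite P00 eqxx in P0.
have ex r : (r <= d1)%N -> exists2 M, hom M & (r <= \rank M)%N.
  elim: r => [_|r IH ltr]; first by exists 0 => // x; rewrite mulmx0 mul0mx.
  have [M hM] := IH (ltnW ltr); rewrite leq_eqVlt => /orP[/eqP E|]; last by exists M.
  by have [|M' hM' ltM] := step M hM; [rewrite -E|exists M' => //; rewrite E].
have [M hM rM] := ex d1 (leqnn _); exists M; split=> //.
by rewrite /row_free eqn_leq rM rank_leq_row.
Qed.

End CharacterIso.

(** * Permutation modules and fixed points *)

Section PermutationModules.
Variables (k : fieldType) (n : nat).
Hypothesis k0 : [pchar k] =i pred0.

Definition num_fixed (X : finType) (to : {action 'S_n &-> X}) (s : 'S_n) : nat :=
  #|[set x | to x s == x]|.

Lemma tr_permrep (X : finType) (to : {action 'S_n &-> X}) s :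
  \tr (permrep to s : 'M[k]_#|X|) = (num_fixed to s)%:R.
Proof.
rewrite /num_fixed -sum1dep_card natr_sum big_mkcond sum_enum_val.
by apply: eq_bigr => x _; rewrite mxE; case: ifP.
Qed.

Lemma permrep_rep (X : finType) (to : {action 'S_n &-> X}) : is_rep (@permrep k n X to).
Proof.
split=> [|s t]; apply/matrixP => x y; rewrite !mxE ?act1 ?(inj_eq enum_val_inj) //.
rewrite (bigD1 (enum_rank (to (enum_val x) s))) //= !mxE enum_rankK eqxx mul1r actM big1 ?addr0 //.
move=> z zx; rewrite mxE -(inj_eq enum_rank_inj) enum_valK eq_sym (negbTE zx) mul0r //.
Qed.

Lemma perm_moduleP d (rho : 'S_n -> 'M[k]_d) (X : finType) (to : {action 'S_n &-> X}) :
  is_rep rho -> (forall s, \tr (rho s) = (num_fixed to s)%:R) -> perm_module rho.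
Proof.
move=> rhoR OStrace; have [|B [dX rfB rhoB]] := char_iso k0 rhoR (permrep_rep to).
  by move=> s; rewrite OStrace tr_permrep.
by exists X, to, B.
Qed.

Lemma mxtrace_sim d e (A : 'M[k]_d) (A' : 'M[k]_e) (B : 'M[k]_(d, e)) :
  row_free B -> row_full B -> A *m B = B *m A' -> \tr A = \tr A'.
Proof.
move=> /row_freeP[C BC] /row_fullP[C' C'B] AB.
have CC : C = C' by rewrite -[C]mul1mx -C'B -mulmxA BC mulmx1.
by rewrite -[A]mulmx1 -BC mulmxA AB -mulmxA mxtrace_mulC -mulmxA CC C'B mulmx1.
Qed.

Lemma tr_perm_module d (rho : 'S_n -> 'M[k]_d) : perm_module rho ->
  exists (X : finType) (to : {action 'S_n &-> X}), forall s, \tr (rho s) = (num_fixed to s)%:R.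
Proof.
move=> [X [to [B [dX rfB rhoB]]]]; exists X, to => s; rewrite -tr_permrep.
apply: mxtrace_sim (rfB) _ (rhoB s).
by move: (rfB); rewrite /row_full /row_free => /eqP ->; apply/eqP.
Qed.

Lemma tr_dsum d c (rho : 'S_n -> 'M[k]_d) s : \tr (dsum c rho s) = c%:R * \tr (rho s).
Proof. by rewrite /dsum mxtrace_mxdiag sumr_const card_ord mulr_natl. Qed.

End PermutationModules.

(** * The representation on the dual algebra in PBW coordinates *)

Lemma word_act1 n i (w : word n i) : word_act 1%g w = w.
Proof.
apply/ffunP => a; rewrite ffunE; apply: val_inj => /=.
by rewrite (eq_imset _ (perm1 (T := _))) imset_id.
Qed.

Lemma word_actM n i (w : word n i) (s t : 'S_n) :
  word_act (s * t)%g w = word_act t (word_act s w).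
Proof.
apply/ffunP => a; rewrite !ffunE; apply: val_inj => /=.
by rewrite -imset_comp; apply: eq_imset => b /=; rewrite permM.
Qed.

Section OSdualTrace.
Variables (k : fieldType) (n i : nat).
Hypothesis k0 : [pchar k] =i pred0.
Local Notation J := (Jsq k n i).
Local Notation G := (PBWmx k n i).

Definition PBWact_mx (s : 'S_n) : 'M[k]_(size (PBWwords n i)) :=
  \matrix_(p, q) PBWact (perm_nat s) (delta k (tnth (in_tuple (PBWwords n i)) q)) (tnth (in_tuple (PBWwords n i)) p).

Definition OSdual_basis : 'M[k]_(\rank (cokermx J), size (PBWwords n i)) := val_factmod 1%:M *m G.

Lemma val_factmod_PBWmx m (W : 'M[k]_(m, _)) : val_factmod (in_factmod J W) *m G = W *m G.
Proof.
rewrite -[in RHS](add_sub_fact_mod J W) mulmxDl.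
have /submxP[D ->] := val_submodP (in_submod J W).
by rewrite -mulmxA (Jsq_PBWmx _ _ k0) mulmx0 add0r.
Qed.

Lemma OSdual_basisE m (W : 'M[k]_(m, _)) : W *m OSdual_basis = val_factmod W *m G.
Proof. by rewrite mulmxA -val_factmodE. Qed.

Lemma OSdual_mxE s : OSdual_mx n i s *m OSdual_basis = OSdual_basis *m PBWact_mx s.
Proof.
rewrite OSdual_basisE /OSdual_mx val_factmod_PBWmx /OSdual_basis; move: (val_factmod _) => V.
by rewrite -!mulmxA Tmx_PBWmx.
Qed.

Lemma OSdual_basis_free : row_free OSdual_basis.
Proof.
apply: inj_row_free => v; rewrite OSdual_basisE => /ker_PBWmx.
by rewrite -in_factmod_eq0 val_factmodK => /eqP.
Qed.

Lemma OSdual_basis_full : row_full OSdual_basis.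
Proof.
have [Z ZG] := row_fullP (row_full_PBWmx k n i); apply/row_fullP; exists (in_factmod J Z).
by rewrite OSdual_basisE val_factmod_PBWmx.
Qed.

Lemma tr_OSdual s : \tr (OSdual_mx n i s) = dual_trace k i s.
Proof.
rewrite (mxtrace_sim OSdual_basis_free OSdual_basis_full (OSdual_mxE s)).
by rewrite /dual_trace big_tnth; apply: eq_bigr => p _; rewrite mxE.
Qed.

Lemma Tmx_rep : is_rep (Tmx k i (n := n)).
Proof.
split=> [|s t]; apply/matrixP => x y.
  by rewrite !mxE word_act1 (inj_eq enum_val_inj).
rewrite !mxE (bigD1 (enum_rank (word_act s (enum_val x)))) //= !mxE enum_rankK eqxx mul1r big1 ?addr0.
  by rewrite word_actM.
by move=> z zx; rewrite mxE -(inj_eq enum_rank_inj) enum_valK eq_sym (negbTE zx) mul0r.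
Qed.

(** Conjugation by [OSdual_basis] turns the action into [PBWact_mx], which is multiplicative because
    the expansion of words into normal words is onto and equivariant. *)
Lemma OSdual_rep : is_rep (OSdual_mx (k := k) n i).
Proof.
have [C BC] := row_freeP OSdual_basis_free; have [Z ZG] := row_fullP (row_full_PBWmx k n i).
have [T1 TM] := Tmx_rep.
have SE s : PBWact_mx s = Z *m (Tmx k i s *m G) by rewrite Tmx_PBWmx mulmxA ZG mul1mx.
have E s : OSdual_mx n i s = OSdual_basis *m PBWact_mx s *m C.
  by rewrite -OSdual_mxE -mulmxA BC mulmx1.
split=> [|s t]; first by rewrite E SE T1 mul1mx ZG mulmx1 BC.
have SM : PBWact_mx (s * t)%g = PBWact_mx s *m PBWact_mx t.
  rewrite [LHS]SE TM -(mulmxA (Tmx k i s)) Tmx_PBWmx (mulmxA (Tmx k i s)) Tmx_PBWmx.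
  by rewrite -(mulmxA G) (mulmxA Z) ZG mul1mx.
by rewrite (E (s * t)%g) SM mulmxA -OSdual_mxE [in RHS](E t) !mulmxA.
Qed.

End OSdualTrace.

(** * Executable traces on the Orlik-Solomon algebra *)

Section Compute.

(* Basis monomials of the Orlik-Solomon model as lists: 0 for no edge, l.+1 for the edge to l. *)
Fixpoint X_codes (i j : nat) (v : seq nat) : seq (bool * seq nat) :=
  if v is x :: w then
    let m := size w in
    if (j == m) || (i == m) then
      let a := if j == m then i else j in
      if x is l.+1 then
        if l == a then [::] else
          let r := X_codes a l w in
          [seq (p.1, a.+1 :: p.2) | p <- r] ++ [seq (~~ p.1, l.+1 :: p.2) | p <- r]
      else [:: (false, a.+1 :: w)]
    else [seq (if x is 0 then p.1 else ~~ p.1, x :: p.2) | p <- X_codes i j w]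
  else [::].

Fixpoint OSact_codes (N : nat) (f : nat -> nat) (v : seq nat) : seq (bool * seq nat) :=
  if v is x :: w then
    if x is l.+1 then
      flatten [seq [seq (p.1 (+) q.1, q.2) | q <- X_codes (f l) (f (size w)) p.2] | p <- OSact_codes N f w]
    else OSact_codes N f w
  else [:: (false, nseq N 0)].

Fixpoint codes (n : nat) : seq (seq nat) :=
  if n is m.+1 then [seq x :: w | x <- iota 0 m.+1, w <- codes m] else [:: [::]].

Definition degc (v : seq nat) := count (fun x => x != 0%N) v.

(** Diagonal contributions are counted by sign ([true] for -1), so the computation stays in the
    natural numbers; the trace is the difference of the two counts. *)
Definition OStrace_count (b : bool) (N j : nat) (f : nat -> nat) : nat :=
  sumn [seq count (fun p => (p.1 == b) && (p.2 == v)) (OSact_codes N f v) | v <- codes N & degc v == j].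

End Compute.

Section ComputeCorrect.
Variable k : fieldType.

Fixpoint code (n : nat) : OSbasis n -> seq nat :=
  if n is m.+1 then fun b => (if b.1 is Some l then (val l).+1 else 0%N) :: code b.2
  else fun _ => [::].

Lemma size_code n (b : OSbasis n) : size (code b) = n.
Proof. by elim: n b => //= n IH b; rewrite IH. Qed.

Lemma code_inj n : injective (@code n).
Proof.
elim: n => [[] []|n IH [o b] [o' b']] //= [E /IH ->].
by case: o o' E => [l|] [l'|] //= [/val_inj ->].
Qed.

Definition eval_codes (L : seq (bool * seq nat)) (v : seq nat) : k :=
  \sum_(p <- L) (-1) ^+ p.1 * (p.2 == v)%:R.

Lemma eval_codes_cat L1 L2 v : eval_codes (L1 ++ L2) v = eval_codes L1 v + eval_codes L2 v.
Proof. exact: big_cat. Qed.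

Lemma eval_codes_cons x L y v :
  eval_codes [seq (p.1, x :: p.2) | p <- L] (y :: v) = (x == y)%:R * eval_codes L v.
Proof.
rewrite /eval_codes big_map mulr_sumr; apply: eq_bigr => p _ /=.
by rewrite eqseq_cons -mulnb natrM; ring.
Qed.

Lemma eval_codes_consN x L y v :
  eval_codes [seq (~~ p.1, x :: p.2) | p <- L] (y :: v) = - ((x == y)%:R * eval_codes L v).
Proof.
rewrite /eval_codes big_map mulr_sumr -sumrN; apply: eq_bigr => p _ /=.
by rewrite eqseq_cons -mulnb natrM signrN; ring.
Qed.

Lemma X_codes_sym i j v : X_codes i j v = X_codes j i v.
Proof.
elim: v i j => [|x w IH] i j //=; rewrite orbC IH.
by case: (eqVneq i (size w)) => [->|]; case: (eqVneq j (size w)) => [->|].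
Qed.

Lemma delta_pair (T U : eqType) (x x' : T) (y y' : U) :
  delta k (x, y) (x', y') = (x' == x)%:R * delta k y y'.
Proof. by rewrite /delta xpair_eqE -mulnb natrM. Qed.

Lemma X_delta n i j (b c : OSbasis n) : i != j -> (i < n)%N -> (j < n)%N ->
  X i j c (delta k b) = eval_codes (X_codes i j (code b)) (code c).
Proof.
elim: n i j b c => [|n IH] i j // [o b] [o' c]; move: i j.
apply: edge_ind => [i j E|i j ij lti ltj|a].
- by rewrite X_symE E X_codes_sym.
- rewrite X_low //; under X_fext => x do rewrite delta_pair.
  rewrite (linZ (X_linear _ _ _)) IH //= size_code.
  have -> : (j == n) || (i == n) = false by lia.
  case: o => [l|]; rewrite ?eval_codes_consN ?eval_codes_cons; case: o' => [l'|] //=; rewrite ?(mulr0, mul0r, oppr0) ?eqSS //.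
    by rewrite (_ : (Some l' == Some l) = (val l == val l')) ?mulN1r // eq_sym.
  by rewrite !mul1r.
rewrite [code _]/= [code _]/= [X_codes _ _ _]/= size_code eqxx /=.
case: o' => [p|]; last first.
  rewrite X_top0; case: o => [l|]; last by rewrite /eval_codes big_seq1 mulr0.
  case: ifP => _; first by rewrite /eval_codes big_nil.
  by rewrite eval_codes_cat eval_codes_cons eval_codes_consN !mul0r oppr0 addr0.
have [->|pa] := eqVneq p a.
  rewrite X_top1 delta_pair; case: o => [l|]; last first.
    rewrite eqxx mul1r /eval_codes big_seq1 /= expr0 mul1r eqseq_cons eqxx /= (inj_eq (@code_inj n)) eq_sym.
    rewrite big1 ?addr0 // => l _; under X_fext => x do rewrite delta_pair.
    by rewrite (linZ (X_linear _ _ _)) mul0r.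
  rewrite mul0r add0r; have [la|la] := eqVneq (val l) a.
    rewrite /eval_codes big_nil big1 // => l' l'a; under X_fext => x do rewrite delta_pair.
    rewrite (linZ (X_linear _ _ _)) (_ : Some l' == Some l = false) ?mul0r //.
    by apply/negbTE; apply: contra l'a => /eqP[->]; rewrite -val_eqE la.
  rewrite eval_codes_cat eval_codes_cons eval_codes_consN eqxx mul1r eqSS (negbTE la) mul0r subr0.
  rewrite (bigD1 l) //= big1 ?addr0 => [|l' /andP[_ l'l]].
    under X_fext => x do rewrite delta_pair.
    by rewrite (linZ (X_linear _ _ _)) eqxx mul1r IH // eq_sym.
  under X_fext => x do rewrite delta_pair.
  by rewrite (linZ (X_linear _ _ _)) (_ : Some l' == Some l = false) ?mul0r //; apply/negbTE.
rewrite X_top2 //; under X_fext => x do rewrite delta_pair.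
rewrite (linZ (X_linear _ _ _)); case: o => [l|]; last first.
  rewrite mul0r oppr0 /eval_codes big_seq1 /= eqseq_cons eqSS.
  by rewrite [val a == val p]eq_sym val_eqE (negbTE pa) mulr0.
have [la|la] := eqVneq (val l) a.
  rewrite /eval_codes big_nil (_ : Some p == Some l = false) ?mul0r ?oppr0 //.
  by apply/negbTE; apply: contra pa => /eqP[->]; rewrite -val_eqE la.
rewrite eval_codes_cat eval_codes_cons eval_codes_consN !eqSS [val a == val p]eq_sym [val p == val a]val_eqE (negbTE pa) mul0r add0r.
have [->|pl] := eqVneq p l; first by rewrite !eqxx !mul1r IH // eq_sym.
rewrite (_ : Some p == Some l = false) ?mul0r; last by apply/negbTE.
by rewrite [val l == val p]eq_sym val_eqE (negbTE pl) mul0r.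
Qed.

Lemma X_codes_code n i j (b : OSbasis n) p : i != j -> (i < n)%N -> (j < n)%N ->
  p \in X_codes i j (code b) -> exists b' : OSbasis n, p.2 = code b'.
Proof.
elim: n i j b p => [|n IH] i j // [o b] p; move: i j.
apply: edge_ind => [i j E|i j ij lti ltj|a].
- by rewrite X_codes_sym.
- rewrite /= size_code; have -> : (j == n) || (i == n) = false by lia.
  by move=> /mapP[q /IH[] // b' Eq ->] /=; exists (o, b'); rewrite Eq.
rewrite /= size_code eqxx /=; case: o => [l|]; last first.
  by rewrite inE => /eqP ->; exists (Some a, b).
have [//|la] := eqVneq (val l) a.
rewrite mem_cat => /orP[]/mapP[q /IH[] // ] => [|b' Eq ->||b' Eq ->]; rewrite 1?eq_sym //.
  by exists (Some a, b'); rewrite /= Eq.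
by exists (Some l, b'); rewrite /= Eq.
Qed.

Lemma code_OSone n : code (OSone n) = nseq n 0%N.
Proof. by elim: n => //= n ->. Qed.

Lemma OSact_codes_code N n (g : nat -> nat) (b : OSbasis n) p :
  {in ltn^~ N &, injective g} -> (forall x, (x < N)%N -> (g x < N)%N) -> (n <= N)%N ->
  p \in OSact_codes N g (code b) -> exists c : OSbasis N, p.2 = code c.
Proof.
move=> g_inj g_lt; elim: n b p => [|n IH] b p ltnN.
  by rewrite inE => /eqP ->; exists (OSone N); rewrite code_OSone.
case: b => -[l|] b /=; last exact: (IH b p (ltnW ltnN)).
move=> /flattenP[_ /mapP[q /(IH _ _ (ltnW ltnN))[c Eq] ->] /mapP[r]].
have ltl : (l < N)%N := ltn_trans (ltn_ord l) ltnN.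
rewrite size_code Eq => /X_codes_code[|||c' Er ->]; rewrite ?g_lt //; last by exists c'.
by apply/eqP => /g_inj E; have := ltn_ord l; rewrite E ?ltnn.
Qed.

Lemma OSact_delta N n (f g : nat -> nat) (b : OSbasis n) (c : OSbasis N) :
  {in ltn^~ N &, injective f} -> (forall x, (x < N)%N -> (f x < N)%N) -> (n <= N)%N ->
  (forall x, (x < N)%N -> f x = g x) ->
  OSact f (delta k b) c = eval_codes (OSact_codes N g (code b)) (code c).
Proof.
move=> f_inj f_lt + fg; elim: n b c => [|n IH] b c ltnN.
  case: b; rewrite [OSact _ _ _]/= /delta eqxx mul1r /eval_codes big_seq1 expr0 mul1r -code_OSone.
  by rewrite (inj_eq (@code_inj N)) eq_sym.
case: b => o b; rewrite [OSact _ _ _]/=.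
have R0 o' : OSact f (fun x => delta k (o, b) (o', x)) = fun c' => (o' == o)%:R * OSact f (delta k b) c'.
  apply: functional_extensionality => c'; rewrite -(linZ (OSact_linear _ _)).
  by apply: OSact_fext => x; rewrite delta_pair.
rewrite R0; case: o R0 => [l|] R0; last first.
  rewrite eqxx mul1r big1 ?addr0 => [|l _]; first by rewrite IH // ltnW.
  by rewrite R0 (linZ (X_linear _ _ _)) mul0r.
rewrite mul0r add0r (bigD1 l) //= big1 ?addr0 => [|l' l'l]; last first.
  by rewrite R0 (linZ (X_linear _ _ _)) (_ : Some l' == Some l = false) ?mul0r //; apply/negbTE.
rewrite R0 (linZ (X_linear _ _ _)) eqxx mul1r size_code.
have ltl : (l < N)%N := ltn_trans (ltn_ord l) ltnN.
rewrite -!fg // (@X_fext _ _ _ _ _ _ (fun c' =>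
  \sum_(p <- OSact_codes N g (code b)) (-1) ^+ p.1 * (p.2 == code c')%:R)); last first.
  by move=> c'; rewrite IH // ltnW.
have g_inj : {in ltn^~ N &, injective g} by move=> x y Hx Hy; rewrite -!fg //; apply: f_inj.
have g_lt x : (x < N)%N -> (g x < N)%N by move=> Hx; rewrite -fg // f_lt.
rewrite (lin_sum (X_linear _ _ _)) /eval_codes big_flatten big_map big_seq [RHS]big_seq.
apply: eq_bigr => p /(OSact_codes_code g_inj g_lt (ltnW ltnN))[b' Ep].
rewrite (linZ (X_linear _ _ _)) Ep.
rewrite (@X_fext _ _ _ _ _ _ (delta k b')); last first.
  by move=> c'; rewrite /delta (inj_eq (@code_inj N)) eq_sym.
rewrite X_delta ?f_lt //; last first.
  by apply/eqP => /f_inj E; have := ltn_ord l; rewrite E ?ltnn.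
rewrite /eval_codes big_map mulr_sumr; apply: eq_bigr => q _ /=.
by rewrite signr_addb mulrA.
Qed.

Lemma sum_codes n (F : seq nat -> k) : \sum_(b : OSbasis n) F (code b) = \sum_(v <- codes n) F v.
Proof.
elim: n F => [|n IH] F.
  by rewrite big_seq1 (bigD1 tt) //= big1 ?addr0 // => -[].
rewrite -(pair_bigA _ (fun o b => F ((if o is Some l then (val l).+1 else 0%N) :: code b))) /=.
under eq_bigr => o _ do rewrite (IH (fun v => F (_ :: v))).
rewrite /= -[_ ++ _]/([seq x :: w | x <- 0%N :: iota 1 n, w <- codes n]) big_allpairs_dep big_cons.
rewrite (bigD1 None) //=; congr (_ + _).
rewrite -[1%N]addn0 iotaDl big_map (_ : iota 0 n = index_iota 0 n) ?/index_iota ?subn0 //.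
rewrite -[X in iota 0 X]subn0 -/(index_iota 0 n) big_mkord.
by rewrite (reindex_omap Some id) => [|[l|]] //=; apply: eq_bigl => l; rewrite eqxx.
Qed.

Lemma OStrace_countE n j (s : 'S_n) (g : nat -> nat) : (forall x, (x < n)%N -> perm_nat s^-1 x = g x) ->
  OStrace k j s = (OStrace_count false n j g)%:R - (OStrace_count true n j g)%:R.
Proof.
move=> sgn_at.
have degE (b : OSbasis n) : OSdegree b = degc (code b).
  by elim: (n) b => //= m IH [[l|] b] /=; rewrite IH.
transitivity (\sum_(v <- codes n | degc v == j) eval_codes (OSact_codes n g v) v).
  rewrite big_mkcond -sum_codes /OStrace big_mkcond; apply: eq_bigr => b _.
  rewrite degE; case: ifP => // _; apply: OSact_delta => //; [exact: perm_nat_inj|exact: perm_nat_lt].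
rewrite /OStrace_count !sumnE !big_map !natr_sum !big_filter -sumrB; apply: eq_bigr => v _.
rewrite /eval_codes -!sum1_count !natr_sum [X in _ = X - _]big_mkcond [X in _ = _ - X]big_mkcond -sumrB; apply: eq_bigr => -[[] w] _ /=.
  by rewrite expr1; case: eqP; rewrite ?mulr0 ?mulr1 ?subr0 ?sub0r.
by rewrite expr0 mul1r; case: eqP; rewrite ?subr0.
Qed.

End ComputeCorrect.

(** * Permutations as lists of values *)

Section PermLists.
Variable n : nat.
Implicit Types s t : 'S_n.

Definition perm_list s : seq nat := [seq perm_nat s x | x <- iota 0 n].
Definition lcomp (a b : seq nat) : seq nat := [seq nth 0%N b x | x <- a].

Lemma size_perm_list s : size (perm_list s) = n.
Proof. by rewrite size_map size_iota. Qed.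

Lemma nth_perm_list s x : (x < n)%N -> nth 0%N (perm_list s) x = perm_nat s x.
Proof. by move=> ltx; rewrite (nth_map 0%N) ?size_iota // nth_iota. Qed.

Lemma perm_list_inj : injective perm_list.
Proof.
move=> s t E; apply/permP => i; apply: val_inj.
by rewrite /= -!perm_nat_val -!nth_perm_list ?ltn_ord // E.
Qed.

Lemma perm_list_mul s t : perm_list (s * t)%g = lcomp (perm_list s) (perm_list t).
Proof.
rewrite /lcomp /perm_list -map_comp; apply/eq_in_map => x; rewrite mem_iota /= => ltx.
rewrite -/(perm_list t) nth_perm_list ?perm_nat_lt // -[x]/(val (Ordinal ltx)) !perm_nat_val.
by rewrite permM.
Qed.

Lemma perm_list_one : perm_list 1%g = iota 0 n.
Proof.
rewrite -[RHS]map_id; apply/eq_in_map => x; rewrite mem_iota /= => ltx.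
by rewrite -[x]/(val (Ordinal ltx)) perm_nat_val perm1.
Qed.

Lemma perm_list_uniq s : uniq (perm_list s).
Proof.
rewrite map_inj_in_uniq ?iota_uniq // => x y; rewrite !mem_iota /= => Hx Hy.
exact: perm_nat_inj.
Qed.

Lemma perm_nat_inv s x : (x < n)%N -> perm_nat s^-1 x = index x (perm_list s).
Proof.
move=> ltx; set y := perm_nat s^-1 x; have lty : (y < n)%N by apply: perm_nat_lt.
have -> : x = nth 0%N (perm_list s) y.
  by rewrite nth_perm_list // /y -[x]/(val (Ordinal ltx)) !perm_nat_val permKV.
by rewrite index_uniq ?size_perm_list ?perm_list_uniq.
Qed.

Lemma perm_list_perms s : perm_list s \in permutations (iota 0 n).
Proof.
rewrite mem_permutations uniq_perm ?perm_list_uniq ?iota_uniq //.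
apply: (uniq_min_size (perm_list_uniq s) _ _).2 => [x /mapP[y]|].
  by rewrite !mem_iota /= => lty ->; apply: perm_nat_lt.
by rewrite size_perm_list size_iota.
Qed.

Lemma perms_perm_list l : l \in permutations (iota 0 n) -> exists s, perm_list s = l.
Proof.
rewrite mem_permutations => Pl.
have Sl : size l = n by rewrite (perm_size Pl) size_iota.
have lt (i : 'I_n) : (nth 0%N l i < n)%N.
  have : nth 0%N l i \in iota 0 n by rewrite -(perm_mem Pl) mem_nth // Sl.
  by rewrite mem_iota.
have inj : injective (fun i => Ordinal (lt i)).
  move=> i j [/eqP]; rewrite nth_uniq ?Sl ?ltn_ord //; last by rewrite (perm_uniq Pl) iota_uniq.
  by move/eqP/val_inj.
exists (perm inj); apply: (@eq_from_nth _ 0%N) => [|x]; rewrite size_perm_list ?Sl // => ltx.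
by rewrite nth_perm_list // -[x]/(val (Ordinal ltx)) perm_nat_val permE.
Qed.

Lemma sum_perms (F : seq nat -> nat) :
  (\sum_(s : 'S_n) F (perm_list s) = \sum_(l <- permutations (iota 0 n)) F l)%N.
Proof.
rewrite -(big_map perm_list xpredT); apply: perm_big; apply: uniq_perm.
- by rewrite map_inj_uniq ?index_enum_uniq //; apply: perm_list_inj.
- exact: permutations_uniq.
move=> l; apply/mapP/idP => [[s _ ->]|/perms_perm_list[s <-]]; first exact: perm_list_perms.
by exists s; rewrite ?mem_index_enum.
Qed.

(** Conjugacy is tested as g r = l g, which avoids inverting lists. *)
Definition class_check (R : seq (seq nat)) :=
  all (mem (permutations (iota 0 n))) R && all (fun l => has (fun r =>
  has (fun g => lcomp g r == lcomp l g) (permutations (iota 0 n))) R) (permutations (iota 0 n)).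

Lemma class_ind R (P : 'S_n -> Prop) : class_check R ->
  (forall s g, P (s ^ g)%g -> P s) -> (forall s, perm_list s \in R -> P s) -> forall s, P s.
Proof.
move=> /andP[/allP RP /allP cR] Pc PR s.
have /hasP[r Rr /hasP[l /perms_perm_list[g <-] /eqP E]] := cR _ (perm_list_perms s).
have [rho rE] := perms_perm_list (RP _ Rr).
have : (g * rho = s * g)%g by apply: perm_list_inj; rewrite !perm_list_mul rE E.
move=> /(canRL (mulKg _)) rhoE; apply: (Pc s g); apply: PR.
by rewrite conjgE -rhoE rE.
Qed.

End PermLists.

(** * Characters of permutation modules *)

Section PermCharacters.
Variable n : nat.

Definition perm_char (chi : 'S_n -> nat) : Prop :=
  exists (X : finType) (to : {action 'S_n &-> X}), forall s, num_fixed to s = chi s.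

Lemma perm_char_ext chi chi' : chi =1 chi' -> perm_char chi -> perm_char chi'.
Proof. by move=> E [X [to toE]]; exists X, to => s; rewrite toE. Qed.

Lemma perm_char_conj chi s g : perm_char chi -> chi (s ^ g)%g = chi s.
Proof.
move=> [X [to toE]]; rewrite -!toE /num_fixed -[RHS](card_imset _ (@act_inj _ _ _ to g)).
apply: eq_card => x; rewrite !inE; apply/eqP/imsetP => [xE|[y]].
  exists (to x g^-1%g); rewrite ?inE ?actKV //.
  by apply/eqP; apply: (can_inj (actK to g)); rewrite actKV -!actM -conjgE.
rewrite inE => /eqP yE ->; rewrite -actM conjgE mulKVg.
by rewrite actM yE.
Qed.

Lemma perm_charI (X : finType) (f : X -> 'S_n -> X) : (forall x, f x 1%g = x) ->
  (forall x s t, f x (s * t)%g = f (f x s) t) ->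
  perm_char (fun s => #|[set x | f x s == x]|).
Proof. by move=> f1 fM; exists X, (TotalAction f1 fM). Qed.

Lemma perm_char0 : perm_char (fun=> 0%N).
Proof.
have [X [to E]] := @perm_charI void (fun x _ => x) (fun=> erefl) (fun _ _ _ => erefl).
by exists X, to => s; rewrite E; apply: eq_card0 => -[].
Qed.

Lemma perm_charD chi chi' : perm_char chi -> perm_char chi' ->
  perm_char (fun s => chi s + chi' s)%N.
Proof.
move=> [X [to toE]] [X' [to' toE']].
pose f (x : X + X') s := match x with inl y => inl (to y s) | inr y => inr (to' y s) end.
have [||Z [toz E]] := @perm_charI _ f.
- by case=> x; rewrite /f act1.
- by case=> x s t; rewrite /f actM.
exists Z, toz => s; rewrite E -toE -toE' /num_fixed -!sum1dep_card big_sumType /=.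
by congr (_ + _)%N; apply: eq_bigl => x.
Qed.

Lemma perm_charMn chi m : perm_char chi -> perm_char (fun s => m * chi s)%N.
Proof.
move=> H; elim: m => [|m IH]; first exact: perm_char0.
by apply: perm_char_ext (perm_charD H IH) => s; rewrite mulSn.
Qed.

(** The elements g with g s g^-1 in H are sorted by the coset H g: the condition says that s fixes H
    g, so each fixed coset contributes |H| of them. *)
Lemma perm_char_coset (H : {group 'S_n}) : exists2 chi, perm_char chi &
  forall s, (chi s * #|H| = #|[set g : 'S_n | (g * s * g^-1)%g \in H]|)%N.
Proof.
pose Q (B : {set 'S_n}) := B \in rcosets H [set: 'S_n]; pose X := {B : {set 'S_n} | Q B}.
have fP (B : X) (s : 'S_n) : (val B :* s)%g \in rcosets H [set: 'S_n].
  by case: B => B /= /rcosetsP[g _ ->]; rewrite -rcosetM mem_rcosets mulSGid ?subsetT // inE.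
pose f (B : X) s : X := exist Q _ (fP B s).
have HP := @perm_charI X f; exists (fun s => #|[set x | f x s == x]|).
  by apply: HP => [B|B s t]; apply: val_inj; rewrite /= ?rcoset1 ?rcosetM.
move=> s.
have cP (g : 'S_n) : (H :* g)%g \in rcosets H [set: 'S_n] by rewrite mem_rcosets mulSGid ?subsetT // inE.
pose c g : X := exist Q _ (cP g).
have fib (B : X) g : (c g == B) = (g \in val B).
  case: B => B BP; rewrite -val_eqE /=; case/rcosetsP: (BP) => h _ ->.
  by apply/eqP/idP => [<-|/rcoset_eqP ->]; rewrite ?rcoset_refl.
have fixE g : (f (c g) s == c g) = ((g * s * g^-1)%g \in H).
  rewrite -val_eqE /= -rcosetM; apply/eqP/idP => [E|Hs].
    by rewrite -mem_rcoset -E rcoset_refl.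
  by apply/rcoset_eqP; rewrite mem_rcoset.
rewrite -[RHS]sum1dep_card (partition_big c xpredT) //=.
rewrite -sum1dep_card big_mkcond big_distrl /=; apply: eq_bigr => B _.
have [g gB] : exists g, c g = B.
  by case: B => B BP; case/rcosetsP: (BP) => g _ Bg; exists g; apply: val_inj.
rewrite -(card_rcoset H g) -sum1_card; case: ifP => fB; rewrite ?mul1n ?mul0n.
  apply: eq_bigl => h; rewrite -fixE -[(H :* g)%g]/(val (c g)) -fib gB.
  by have [->|] := eqVneq (c h) B; rewrite ?fB ?andbF.
rewrite big1 // => h /andP[+ /eqP hB].
by rewrite -fixE hB fB.
Qed.

End PermCharacters.

Section ListGroups.
Variable n : nat.

(** No inverses are tested: a finite set of permutations that contains 1 and is closed under
    products is a subgroup. *)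
Definition group_check (L : seq (seq nat)) :=
  [&& uniq L, iota 0 n \in L, all (mem (permutations (iota 0 n))) L &
      all (fun a => all (fun b => lcomp a b \in L) L) L].

Definition conj_count (L : seq (seq nat)) (l : seq nat) : nat :=
  count (fun g => has (fun h => lcomp g l == lcomp h g) L) (permutations (iota 0 n)).

Lemma perm_char_list L : group_check L -> exists2 chi, perm_char chi &
  forall s : 'S_n, (chi s * size L = conj_count L (perm_list s))%N.
Proof.
move=> /and4P[UL L1 LP LM].
pose H := [set s : 'S_n | perm_list s \in L].
have gH : group_set H.
  apply/group_setP; split=> [|s t]; rewrite !inE ?perm_list_one // => Hs Ht.
  by rewrite perm_list_mul; apply: (allP (allP LM _ Hs)).
have card_perms (p : pred (seq nat)) :
    (#|[set s : 'S_n | p (perm_list s)]| = count p (permutations (iota 0 n)))%N.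
  rewrite -sum1dep_card big_mkcond -sum1_count [RHS]big_mkcond /=.
  exact: (sum_perms n (fun l => if p l then 1 else 0)%N).
have [chi chiP chiE] := perm_char_coset (Group gH); exists chi => // s.
have <- : #|H| = size L.
  rewrite card_perms -size_filter; apply/perm_size/uniq_perm => // [|l].
    exact/filter_uniq/permutations_uniq.
  by rewrite mem_filter; apply/andP/idP => [[]|Ll] //; split=> //; apply: (allP LP).
rewrite chiE /conj_count -card_perms; apply: eq_card => g; rewrite !inE.
apply/idP/hasP => [Hg|[h Lh /eqP E]].
  by exists (perm_list (g * s * g^-1)%g); rewrite // -!perm_list_mul mulgKV.
have [t Et] := perms_perm_list (allP LP _ Lh); rewrite -Et -!perm_list_mul in E.
by rewrite (perm_list_inj E) mulgK Et.
Qed.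

End ListGroups.

(** * Degrees 0 and 1 *)

Section LowDegree.
Variables (k : fieldType) (n i : nat).
Hypothesis k0 : [pchar k] =i pred0.
Hypothesis i_le1 : (i <= 1)%N.

(** A quadratic relation needs two consecutive positions, so J_i = 0 and the quotient is the
    permutation module on words. *)
Lemma tr_OSdual_low (s : 'S_n) :
  \tr (OSdual_mx (k := k) n i s) = #|[set w : word n i | word_act s w == w]|%:R.
Proof.
have J0 : Jsq k n i = 0.
  apply/eqP; rewrite /Jsq -submx0 genmxE submx0; apply/eqP/matrixP => r c; rewrite !mxE.
  case: (enum_val r) => [[p w] q]; rewrite (_ : (_ < i)%N = false) //.
  by have := ltn_ord p; lia.
have F : row_free (val_factmod (1%:M : 'M_(\rank (cokermx (Jsq k n i))))).
  by apply: inj_row_free => v; rewrite -val_factmodE => /eqP; rewrite val_factmod_eq0 => /eqP.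
have Fu : row_full (val_factmod (1%:M : 'M_(\rank (cokermx (Jsq k n i))))).
  apply/row_fullP; exists (in_factmod _ 1%:M); rewrite -val_factmodE.
  have := add_sub_fact_mod (Jsq k n i) 1%:M.
  by rewrite (_ : val_submod _ = 0) ?add0r //; apply/eqP; rewrite -submx0 -[X in (_ <= X)%MS]J0 val_submodP.
rewrite (mxtrace_sim F Fu (A' := Tmx k i s)).
  rewrite -sum1dep_card natr_sum big_mkcond sum_enum_val.
  by apply: eq_bigr => x _; rewrite mxE; case: ifP.
rewrite -val_factmodE /OSdual_mx; move: (_ *m Tmx k i s) => W.
have := add_sub_fact_mod (Jsq k n i) W.
by rewrite (_ : val_submod _ = 0) ?add0r //; apply/eqP; rewrite -submx0 -[X in (_ <= X)%MS]J0 val_submodP.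
Qed.

Lemma low_perm_char : exists2 chi, @perm_char n chi & forall s, dual_trace k i s = (chi s)%:R.
Proof.
exists (fun s => #|[set w : word n i | word_act s w == w]|).
  by apply: (@perm_charI _ _ (fun w s => word_act s w)) => [w|w s t]; rewrite ?word_act1 ?word_actM.
by move=> s; rewrite -(tr_OSdual _ k0) tr_OSdual_low.
Qed.
End LowDegree.

Lemma dual_trace_0 (k : fieldType) (k0 : [pchar k] =i pred0) n (s : 'S_n) : dual_trace k 0 s = 1.
Proof.
rewrite -(tr_OSdual _ k0) tr_OSdual_low // -[RHS]/(1%:R); congr (_%:R).
rewrite (eq_card (B := [set: word n 0])) ?cardsT ?card_ffun ?card_ord ?expn0 // => w.
by rewrite !inE; apply/eqP/ffunP => -[].
Qed.

Lemma dual_trace_class (k : fieldType) (k0 : [pchar k] =i pred0) n i (s g : 'S_n) :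
  dual_trace k i (s ^ g)%g = dual_trace k i s.
Proof.
rewrite -!(tr_OSdual _ k0); have [R1 RM] := OSdual_rep n i k0.
by rewrite conjgE !RM mxtrace_mulC -mulmxA -RM mulgV R1 mulmx1.
Qed.

(** * The Koszul identity as a recurrence for the dual characters *)

Section Recurrence.

Fixpoint dot (c r : seq int) : int :=
  if c is x :: c' then if r is y :: r' then x * y + dot c' r' else 0 else 0.

(** The newest value comes first, so that [dot] with the coefficients is the convolution of the
    recurrence. *)
Fixpoint dual_trace_rev (c : seq int) (N : nat) : seq int :=
  if N is N'.+1 then let r := dual_trace_rev c N' in dot c r :: r else [:: 1].

Definition dual_trace_seq c N := head 0 (dual_trace_rev c N).

Lemma dual_trace_revE c N : dual_trace_rev c N = [seq dual_trace_seq c (N - j) | j <- iota 0 N.+1].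
Proof.
elim: N => // N IH; transitivity (dual_trace_seq c N.+1 :: dual_trace_rev c N) => //.
have -> : iota 0 N.+2 = 0%N :: [seq (1 + x)%N | x <- iota 0 N.+1].
  by rewrite -[LHS]/(0%N :: iota (1 + 0) N.+1) iotaDl.
by rewrite map_cons -map_comp IH subn0.
Qed.

Lemma dotE c r : dot c r = \sum_(j < size r) c`_j * r`_j.
Proof.
elim: c r => [|x c IH] [|y r] /=; rewrite ?big_ord0 //.
  by rewrite big1 // => j _; rewrite nth_nil mul0r.
by rewrite big_ord_recl IH.
Qed.

Lemma dual_trace_seqS c N : dual_trace_seq c N.+1 = \sum_(j < N.+1) c`_j * dual_trace_seq c (N - j).
Proof.
rewrite {1}/dual_trace_seq [head _ _]/= dotE dual_trace_revE size_map size_iota.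
by apply: eq_bigr => j _; rewrite (nth_map 0%N) ?size_iota // nth_iota.
Qed.

Definition OStrace_int n l j : int := (OStrace_count false n j (index^~ l))%:Z - (OStrace_count true n j (index^~ l))%:Z.

(* The coefficients of the recurrence A_(N+1) = sum_j c_j A_(N-j). *)
Definition koszul_coefs n l : seq int := [seq (-1) ^+ j * OStrace_int n l j.+1 | j <- iota 0 n.-1].

(** Vertex 0 has no smaller vertex to be joined to, so a monomial has at most n-1 edges; hence
    [koszul_coefs] has n-1 entries. *)
Lemma OStrace_count_big b n j g : (0 < n <= j)%N -> OStrace_count b n j g = 0%N.
Proof.
case: n => // n nj; rewrite /OStrace_count (_ : [seq v <- _ | _] = [::]) //; apply/eqP.
rewrite -[_ == _]negbK -has_filter; apply/hasPn => v Hv; rewrite neq_ltn; apply/orP; left.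
apply: leq_trans nj; elim: n v Hv => [|n IH] v; first by rewrite inE => /eqP ->.
rewrite [codes _]/= -[_ ++ _]/([seq x :: w | x <- iota 0 n.+2, w <- codes n.+1]).
by move=> /allpairsPdep[x [w [_ /IH Hw ->]]]; rewrite /degc /= ltnS; case: (x != 0%N) => //; apply: ltnW.
Qed.

(** As E_0 = 1, the Koszul identity can be solved for the value of highest degree. *)
Lemma dual_traceE (k : fieldType) (k0 : [pchar k] =i pred0) n N (s : 'S_n) :
  (0 < n)%N -> OStrace_int n (perm_list s) 0 = 1 -> dual_trace k N s = (dual_trace_seq (koszul_coefs n (perm_list s)) N)%:~R.
Proof.
move=> n_gt0 e0.
have EE j : OStrace k j s = (OStrace_int n (perm_list s) j)%:~R.
  by rewrite (OStrace_countE _ _ (fun x => @perm_nat_inv n s x)) /OStrace_int rmorphB.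
have cE j : (koszul_coefs n (perm_list s))`_j = (-1) ^+ j * OStrace_int n (perm_list s) j.+1.
  have [ltj|gej] := ltnP j n.-1.
    by rewrite (nth_map 0%N) ?size_iota // nth_iota.
  rewrite nth_default ?size_map ?size_iota // /OStrace_int !OStrace_count_big ?subrr ?mulr0 //; lia.
elim/ltn_ind: N => -[|N] IH; first by rewrite dual_trace_0.
have := koszul_trace k0 s (ltn0Sn N); rewrite big_ord_recl /= EE e0 expr0 !mul1r subn0 => /eqP.
rewrite addr_eq0 => /eqP ->; rewrite dual_trace_seqS rmorph_sum -sumrN; apply: eq_bigr => j _.
rewrite /= /bump /= add1n subSS EE IH ?ltnS ?leq_subr // cE !rmorphM rmorphXn rmorphN rmorph1.
by rewrite exprS mulN1r mulNr opprK mulrA.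
Qed.

Lemma dual_trace_perm_char (k : fieldType) (k0 : [pchar k] =i pred0) n i R chi :
  (0 < n)%N -> class_check n R -> all (fun r => OStrace_int n r 0 == 1) R -> @perm_char n chi ->
  (forall s : 'S_n, perm_list s \in R -> dual_trace_seq (koszul_coefs n (perm_list s)) i = chi s) ->
  forall s : 'S_n, dual_trace k i s = (chi s)%:R.
Proof.
move=> n_gt0 cR /allP eR chiP hR; apply: (class_ind cR) => [s g|s Rs].
  by rewrite dual_trace_class // (perm_char_conj _ _ chiP).
by rewrite dual_traceE ?hR //; apply/eqP/eR.
Qed.

End Recurrence.

(** * Propagation of permutation characters through all degrees *)

Section PermTrace.
Variable k : fieldType.
Hypothesis k0 : [pchar k] =i pred0.

Definition perm_trace n i : Prop :=
  exists2 chi, @perm_char n chi & forall s, dual_trace k i s = (chi s)%:R.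

Lemma perm_trace_module n i : perm_trace n i -> perm_module (OSdual_mx (k := k) n i).
Proof.
move=> [chi [X [to toE]] OStrace]; apply: (perm_moduleP k0 (to := to)); first exact: OSdual_rep.
by move=> s; rewrite tr_OSdual // OStrace toE.
Qed.

Lemma intr_inj_pchar0 (x y : int) : x%:~R = y%:~R :> k -> x = y.
Proof.
move=> /eqP; rewrite -subr_eq0 -rmorphB => xy; apply/eqP; rewrite -subr_eq0.
case: (x - y) xy => [[|m]|m] //; last by rewrite NegzE rmorphN oppr_eq0; apply: contraLR => _; apply: natk_neq0.
by rewrite /= -[_ == 0]/(m.+1%:R == 0 :> k) (negbTE (natk_neq0 k0 m)).
Qed.

(* The number of fixed points of the permutation l on the cosets of the group listed by L. *)
Definition mark n (L : seq (seq nat)) l := (conj_count n L l %/ size L)%N.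

Lemma perm_char_mark n L : group_check n L -> @perm_char n (fun s => mark n L (perm_list s)).
Proof.
move=> Lok; have [chi chiP chiE] := perm_char_list Lok.
apply: perm_char_ext chiP => s; rewrite /mark -chiE mulnK //.
by case/and4P: Lok; case: (L).
Qed.

(** From index [size c] on, the convolution has a fixed number of terms and is a linear recurrence
    with constant coefficients. *)
Lemma dual_trace_seq_rec c i : (0 < size c)%N ->
  dual_trace_seq c (i + size c) = \sum_(j < size c) c`_j * dual_trace_seq c (i + (size c).-1 - j).
Proof.
case E: (size c) => [|q] // _; rewrite addnS dual_trace_seqS /=.
rewrite -!(big_mkord xpredT (fun j => c`_j * dual_trace_seq c (i + q - j))).
rewrite (@big_cat_nat _ _ _ q.+1) //=; last by rewrite ltnS leq_addl.
rewrite [X in _ + X = _]big_nat [X in _ + X = _]big1 ?addr0 // => j /andP[Hj _].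
by rewrite nth_default ?mul0r // E.
Qed.

(** Both sides obey the same recurrence of order [size c], so agreement on the first [size c]
    indices suffices. *)
Lemma dual_trace_seq_step (c : seq int) t (f : nat -> int) : (0 < size c)%N ->
  (forall i, f (i + size c)%N = \sum_(j < size c) c`_j * f (i + (size c).-1 - j)%N) ->
  (forall i, (i < size c)%N -> dual_trace_seq c (i + t) = dual_trace_seq c i + f i) ->
  forall i, dual_trace_seq c (i + t) = dual_trace_seq c i + f i.
Proof.
move=> c_gt0 frec fbase i; elim/ltn_ind: i => i IH; have [/fbase //|cle] := ltnP i (size c).
rewrite -(subnK cle); set m := (i - size c)%N; rewrite addnAC dual_trace_seq_rec // dual_trace_seq_rec // frec.
rewrite -big_split; apply: eq_bigr => j _ /=; rewrite -mulrDr -IH; last by rewrite /m; have := ltn_ord j; move: (nat_of_ord j) => x; move: (size c) cle c_gt0 => p; lia.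
congr (_ * dual_trace_seq c _); rewrite /m; have := ltn_ord j; move: (nat_of_ord j) => x.
by move: (size c) cle c_gt0 => p; lia.
Qed.

Definition base_check n R t (F : nat -> seq nat -> nat) : bool :=
  all (fun r => all (fun i => dual_trace_seq (koszul_coefs n r) (i + t) == dual_trace_seq (koszul_coefs n r) i + (F i r)%:Z)
                    (iota 0 n.-1)) R.

(** Reduces all degrees to finitely many computations: [base_check] compares n-1 degrees on each
    class, [Frec] extends the comparison, and sums of permutation characters are permutation
    characters. *)
Lemma perm_trace_step n R t (F : nat -> seq nat -> nat) :
  (1 < n)%N -> (0 < t)%N -> class_check n R -> all (fun r => OStrace_int n r 0 == 1) R ->
  (forall i, @perm_char n (fun s => F i (perm_list s))) -> base_check n R t F ->
  (forall r i, r \in R -> (F (i + n.-1)%N r)%:Z =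
     \sum_(j < n.-1) (koszul_coefs n r)`_j * (F (i + n.-2 - j)%N r)%:Z) ->
  (forall i, (i < t)%N -> perm_trace n i) -> forall i, perm_trace n i.
Proof.
move=> n_gt1 t_gt0 cR eR FP FB Frec Pt i; elim/ltn_ind: i => i IH.
have [/Pt //|tle] := ltnP i t; rewrite -(subnK tle); set m := (i - t)%N.
have [|chi chiP chiE] := IH m; first by rewrite /m; lia.
have P' := perm_charD chiP (FP m); have n_gt0 := ltnW n_gt1.
eexists; first exact: P'.
apply: (dual_trace_perm_char k0 n_gt0 cR eR P') => s Rs.
have scs : size (koszul_coefs n (perm_list s)) = n.-1 by rewrite size_map size_iota.
rewrite (@dual_trace_seq_step _ _ (fun i => (F i (perm_list s))%:Z)) ?scs; last 3 first.
- by case: (n) n_gt1 => [|[]].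
- by move=> j; rewrite Frec.
- by move=> j ltj; apply/eqP; apply: (allP (allP FB _ Rs)); rewrite mem_iota.
rewrite PoszD; congr (_ + _); apply: intr_inj_pchar0.
by rewrite -(dual_traceE k0) ?chiE //; apply/eqP/(allP eR).
Qed.

Lemma perm_trace_check n i R F : (0 < n)%N -> class_check n R -> all (fun r => OStrace_int n r 0 == 1) R ->
  @perm_char n (fun s => F (perm_list s)) -> all (fun r => dual_trace_seq (koszul_coefs n r) i == (F r)%:Z) R ->
  perm_trace n i.
Proof.
move=> n_gt0 cR eR FP /allP FR; eexists; first exact: FP.
by apply: (dual_trace_perm_char k0 n_gt0 cR eR FP) => s Rs; apply/eqP/FR.
Qed.

Lemma perm_trace_low n i : (i <= 1)%N -> perm_trace n i.
Proof. by move=> i1; apply: low_perm_char. Qed.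

End PermTrace.
Ltac eval_table := repeat match goal with
  | |- context [koszul_coefs ?n ?l] => let v := eval vm_compute in (koszul_coefs n l) in
      rewrite (_ : koszul_coefs n l = v); last by vm_compute
  | |- context [mark ?n ?L ?l] => let v := eval vm_compute in (mark n L l) in
      rewrite (_ : mark n L l = v); last by vm_compute
  end.

Ltac rec_table := eval_table; rewrite !big_ord_recl big_ord0 /= /bump /=;
  rewrite ?(add0n, add1n, addn0, addn1, addn2, addn3, addn4, subSS, subn0) /= ?expnS.

(** * Explicit decompositions for n <= 5 and the negative value for n = 6, 7 *)

Section SmallCases.
Variable k : fieldType.
Hypothesis k0 : [pchar k] =i pred0.

Definition lcomp_pow n l m : seq nat := iter m (lcomp^~ l) (iota 0 n).
(** [n.+2] powers are enough to detect the order of every permutation used below, which is at most 6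
    for n = 5. *)
Definition cyclic_list n l : seq (seq nat) := [seq lcomp_pow n l m | m <- iota 0 (size (undup [seq lcomp_pow n l m | m <- iota 0 n.+2]))].
Definition lcomp_prod (L M : seq (seq nat)) := [seq lcomp a b | a <- L, b <- M].

Lemma perm_trace1 i : perm_trace k 1 i.
Proof.
case: i => [|i]; first exact: perm_trace_low.
by apply: (@perm_trace_check _ k0 1 i.+1 [:: [:: 0%N]] (fun=> 0%N)) => //; apply: perm_char0.
Qed.

Lemma perm_trace2 i : perm_trace k 2 i.
Proof.
apply: (@perm_trace_step _ k0 2 [:: [:: 0; 1]; [:: 1; 0]]%N 1 (fun _ _ => 0%N)).
1-4,6: by vm_compute.
- by move=> j; apply: perm_char0.
- by move=> r j _; rewrite big1 // => h _; rewrite mulr0.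
by case=> // _; apply: perm_trace_low.
Qed.

Definition classes3 : seq (seq nat) := [:: [:: 0; 1; 2]; [:: 1; 0; 2]; [:: 1; 2; 0]]%N.

(** A_(i+2) - A_i is 2^i times the regular character. Shift 1 is impossible: A_1 - A_0 is -1 on a
    3-cycle. *)
Lemma perm_trace3 i : perm_trace k 3 i.
Proof.
apply: (@perm_trace_step _ k0 3 classes3 2 (fun i r => 2 ^ i * mark 3 [:: iota 0 3] r)%N).
1-4,6: by vm_compute.
- by move=> j; apply/perm_charMn/perm_char_mark; vm_compute.
- by move=> r j; rewrite !inE => /or3P[] /eqP ->; rec_table; lia.
by move=> j ltj; apply: perm_trace_low.
Qed.

Definition classes4 : seq (seq nat) :=
  [:: [:: 0; 1; 2; 3]; [:: 1; 0; 2; 3]; [:: 1; 0; 3; 2]; [:: 1; 2; 0; 3]; [:: 1; 2; 3; 0]]%N.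

(* The number of regular summands separating degree j + 2 from degree j for n = 4. *)
Fixpoint coef4 j : nat := if j is j'.+1 then 3 * coef4 j' + 2 ^ j' + 1 else 0.

(** The summands are cosets of the group of a transposition, of a double transposition, and of the
    trivial group; in dimensions, 24 = 12 + 12 for i = 0 and 84 = 12 + 24 + 48 for i = 1. *)
Lemma perm_trace4 i : perm_trace k 4 i.
Proof.
apply: (@perm_trace_step _ k0 4 classes4 2 (fun i r => mark 4 (cyclic_list 4 [:: 1; 0; 2; 3]) r
  + 2 ^ i * mark 4 (cyclic_list 4 [:: 1; 0; 3; 2]) r + coef4 i * mark 4 (cyclic_list 4 (iota 0 4)) r)%N).
1-4,6: by vm_compute.
- by move=> j; apply: perm_charD; [apply: perm_charD|]; try apply: perm_charMn; apply: perm_char_mark; vm_compute.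
- by move=> r j; rewrite !inE => /or4P[|||/orP[]] /eqP ->; rec_table; lia.
by move=> j ltj; apply: perm_trace_low.
Qed.

Definition classes5 : seq (seq nat) := [:: [:: 0; 1; 2; 3; 4]; [:: 1; 0; 2; 3; 4];
  [:: 1; 0; 3; 2; 4]; [:: 1; 2; 0; 3; 4]; [:: 1; 2; 0; 4; 3]; [:: 1; 2; 3; 0; 4];
  [:: 1; 2; 3; 4; 0]]%N.

(* The number of regular summands separating degree j + 4 from degree j for n = 5. *)
Fixpoint coef5 j : nat := if j is j'.+1 then 4 * coef5 j' + (9 * 3 ^ j' + 14 * 2 ^ j').-1 else 7.

Local Notation markC2a := (mark 5 (cyclic_list 5 [:: 1; 0; 2; 3; 4]%N)).
Local Notation markC2b := (mark 5 (cyclic_list 5 [:: 1; 0; 3; 2; 4]%N)).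
Local Notation markC6 := (mark 5 (cyclic_list 5 [:: 1; 2; 0; 4; 3]%N)).
Local Notation markV4 := (mark 5 (lcomp_prod (cyclic_list 5 [:: 1; 0; 2; 3; 4]%N) (cyclic_list 5 [:: 0; 1; 3; 2; 4]%N))).
Local Notation markD8 := (mark 5 (lcomp_prod (cyclic_list 5 [:: 2; 1; 0; 3; 4]%N) (cyclic_list 5 [:: 1; 2; 3; 0; 4]%N))).

(** On a 5-cycle the characters are 1, 0, 0, 0, 1 in degrees 0 to 4, so no shift below 4 gives a
    nonnegative difference from degree 0. For i = 0 the dimensions are 1700 = 20 + 540 + 300 +
    840. *)
Lemma perm_trace5 i : perm_trace k 5 i.
Proof.
apply: (@perm_trace_step _ k0 5 classes5 4 (fun i r => markC6 r + (5 * 2 ^ i.+1).-1 * markC2a r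
  + 5 * 2 ^ i * markC2b r + coef5 i * mark 5 (cyclic_list 5 (iota 0 5)) r)%N).
1-4,6: by vm_compute.
- by move=> j; do 3?[apply: perm_charD]; try apply: perm_charMn; apply: perm_char_mark; vm_compute.
(* Positivity of the powers makes the predecessors in the multiplicities genuine subtractions. *)
- move=> r j; have := expn_gt0 2 j; have := expn_gt0 3 j; rewrite !inE => ? ?.
  by move=> /or4P[|||/or4P[]] /eqP ->; rec_table; lia.
(* Degrees 2 and 3 of the initial block are decomposed separately, in dimensions 65 = 15 + 20 + 30
   and 350 = 20 + 180 + 30 + 120. *)
case=> [|[|[|[|]]]] // _; try exact: perm_trace_low.
  apply: (@perm_trace_check _ k0 5 _ classes5 (fun r => markD8 r + markC6 r + markV4 r)%N).
  1-3,5: by vm_compute.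
  by do 2?[apply: perm_charD]; apply: perm_char_mark; vm_compute.
apply: (@perm_trace_check _ k0 5 _ classes5
  (fun r => markC6 r + 3 * markC2a r + markV4 r + 2 * markC2b r)%N).
1-3,5: by vm_compute.
by apply: perm_charD; [apply: perm_charD; [apply: perm_charD|]|]; try apply: perm_charMn; apply: perm_char_mark; vm_compute.
Qed.

Lemma sixcycle_trace n : (n == 6)%N || (n == 7)%N ->
  exists s : 'S_n, \tr (OSdual_mx (k := k) n 5 s) = -1.
Proof.
have E m l : (0 < m)%N -> perm_eq l (iota 0 m) -> OStrace_int m l 0 = 1 -> dual_trace_seq (koszul_coefs m l) 5 = -1 ->
  exists s : 'S_m, \tr (OSdual_mx (k := k) m 5 s) = -1.
  move=> m_gt0 Pl e0 h5; have [|s El] := @perms_perm_list m l; first by rewrite mem_permutations.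
  by exists s; rewrite (tr_OSdual _ k0) (dual_traceE k0) ?El // h5 rmorphN1.
case/orP => /eqP ->; [apply: (E _ [:: 1; 2; 3; 4; 5; 0]%N)|apply: (E _ [:: 1; 2; 3; 4; 5; 0; 6]%N)];
  by vm_compute.
Qed.

(** A fixed point count m equal to the trace -c would give m + c = 0 with c positive, impossible in
    characteristic zero. *)
Lemma dsum_not_perm_module n c d (rho : 'S_n -> 'M[k]_d) s : (0 < c)%N ->
  \tr (rho s) = -1 -> ~ perm_module (dsum c rho).
Proof.
case: c => // c _ trN /tr_perm_module[X [to /(_ s)]]; rewrite tr_dsum trN mulrN1 => /eqP.
by rewrite eq_sym -addr_eq0 -natrD addnS (negbTE (natk_neq0 k0 _)).
Qed.

Lemma not_perm_module n d (rho : 'S_n -> 'M[k]_d) s : \tr (rho s) = -1 -> ~ perm_module rho.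
Proof.
move=> trN /tr_perm_module[X [to /(_ s)]]; rewrite trN => /eqP.
by rewrite eq_sym -addr_eq0 -mulrSr (negbTE (natk_neq0 k0 _)).
Qed.

End SmallCases.

(** * Quotient of a permutation module by a commuting cyclic group of order p + 2 *)

Section CyclicQuotient.
Variables (n p : nat) (X : finType) (f : X -> 'S_n -> X) (S : {set X}) (tau : X -> X).
Hypothesis f1 : forall x, f x 1%g = x.
Hypothesis fM : forall x s t, f x (s * t)%g = f (f x s) t.
Hypothesis f_tau : forall x s, f (tau x) s = tau (f x s).
Hypothesis tau_order : forall x, iter p.+2 tau x = x.
Hypothesis fS : forall x s, x \in S -> f x s \in S.
Hypothesis tauS : forall x, x \in S -> tau x \in S.

Lemma iter_tau_act (x : X) (a b : 'Z_p.+2) : iter (a * b)%g tau x = iter b tau (iter a tau x).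
Proof.
have -> : (a * b)%g = ((b + a) %% p.+2)%N :> nat by rewrite addnC.
rewrite -iterD [in RHS](divn_eq (b + a) p.+2) iterD; set y := iter _ tau x.
by elim: (_ %/ _)%N => // q IH; rewrite mulSn iterD -IH tau_order.
Qed.

Definition cyc_act : {action 'Z_p.+2 &-> X} :=
  TotalAction (to := fun x (a : 'Z_p.+2) => iter a tau x) (fun=> erefl) iter_tau_act.

Local Notation K := [set: 'Z_p.+2]%G.
Local Notation orb := (orbit cyc_act K).

Lemma f_iter r x s : f (iter r tau x) s = iter r tau (f x s).
Proof. by elim: r => //= r IH; rewrite f_tau IH. Qed.

Lemma f_orbit x s : [set f y s | y in orb x] = orb (f x s).
Proof.
rewrite /orbit -imset_comp; apply: eq_imset => a /=; exact: f_iter.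
Qed.

(* Burnside's lemma on the [x] of [S] whose orbit is fixed by [s]. *)
Lemma perm_char_cyclic : exists2 chi, perm_char chi &
  forall s, (p.+2 * chi s = \sum_(r < p.+2) #|[set x in S | f x s == iter r tau x]|)%N.
Proof.
pose Q (B : {set X}) := B \in [set orb x | x in S].
have gP (B : {B | Q B}) s : Q [set f y s | y in val B].
  by case: B => B /= /imsetP[x xS ->]; rewrite f_orbit; apply/imsetP; exists (f x s); rewrite ?fS.
pose g B s : {B | Q B} := exist Q _ (gP B s).
exists (fun s => #|[set B | g B s == B]|).
  apply: perm_charI => [B|B s t]; apply: val_inj => /=.
    by rewrite (eq_imset _ f1) imset_id.
  by rewrite -imset_comp; apply: eq_imset => x /=; rewrite fM.
move=> s; pose T := [set x in S | f x s \in orb x].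
have orbS x : x \in S -> orb x \subset S.
  move=> xS; apply/subsetP => _ /imsetP[a _ ->] /=.
  by elim: (nat_of_ord a) => //= r IH; apply: tauS.
have fixE x : (f x s \in orb x) = ([set f y s | y in orb x] == orb x).
  by rewrite f_orbit; apply/orbit_eqP/eqP.
have -> : #|[set B | g B s == B]| = #|[set orb x | x in T]|.
  rewrite -(card_imset _ val_inj); apply: eq_card => B; apply/imsetP/imsetP.
    case=> -[C CQ]; rewrite inE -val_eqE /= => fixC ->.
    case/imsetP: (CQ) => x xS Cx; exists x => //; rewrite inE xS fixE.
    by rewrite /= Cx in fixC.
  case=> x; rewrite inE fixE => /andP[xS xf] ->.
  have Qx : Q (orb x) by apply: imset_f.
  by exists (exist Q _ Qx); rewrite // inE -val_eqE.
have actT : [acts K, on T | cyc_act].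
  apply/actsP => a _ x; rewrite !inE.
  have xa : orb (cyc_act x a) = orb x by apply/orbit_eqP; rewrite mem_orbit ?inE.
  have fxa : f (cyc_act x a) s = cyc_act (f x s) a by apply: f_iter.
  rewrite xa fxa; congr (_ && _).
    apply/idP/idP => xS; last by apply: (subsetP (orbS x xS)); rewrite mem_orbit ?inE.
    by apply: (subsetP (orbS _ xS)); rewrite xa orbit_refl.
  by apply/idP/idP => /orbit_eqP E; apply/orbit_eqP; rewrite -E; [apply/esym|]; apply/orbit_eqP; rewrite mem_orbit ?inE.
have := Frobenius_Cauchy actT; rewrite cardsT card_ord mulnC => <-.
transitivity (\sum_(x in T) #|'C_K[x | cyc_act]%g|)%N.
  transitivity (\sum_(a : 'Z_p.+2) \sum_(x in T) (cyc_act x a == x))%N.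
    rewrite [LHS](eq_bigl xpredT) => [|a]; last by rewrite inE.
    apply: eq_bigr => a _; rewrite -sum1dep_card big_mkcondr /=.
    by apply: eq_big => [x|x _]; rewrite ?inE ?sub1set ?inE //; case: eqP.
  rewrite exchange_big; apply: eq_bigr => x _.
  rewrite (_ : #|_| = #|[set a : 'Z_p.+2 | cyc_act x a == x]|); last first.
    by apply: eq_card => a; rewrite !inE sub1set inE.
  by rewrite -sum1dep_card [RHS]big_mkcond; apply: eq_bigr => a _; case: eqP.
transitivity (\sum_(a : 'Z_p.+2) \sum_(x in S) (f x s == cyc_act x a))%N; last first.
  apply: eq_bigr => a _; rewrite -sum1dep_card big_mkcondr /=.
  by apply: eq_bigr => x _; case: eqP.
rewrite exchange_big [RHS](bigID (fun x => f x s \in orb x)) /= [X in (_ + X)%N]big1 ?addn0; last first.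
  move=> x /andP[_ nx]; apply: big1 => a _; case: eqP => // E.
  by case/negP: nx; rewrite E; apply: (mem_orbit cyc_act x (in_setT a)).
apply: eq_big => [x|x]; rewrite inE // => /andP[_ /orbitP[b _ xb]].
rewrite -(card_rcoset _ b) -(amove_act _ _ (subsetT _)) ?inE //.
rewrite (_ : #|_| = #|[set a : 'Z_p.+2 | f x s == cyc_act x a]|); last first.
  by apply: eq_card => a; rewrite !inE -xb eq_sym.
by rewrite -sum1dep_card [LHS]big_mkcond; apply: eq_bigr => a _; case: eqP.
Qed.

End CyclicQuotient.

(** * Orthogonal projection onto the quadratic relations *)

Section DegreeTwo.
Variables (k : fieldType) (n : nat).
Hypothesis k0 : [pchar k] =i pred0.
Implicit Types (i j l : 'I_n) (P Q : {set 'I_n}) (phi : {set 'I_n} -> {set 'I_n} -> k).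

Notation triple := ('I_n * 'I_n * 'I_n)%type.
Notation distinct t := (uniq [:: t.1.1; t.1.2; t.2]).

Lemma distinct_inj (t t' : triple) : distinct t -> distinct t' ->
  [set t.1.1; t.1.2] = [set t'.1.1; t'.1.2] -> [set t.1.1; t.2] = [set t'.1.1; t'.2] -> t = t'.
Proof.
case: t t' => [[i j] l] [[i' j'] l'] /=; rewrite !inE !negb_or !andbT.
move=> /andP[/andP[ij il] jl] /andP[/andP[ij' il'] jl'] E1 E2.
have Ei : i = i'.
  have := set21 i j; rewrite E1 => /set2P[] // ie; have := set21 i l; rewrite E2 => /set2P[] // ie'.
  by move: jl'; rewrite -ie -ie' eqxx.
subst i'; congr (_, _, _).
  by have := set22 i j; rewrite E1 => /set2P[] // ji; rewrite ji eqxx in ij.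
by have := set22 i l; rewrite E2 => /set2P[] // li; rewrite li eqxx in il.
Qed.

(** Words of two edges sharing exactly one vertex correspond to ordered triples, with the shared
    vertex first; [F] is carried to such words and extended by 0. *)
Definition triangle_sum (F : triple -> k) P Q : k := \sum_(t : triple | distinct t)
  ((P == [set t.1.1; t.1.2]) && (Q == [set t.1.1; t.2]))%:R * F t.

Lemma triangle_sum_distinct F (t : triple) : distinct t ->
  triangle_sum F [set t.1.1; t.1.2] [set t.1.1; t.2] = F t.
Proof.
move=> Ut; rewrite /triangle_sum (bigD1 t) //= !eqxx mul1r big1 ?addr0 // => t' /andP[Ut' tt'].
case: andP => [[/eqP E1 /eqP E2]|_]; last by rewrite mul0r.
by rewrite (distinct_inj Ut Ut' E1 E2) eqxx in tt'.
Qed.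

Lemma triangle_sum_apart F P Q : apart P Q -> triangle_sum F P Q = 0.
Proof.
move=> PQ; rewrite /triangle_sum big1 // => t Ut; case: andP => [[/eqP E1 /eqP E2]|_]; last by rewrite mul0r.
move: PQ; rewrite /apart E1 E2 => /orP[/eqP E|/disjointFr /(_ (set21 _ _))]; last by rewrite set21.
move: Ut; rewrite /= !inE !negb_or !andbT => /andP[/andP[ij _] jl].
have := set22 t.1.1 t.1.2; rewrite E => /set2P[] e; [by rewrite e eqxx in ij|by rewrite e eqxx in jl].
Qed.

(** The sum over the six orderings of a triangle with the signature as sign. Modulo symmetric
    functions, the Orlik-Solomon relation of the triangle is this alternating vector, of squared
    length 6, whence the 1/6 in [proj]. *)
Definition alt phi (t : triple) : k := let: (i, j, l) := t in
  phi [set i; j] [set i; l] - phi [set i; l] [set i; j]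
  + (phi [set j; l] [set j; i] - phi [set j; i] [set j; l])
  + (phi [set l; i] [set l; j] - phi [set l; j] [set l; i]).

(* The orthogonal projection onto the span of the relations. *)
Definition proj phi P Q : k :=
  2%:R^-1 * (phi P Q + phi Q P) + 6%:R^-1 * triangle_sum (alt phi) P Q.

Let two0 : 2%:R != 0 :> k := natk_neq0 k0 1.
Let three0 : 3%:R != 0 :> k := natk_neq0 k0 2.
Let six0 : 6%:R != 0 :> k := natk_neq0 k0 5.

Lemma proj_id phi (A B : gen n) : pair_rels phi ->
  proj phi (val A) (val B) = phi (val A) (val B).
Proof.
move=> phiP; have pt := pr_triangle phiP; rewrite /proj.
have [AB|[i [j [l [Ut -> ->]]]]] := gen_cases A B.
  rewrite triangle_sum_apart // mulr0 addr0 -(pair_rels_apart phiP AB).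
  by rewrite -mulr2n -[phi _ _ *+ 2]mulr_natl mulKf.
rewrite (@triangle_sum_distinct _ (i, j, l)) // /alt.
have U' : uniq [:: j; l; i].
  by move: Ut; rewrite /= !inE !negb_or !andbT (eq_sym j i) (eq_sym l i) => /andP[/andP[-> ->] ->].
have := pt i j l Ut; have := pt j l i U'.
rewrite !(setUC [set j] [set i], setUC [set l] [set i], setUC [set l] [set j]).
move=> /(canRL (addKr _)) H2 /(canRL (addKr _)) H3; rewrite H2 H3; field.
by rewrite two0 six0.
Qed.

Lemma proj_rels phi : pair_rels (proj phi).
Proof.
split=> [i j l m U|i j l U]; rewrite /proj.
  have D := disjoint_set2 U.
  have D' : [disjoint [set l; m] & [set i; j]] by rewrite disjoint_sym.
  rewrite !triangle_sum_apart /apart ?D ?D' ?orbT // !mulr0 !addr0; congr (_ * _); exact: addrC.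
have T (a b c : 'I_n) : uniq [:: a; b; c] -> triangle_sum (alt phi) [set a; b] [set a; c] = alt phi (a, b, c).
  exact: (@triangle_sum_distinct _ (a, b, c)).
have P x y z : uniq [:: x; y; z] = [&& x != y, x != z & y != z :> 'I_n].
  by rewrite /= !inE negb_or andbT -andbA.
move: U; rewrite P => /and3P[ij il jl].
have [ji li lj] : [/\ j != i, l != i & l != j] by split; rewrite eq_sym.
rewrite (T i j l); last by rewrite P ij il jl.
rewrite (T i l j); last by rewrite P ij il lj.
rewrite -(setUC [set j] [set i]) (T j i l); last by rewrite P ji il jl.
rewrite (T j l i); last by rewrite P ji li jl.
rewrite /alt !(setUC [set j] [set i], setUC [set l] [set i], setUC [set l] [set j]).
by ring.
Qed.

Local Notation ind w := (fun P Q => (is_word2 w P Q)%:R : k).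

Lemma is_word2E (w : word n 2) (A B : gen n) : is_word2 w (val A) (val B) = (w ord0 == A) && (w ord_max == B).
Proof. by rewrite /is_word2 !(inj_eq val_inj). Qed.

Lemma sum_ind phi (A B : gen n) : 
  \sum_w ind w (val A) (val B) * phi (val (w ord0)) (val (w ord_max)) = phi (val A) (val B).
Proof. by rewrite -(sum_at2 phi); apply: eq_bigr => w _; rewrite is_word2E. Qed.

Lemma gen_ex i j : i != j -> exists A : gen n, val A = [set i; j].
Proof.
move=> ij; have H : #|[set i; j]| == 2%N by rewrite cards2 ij. 
by exists (exist (fun P : {set 'I_n} => #|P| == 2%N) _ H).
Qed.

Lemma sum_alt phi (t : triple) : distinct t ->
  \sum_w alt (ind w) t * phi (val (w ord0)) (val (w ord_max)) = alt phi t.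
Proof.
case: t => [[i j] l]; rewrite /= !inE negb_or andbT => /andP[/andP[ij il] jl].
have [A EA] := gen_ex ij; have [B EB] := gen_ex il; have [C EC] := gen_ex jl.
rewrite /alt !(setUC [set j] [set i], setUC [set l] [set i], setUC [set l] [set j]) -EA -EB -EC.
rewrite -!(sum_ind phi) -!sumrB -!big_split /=; apply: eq_bigr => w _.
by rewrite !mulrDl !mulNr.
Qed.

(** The functions [ind w] are the unit vectors of T^2, so this exhibits the matrix of [proj]. *)
Lemma sum_proj phi (A B : gen n) :
  \sum_w proj (ind w) (val A) (val B) * phi (val (w ord0)) (val (w ord_max)) = proj phi (val A) (val B).
Proof.
rewrite /proj -[in RHS](sum_ind phi A B) -[in RHS](sum_ind phi B A) -big_split mulr_sumr.
rewrite /triangle_sum [in RHS](eq_bigr (fun t => \sum_w ((val A == [set t.1.1; t.1.2]) && (val B == [set t.1.1; t.2]))%:R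
    * (alt (ind w) t * phi (val (w ord0)) (val (w ord_max))))); last first.
  by move=> t Ut; rewrite -mulr_sumr sum_alt.
rewrite exchange_big mulr_sumr -big_split; apply: eq_bigr => w _ /=.
rewrite mulrDl -mulrA mulrDl; congr (_ + _); rewrite -mulrA; congr (_ * _).
by rewrite mulr_suml; apply: eq_bigr => t _; rewrite mulrA.
Qed.

End DegreeTwo.

(** * The degree two character and its double *)

Section DegreeTwoTrace.
Variables (k : fieldType) (n : nat).
Hypothesis k0 : [pchar k] =i pred0.
Implicit Types (i j l : 'I_n) (P Q : {set 'I_n}) (phi : {set 'I_n} -> {set 'I_n} -> k).
Local Notation triple := ('I_n * 'I_n * 'I_n)%type.
Local Notation distinct t := (uniq [:: t.1.1; t.1.2; t.2]).
Local Notation ind w := (fun P Q => (is_word2 w P Q)%:R : k).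
Local Notation J := (Jsq k n 2).

Definition projmx : 'M[k]_#|word n 2| :=
  \matrix_(u, w) let v : word n 2 := enum_val u in proj (ind (enum_val w)) (val (v ord0)) (val (v ord_max)).

Lemma projmxE (x : word n 2) q :
  projmx (enum_rank x) q = proj (ind (enum_val q)) (val (x ord0)) (val (x ord_max)).
Proof. by rewrite mxE enum_rankK. Qed.

Lemma splice2 (w x : word n 2) : splice w ord0 x = x.
Proof.
apply/ffunP => t; rewrite ffunE; have [->|t0] := eqVneq t ord0; first by [].
by have -> : t = ord_max by apply: val_inj; case: t t0 => [[|[|]]].
Qed.

Lemma Jsq_projmx : J *m projmx = 0.
Proof.
apply/eqP; rewrite -sub_kermx genmxE; apply/sub_kermxP/matrixP => c q.
rewrite Jmx_mul [RHS]mxE; case: (enum_val c) => [[p w] u]; case: ifP => // ltp.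
have -> : p = ord0 by apply: val_inj; case: p ltp => [[|]].
under eq_bigr => x _ do rewrite splice2 projmxE.
exact/(pair_rels_perp k0)/proj_rels.
Qed.

Lemma projmx_sub1 : (projmx - 1%:M <= J)%MS.
Proof.
have PI : (projmx - 1%:M <= I2perp k n)%MS.
  apply/sub_kermxP; rewrite mulmxBl mul1mx; apply/eqP; rewrite subr_eq0; apply/eqP/matrixP => u r.
  rewrite [RHS]mxE [in RHS]mxE relcoefE -(proj_id k0 _ _ (rel_set_rels k _)) -sum_proj [RHS]sum_enum_val mxE.
  by apply: eq_bigr => w _; rewrite !mxE relcoefE.
apply/row_subP => u; apply: submx_trans (row_sub _ _) (submx_trans PI _).
apply/row_subP => q; rewrite genmxE; have := row_sub (enum_rank (@ord0 1, enum_val u, q)) (Jmx k n 2).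
congr (_ <= _)%MS; apply/rowP => c; rewrite [LHS]mxE [LHS]mxE enum_rankK /= [RHS]mxE.
rewrite (bigD1 (enum_val c)) //= splice2 eqxx mulr1 enum_valK big1 ?addr0 // => x xc.
by rewrite splice2 eq_sym (negbTE xc) mulr0.
Qed.

(** [projmx] is killed by J on the left and is the identity modulo J, so it projects T^2 along J
    onto a complement, on which the trace of the quotient can be read. *)
Lemma dual_trace2_projmx s : dual_trace k 2 s = \tr (Tmx k 2 s *m projmx).
Proof.
have [Z ZG] := row_fullP (row_full_PBWmx k n 2).
have PG : projmx *m PBWmx k n 2 = PBWmx k n 2.
  apply/eqP; rewrite -subr_eq0 -[X in _ - X]mul1mx -mulmxBl; apply/eqP.
  by have /submxP[D ->] := projmx_sub1; rewrite -mulmxA Jsq_PBWmx ?mulmx0.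
have PE : projmx = PBWmx k n 2 *m (Z *m projmx).
  apply/eqP; rewrite -subr_eq0 mulmxA -{1}[projmx]mul1mx -mulmxBl; apply/eqP.
  have /ker_PBWmx/submxP[D ->] : (1%:M - PBWmx k n 2 *m Z) *m PBWmx k n 2 = 0.
    by rewrite mulmxBl mul1mx -mulmxA ZG mulmx1 subrr.
  by rewrite -mulmxA Jsq_projmx mulmx0.
rewrite PE mulmxA Tmx_PBWmx mxtrace_mulC !mulmxA -(mulmxA Z) PG ZG mul1mx /dual_trace big_tnth.
by apply: eq_bigr => p _; rewrite mxE.
Qed.

Definition act3 (t : triple) (s : 'S_n) : triple := (s t.1.1, s t.1.2, s t.2).
Definition rot3 (t : triple) : triple := (t.1.2, t.2, t.1.1).
Definition swap3 (t : triple) : triple := (t.1.1, t.2, t.1.2).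
Definition count3 (s : 'S_n) (h : triple -> triple) : nat :=
  #|[set t in [set t : triple | distinct t] | act3 t s == h t]|.
Definition wswap (w : word n 2) : word n 2 := [ffun t => w (rev_ord t)].
Definition apart_words : {set word n 2} := [set w : word n 2 | apart (val (w ord0)) (val (w ord_max))].
Definition count2 (s : 'S_n) (h : word n 2 -> word n 2) : nat :=
  #|[set w : word n 2 in apart_words | word_act s w == h w]|.

Lemma sum_words phi : \sum_(w : word n 2) phi (val (w ord0)) (val (w ord_max)) =
  \sum_(w : word n 2 | w \in apart_words) phi (val (w ord0)) (val (w ord_max)) +
  \sum_(t : triple | distinct t) phi [set t.1.1; t.1.2] [set t.1.1; t.2].
Proof.
transitivity (\sum_(w : word n 2 | w \in apart_words) phi (val (w ord0)) (val (w ord_max)) +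
   \sum_(w : word n 2) triangle_sum (fun _ : triple => 1) (val (w ord0)) (val (w ord_max)) *
     phi (val (w ord0)) (val (w ord_max))).
  rewrite [X in X + _]big_mkcond -big_split /=; apply: eq_bigr => w _; rewrite inE.
  case: ifP => [A|nA]; first by rewrite triangle_sum_apart // mul0r addr0.
  have [|[i [j [l [Ut -> ->]]]]] := gen_cases (w ord0) (w ord_max); first by rewrite nA.
  by rewrite (@triangle_sum_distinct _ _ _ (i, j, l)) // mul1r add0r.
congr (_ + _); under eq_bigr => w _ do rewrite mulr_suml.
rewrite exchange_big; apply: eq_bigr => t Ut /=.
move: (Ut); rewrite /= !inE negb_or andbT => /andP[/andP[ij il] _].
have [A EA] := gen_ex ij; have [B EB] := gen_ex il.
rewrite -EA -EB -(sum_ind phi); apply: eq_bigr => w _.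
by rewrite mulr1 /is_word2.
Qed.

Lemma tr_Tmx_projmx s : \tr (Tmx k 2 s *m projmx) =
  \sum_(w : word n 2) proj (ind w) (s @: val (w ord0)) (s @: val (w ord_max)).
Proof.
rewrite sum_enum_val; apply: eq_bigr => u _; set w := enum_val u.
rewrite mxE (bigD1 (enum_rank (word_act s w))) //= projmxE mxE enum_rankK eqxx mul1r big1 ?addr0.
  by rewrite !ffunE.
by move=> v vw; rewrite mxE -(inj_eq enum_rank_inj) enum_valK eq_sym (negbTE vw) mul0r.
Qed.

Lemma ord2 (t : 'I_2) : t = ord0 \/ t = ord_max.
Proof. by case: t => [[|[|]]] // H; [left|right]; apply: val_inj. Qed.

Lemma word_eq (w w' : word n 2) : (w == w') = (w ord0 == w' ord0) && (w ord_max == w' ord_max).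
Proof.
apply/eqP/andP => [->|[/eqP E0 /eqP E1]] //; apply/ffunP => t.
by case: (ord2 t) => ->.
Qed.

Lemma word_fixE (s : 'S_n) (w : word n 2) :
  is_word2 w (s @: val (w ord0)) (s @: val (w ord_max)) = (word_act s w == w).
Proof.
rewrite word_eq !ffunE -!val_eqE /is_word2 /=.
by rewrite eq_sym (eq_sym (val (w ord_max))).
Qed.

Lemma word_swapE (s : 'S_n) (w : word n 2) :
  is_word2 w (s @: val (w ord_max)) (s @: val (w ord0)) = (word_act s w == wswap w).
Proof.
rewrite word_eq !ffunE -!val_eqE /is_word2 andbC eq_sym (eq_sym (val (w ord0))).
have -> : rev_ord ord0 = ord_max :> 'I_2 by apply: val_inj.
by have -> : rev_ord ord_max = ord0 :> 'I_2 by apply: val_inj.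
Qed.

Lemma distinct_act (s : 'S_n) t : distinct (act3 t s) = distinct t.
Proof. by rewrite /= !inE !(inj_eq perm_inj). Qed.

Lemma act3E (s : 'S_n) i j l (t : triple) : distinct t -> uniq [:: i; j; l] ->
  (s @: [set i; j] == [set t.1.1; t.1.2]) && (s @: [set i; l] == [set t.1.1; t.2])
  = (act3 (i, j, l) s == t).
Proof.
move=> Ut U; rewrite !imsetU1 !imset_set1; apply/andP/eqP => [[/eqP E1 /eqP E2]|<- //=].
by apply: distinct_inj => //; rewrite distinct_act.
Qed.

Lemma count3E (s : 'S_n) h : (count3 s h)%:R = \sum_(t : triple | distinct t) (act3 t s == h t)%:R :> k.
Proof.
rewrite /count3 -sum1dep_card natr_sum big_mkcondr /=.
by apply: eq_big => [t|t _]; rewrite ?inE //; case: eqP.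
Qed.

(** The three odd orderings give equal counts after renaming the triples, hence the coefficient 3;
    the identity and the two rotations remain separate. *)
Lemma tr_alternating (s : 'S_n) :
  \sum_(w : word n 2) triangle_sum (alt (ind w)) (s @: val (w ord0)) (s @: val (w ord_max)) =
  (count3 s id)%:R - 3%:R * (count3 s swap3)%:R + (count3 s rot3)%:R
  + (count3 s (rot3 \o rot3))%:R.
Proof.
pose F (t : triple) P Q : k :=
  ((s @: P == [set t.1.1; t.1.2]) && (s @: Q == [set t.1.1; t.2]))%:R.
transitivity (\sum_(t : triple | distinct t) alt (F t) t).
  rewrite exchange_big; apply: eq_bigr => t Ut; rewrite -sum_alt //.
  by apply: eq_bigr => w _; rewrite mulrC.
have U6 i j l : uniq [:: i; j; l] -> [/\ uniq [:: i; l; j], uniq [:: j; l; i],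
    uniq [:: j; i; l], uniq [:: l; i; j] & uniq [:: l; j; i]].
  rewrite /= !inE !negb_or !andbT => /andP[/andP[ij il] jl].
  by rewrite ij il jl (eq_sym j i) (eq_sym l i) (eq_sym l j) ij il jl.
have E3 i j l i' j' l' : ((i, j, l) == (i', j', l') :> triple) = [&& i == i', j == j' & l == l'].
  by rewrite !xpair_eqE andbA.
transitivity (\sum_(t : triple | distinct t) ((act3 t s == id t)%:R - (act3 t s == swap3 t)%:R
   + ((act3 t s == (rot3 \o rot3) t)%:R - (act3 (rot3 (rot3 t)) s == swap3 (rot3 (rot3 t)))%:R)
   + ((act3 t s == rot3 t)%:R - (act3 (t.1.2, t.1.1, t.2) s == swap3 (t.1.2, t.1.1, t.2))%:R) : k)).
  apply: eq_bigr => -[[i j] l] Ut; have [U1 U2 U3 U4 U5] := U6 i j l Ut.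
  rewrite /alt /F !act3E //= /act3 /swap3 /rot3 /= !E3.
  congr (_%:R - _%:R + (_%:R - _%:R) + (_%:R - _%:R));
    by do !case: (_ == _).
rewrite !big_split /= !sumrN -!count3E.
have R1 (h : triple -> triple) (G : triple -> k) : bijective h -> (forall t, distinct (h t) = distinct t) ->
  \sum_(t : triple | distinct t) G (h t) = \sum_(t : triple | distinct t) G t.
  move=> hb hd; rewrite [RHS](reindex h (onW_bij _ hb)).
  by apply: eq_bigl => t; apply/esym/hd.
rewrite (R1 (rot3 \o rot3) (fun t => (act3 t s == swap3 t)%:R)); last 2 first.
- by exists rot3 => -[[i j] l].
- by move=> [[i j] l]; apply/idP/idP => /U6[].
rewrite (R1 (fun t => (t.1.2, t.1.1, t.2)) (fun t => (act3 t s == swap3 t)%:R)); last 2 first.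
- by exists (fun t => (t.1.2, t.1.1, t.2)) => -[[i j] l].
- by move=> [[i j] l]; apply/idP/idP => /U6[].
by rewrite -!count3E; ring.
Qed.

Lemma count2E (s : 'S_n) h : (count2 s h)%:R = \sum_(w : word n 2 | w \in apart_words) (word_act s w == h w)%:R :> k.
Proof.
rewrite /count2 -sum1dep_card natr_sum big_mkcondr /=.
by apply: eq_bigr => t _; case: eqP.
Qed.

Lemma sum_word_fix (s : 'S_n) : \sum_(w : word n 2) (word_act s w == w)%:R = (count2 s id)%:R + (count3 s id)%:R :> k.
Proof.
pose phi P Q : k := ((s @: P == P) && (s @: Q == Q))%:R.
have E (w : word n 2) : (word_act s w == w)%:R = phi (val (w ord0)) (val (w ord_max)).
  by rewrite -word_fixE /phi /is_word2 eq_sym (eq_sym (val (w ord_max))).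
rewrite (eq_bigr _ (fun w _ => E w)) sum_words count2E count3E; congr (_ + _).
  by apply: eq_bigr => w _; rewrite E.
by apply: eq_bigr => -[[i j] l] Ut; rewrite /phi act3E.
Qed.

Lemma sum_word_swap (s : 'S_n) : \sum_(w : word n 2) (word_act s w == wswap w)%:R =
  (count2 s wswap)%:R + (count3 s swap3)%:R :> k.
Proof.
pose phi P Q : k := ((s @: P == Q) && (s @: Q == P))%:R.
have E (w : word n 2) : (word_act s w == wswap w)%:R = phi (val (w ord0)) (val (w ord_max)).
  by rewrite -word_swapE /phi /is_word2 andbC eq_sym (eq_sym (val (w ord0))).
rewrite (eq_bigr _ (fun w _ => E w)) sum_words count2E count3E; congr (_ + _).
  by apply: eq_bigr => w _; rewrite E.
apply: eq_bigr => -[[i j] l] Ut; rewrite /phi (@act3E _ _ _ _ (swap3 (i, j, l))) //.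
move: Ut; rewrite /= !inE !negb_or !andbT => /andP[/andP[-> ->]].
by rewrite eq_sym.
Qed.

(** The symmetric part contributes [count3 s swap3] to the double and the alternating part removes
    it again. This cancellation leaves only nonnegative terms, and the last bracket over 3 is a
    Burnside count of orbits under rotation. *)
Lemma dual_trace2_counts (s : 'S_n) : 2%:R * dual_trace k 2 s =
  (count2 s id)%:R + (count2 s wswap)%:R + (count3 s id)%:R +
  3%:R^-1 * ((count3 s id)%:R + (count3 s rot3)%:R + (count3 s (rot3 \o rot3))%:R).
Proof.
have two0 : 2%:R != 0 :> k := natk_neq0 k0 1.
have three0 : 3%:R != 0 :> k := natk_neq0 k0 2.
have six0 : 6%:R != 0 :> k := natk_neq0 k0 5.
rewrite dual_trace2_projmx tr_Tmx_projmx big_split /= -!mulr_sumr big_split /= tr_alternating.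
rewrite (eq_bigr _ (fun w _ => congr1 (fun b : bool => b%:R) (word_fixE s w))) sum_word_fix.
rewrite (eq_bigr _ (fun w _ => congr1 (fun b : bool => b%:R) (word_swapE s w))) sum_word_swap.
by field; rewrite two0 three0 six0.
Qed.

Lemma dsum_rep d c (rho : 'S_n -> 'M[k]_d) : is_rep rho -> is_rep (dsum c rho).
Proof.
move=> [r1 rM]; split=> [|s t]; rewrite /dsum.
  by rewrite (eq_mxdiag (fun=> r1)) mxdiagZ.
rewrite (eq_mxdiag (fun=> rM s t)) [X in _ = _ *m X]/mxdiag mul_mxdiag_mxblock.
apply/eq_mxblockP => i j; have [E|_] := eqVneq i j; last by rewrite mulmx0.
by subst i; rewrite !conform_mx_id.
Qed.

Lemma two_tr_perm_char : exists2 chi, @perm_char n chi &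
  forall s : 'S_n, 2%:R * dual_trace k 2 s = (chi s)%:R.
Proof.
have two0 : 2%:R != 0 :> k := natk_neq0 k0 1.
have three0 : 3%:R != 0 :> k := natk_neq0 k0 2.
have act3_1 (t : triple) : act3 t 1%g = t by rewrite /act3 !perm1; case: t => [[]].
have act3M (t : triple) (s s' : 'S_n) : act3 t (s * s')%g = act3 (act3 t s) s'.
  by rewrite /act3 !permM.
pose U := [set t : triple | distinct t].
have actU (t : triple) (s : 'S_n) : t \in U -> act3 t s \in U by rewrite !inE distinct_act.
have apart_act (w : word n 2) (s : 'S_n) : w \in apart_words -> word_act s w \in apart_words.
  rewrite !inE /apart !ffunE /= (inj_eq (imset_inj perm_inj)) => /orP[->//|D]; apply/orP; right.
  by rewrite imset_disjoint //; apply: perm_inj.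
have apart_swap (w : word n 2) : w \in apart_words -> wswap w \in apart_words.
  have -> : wswap w \in apart_words = apart (val (w ord_max)) (val (w ord0)).
    rewrite inE !ffunE; congr (apart (val (w _)) (val (w _))); exact: val_inj.
  by rewrite inE /apart eq_sym disjoint_sym.
have [||||||chi2 P2 E2] := @perm_char_cyclic n 0 (word n 2) (fun w s => word_act s w) apart_words wswap.
- exact: word_act1.
- by move=> w s t; apply: word_actM.
- by move=> w s; apply/ffunP => a; rewrite !ffunE.
- by move=> w; apply/ffunP => a; rewrite !ffunE rev_ordK.
- exact: apart_act.
- exact: apart_swap.
(* The trivial involution: its orbits are the points of [U], so this yields the permutation
   character of the ordered triples, counted twice in [EU]. *)
have [|||chiU PU EU] := @perm_char_cyclic n 0 _ act3 U id act3_1 act3M _ _ actU.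
- by [].
- by [].
- by [].
have [|||chiC PC EC] := @perm_char_cyclic n 1 _ act3 U rot3 act3_1 act3M _ _ actU.
- by [].
- by move=> [[i j] l].
- move=> [[i j] l]; rewrite !inE /= !inE !negb_or !andbT (eq_sym j i) (eq_sym l i).
  by move=> /andP[/andP[-> ->] ->].
exists (fun s => 2 * chi2 s + chiU s + chiC s)%N.
  by do 2![apply: perm_charD => //]; apply: perm_charMn.
move=> s; rewrite dual_trace2_counts.
have := E2 s; have := EU s; have := EC s; rewrite !big_ord_recl !big_ord0 /=.
rewrite !addn0 -!/(count3 s _) -/(count2 s id) -/(count2 s wswap) => EC' EU' E2'.
have -> : chiU s = count3 s id.
  by apply/eqP; rewrite -(eqn_pmul2l (isT : 0 < 2)%N) EU' mul2n addnn.
rewrite -!natrD -E2' -(addnA (count3 s id) (count3 s rot3)) -EC' natrM mulKf //.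
by rewrite -natrD.
Qed.

Lemma perm_module_degree2 : perm_module (dsum 2 (OSdual_mx (k := k) n 2)).
Proof.
have [chi [X [to toE]] chiE] := two_tr_perm_char.
apply: (perm_moduleP k0 (to := to)); first exact/dsum_rep/OSdual_rep.
by move=> s; rewrite tr_dsum tr_OSdual // chiE toE.
Qed.

End DegreeTwoTrace.

Theorem theorem11p15 (k : fieldType) (chark0 : [pchar k] =i pred0) :
  (* (i) degrees 0 and 1 are permutation modules, for all n *)
  (forall n i : nat, (0 < n)%N -> (i <= 1)%N ->
     perm_module (OSdual_mx (k:=k) n i))
  (* (ii) degree 2 is a half-permutation module: 2 [M] = [k[X]] *)
  /\ (forall n : nat, (0 < n)%N ->
     perm_module (dsum 2 (OSdual_mx (k:=k) n 2)))
  (* (iii) for n = 1,...,5 every degree is a permutation module *)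
  /\ (forall n i : nat, (0 < n <= 5)%N ->
     perm_module (OSdual_mx (k:=k) n i))
  (* for n = 6, 7 the degree-5 part is not a permutation module, no positive
     multiple of its class is the class of a permutation module, and it has a
     negative character value *)
  /\ (forall n : nat, (n == 6)%N || (n == 7)%N ->
       [/\ ~ perm_module (OSdual_mx (k:=k) n 5),
           (forall c : nat, (0 < c)%N -> ~ perm_module (dsum c (OSdual_mx (k:=k) n 5)))
         & exists (s : 'S_n) (z : int), z < 0 /\ \tr (OSdual_mx (k:=k) n 5 s) = z%:~R]).
Proof.
split=> [n i _ i1|]; first exact/perm_trace_module/perm_trace_low.
split=> [n _|]; first exact: perm_module_degree2.
split=> [n i|n n67].
  case/andP; case: n => [|[|[|[|[|[|n]]]]]] // _ _; apply: perm_trace_module => //.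
  - exact: perm_trace1.
  - exact: perm_trace2.
  - exact: perm_trace3.
  - exact: perm_trace4.
  - exact: perm_trace5.
have [s trN] := sixcycle_trace chark0 n67; split.
- exact: not_perm_module trN.
- by move=> c c_gt0; apply: dsum_not_perm_module trN.
by exists s, (-1).
Qed.
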